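(* Let $n\ge 2$, let $(M,g)$ be an oriented Lorentzian $(n+1)$-manifold of class $C^r$ ($r\ge 3$), let $U\subset\mathbb{R}^n$ be a domain, and let $F:U\to M$ be a $C^2$-differentiable light-like hypersurface (an immersion of class $C^2$ with $B_F\equiv 0$ on $U$). Then $F(U)$ is foliated by light-like geodesics of $M$.
   Context: The signature of $g$ is $(-,+,\dots,+)$; the underlying manifold is taken real analytic and $g$ of class $C^r$. For an immersion $F:U\to M$ with coordinates $(u_1,\dots,u_n)$ on $U$, $B_F=\det\big(g(F_{u_i},F_{u_j})\big)_{i,j=1}^n$ is the determinant of the first fundamental form, where $F_{u_i}=dF(\partial/\partial u_i)$. $F$ is called light-like if $B_F$ vanishes identically. A light-like geodesic is a geodesic $\sigma$ of $M$ with $\sigma'\ne0$ and $g(\sigma',\sigma')=0$, regarded up to reparametrization. Since $F$ is an immersion, ''$F(U)$ is foliated by light-like geodesics'' means that $U$ is foliated by curves whose images under $F$ are (after reparametrization) light-like geodesics of $M$. *)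

(* Defs.v *)
From mathcomp Require Import all_boot all_order all_algebra.
From mathcomp Require Import all_classical all_reals all_analysis.
Import Order.TTheory GRing.Theory Num.Theory.
Import numFieldNormedType.Exports.

Set Implicit Arguments.
Unset Strict Implicit.
Unset Printing Implicit Defensive.

Local Open Scope classical_set_scope.
Local Open Scope ring_scope.

(** Differential calculus on open subsets of R^m. *)

Definition pd (R : realType) (m : nat) (W : normedModType R) (i : 'I_m)
    (f : 'rV[R]_m -> W) : 'rV[R]_m -> W :=
  'D_(delta_mx 0 i) f.

(* Meant for open [V]: all iterated partial derivatives up to order [k] exist
   and are continuous at every point of [V]. *)
Fixpoint Ck (R : realType) (m : nat) (W : normedModType R) (k : nat)
    (V : set 'rV[R]_m) (f : 'rV[R]_m -> W) : Prop :=
  (forall x, V x -> {for x, continuous f}) /\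
  match k with
  | 0%N => True
  | k'.+1 => forall i : 'I_m,
      (forall x, V x -> derivable f x (delta_mx 0 i)) /\ Ck k' V (pd i f)
  end.

Definition monomial (R : realType) (m : nat) (alpha : 'I_m -> nat)
    (x : 'rV[R]_m) : R :=
  \prod_(i < m) x 0 i ^+ alpha i.

(* Real analytic on the open set [V]: of class C^oo and, near every point, the
   sum of an absolutely convergent power series (necessarily the Taylor series).
   The sum is the limit of the partial sums over {0, ..., N-1}^m. *)
Definition real_analytic (R : realType) (m : nat) (V : set 'rV[R]_m)
    (f : 'rV[R]_m -> R) : Prop :=
  (forall k, Ck k V f) /\
  forall a, V a -> exists c : {ffun 'I_m -> nat} -> R,
    \forall x \near a,
      summable [set: {ffun 'I_m -> nat}]
        (fun alpha => (c alpha * monomial alpha (x - a))%:E) /\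
      (fun N : nat => \sum_(b : {ffun 'I_m -> 'I_N})
         let alpha := [ffun i => nat_of_ord (b i)] in
         c alpha * monomial alpha (x - a)) @ \oo --> f x.

(** Manifolds. The functions [cmap] and [cinv] are total; their values outside
    [cdom] and [ccod] carry no meaning. *)

Record chart (R : realType) (m : nat) (M : topologicalType) : Type := Chart {
  cdom : set M;
  cmap : M -> 'rV[R]_m;
  cinv : 'rV[R]_m -> M;
  cdom_open : open cdom;
  ccod_open : open (cmap @` cdom);
  cmapK : forall p, cdom p -> cinv (cmap p) = p;
  cmap_continuous : {within cdom, continuous cmap};
  cinv_continuous : {within cmap @` cdom, continuous cinv} }.

Definition ccod (R : realType) (m : nat) (M : topologicalType)
    (phi : chart R m M) : set 'rV[R]_m :=
  cmap phi @` cdom phi.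

Definition transition (R : realType) (m : nat) (M : topologicalType)
    (phi psi : chart R m M) : 'rV[R]_m -> 'rV[R]_m :=
  cmap psi \o cinv phi.

Definition transition_dom (R : realType) (m : nat) (M : topologicalType)
    (phi psi : chart R m M) : set 'rV[R]_m :=
  cmap phi @` (cdom phi `&` cdom psi).

Record oriented_analytic_manifold (R : realType) (m : nat) (M : topologicalType)
    (A : set (chart R m M)) : Prop := {
  manifold_hausdorff : hausdorff_space M;
  manifold_second_countable : @second_countable M;
  atlas_cover : forall p : M, exists2 phi, A phi & cdom phi p;
  atlas_analytic : forall phi psi, A phi -> A psi -> forall j : 'I_m,
    real_analytic (transition_dom phi psi) (fun y => transition phi psi y 0 j);
  atlas_oriented : forall phi psi, A phi -> A psi -> forall y,
    transition_dom phi psi y -> 0 < \det ('J (transition phi psi) y) }.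

(** Lorentzian metrics, given in each chart by the matrix of their components
    [g phi y i j] = g(d/dy_i, d/dy_j). *)

Definition gform (R : realType) (m : nat) (G : 'M[R]_m) (v w : 'rV[R]_m) : R :=
  (v *m G *m w^T) 0 0.

Definition lorentz_signature (R : realType) (m : nat) (G : 'M[R]_m) : Prop :=
  G^T = G /\
  exists2 P : 'M[R]_m, P \in unitmx &
    P *m G *m P^T = diag_mx (\row_(j < m) if j == 0%N :> nat then -1 else 1).

(* Vectors being rows, ['J tau y] acts on the right, which explains the shape
   of the transformation law of covariant 2-tensors. *)
Record lorentz_metric (R : realType) (m : nat) (M : topologicalType) (r : nat)
    (A : set (chart R m M)) (g : chart R m M -> 'rV[R]_m -> 'M[R]_m) : Prop := {
  metric_class : forall phi, A phi -> forall i j : 'I_m,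
    Ck r (ccod phi) (fun y => g phi y i j);
  metric_signature : forall phi, A phi -> forall y, ccod phi y ->
    lorentz_signature (g phi y);
  metric_change : forall phi psi, A phi -> A psi -> forall y,
    transition_dom phi psi y ->
    g phi y = 'J (transition phi psi) y *m g psi (transition phi psi y)
                *m ('J (transition phi psi) y)^T }.

(* The Christoffel symbol Gamma^k_{ij} of the components [G]. *)
Definition christoffel (R : realType) (m : nat) (G : 'rV[R]_m -> 'M[R]_m)
    (y : 'rV[R]_m) (k i j : 'I_m) : R :=
  2^-1 * \sum_(l < m) invmx (G y) k l *
    (pd i (fun z => G z j l) y + pd j (fun z => G z i l) y
     - pd l (fun z => G z i j) y).

Definition geodesic (R : realType) (m : nat) (M : topologicalType)
    (A : set (chart R m M)) (g : chart R m M -> 'rV[R]_m -> 'M[R]_m)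
    (I : set R) (sigma : R -> M) : Prop :=
  {within I, continuous sigma} /\
  forall phi, A phi -> forall t, I t -> cdom phi (sigma t) ->
    let x := cmap phi \o sigma in
    [/\ derivable x t 1, derivable (derive1 x) t 1 &
        forall k : 'I_m,
          derive1 (derive1 x) t 0 k
          + \sum_(i < m) \sum_(j < m)
              christoffel (g phi) (x t) k i j
                * derive1 x t 0 i * derive1 x t 0 j = 0].

Definition light_like_geodesic (R : realType) (m : nat) (M : topologicalType)
    (A : set (chart R m M)) (g : chart R m M -> 'rV[R]_m -> 'M[R]_m)
    (I : set R) (sigma : R -> M) : Prop :=
  geodesic A g I sigma /\
  forall phi, A phi -> forall t, I t -> cdom phi (sigma t) ->
    let x := cmap phi \o sigma in
    derive1 x t != 0 /\ gform (g phi (x t)) (derive1 x t) (derive1 x t) = 0.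

(** Immersed hypersurfaces. *)

Definition Ck_immersion (R : realType) (n m : nat) (M : topologicalType)
    (k : nat) (A : set (chart R m M)) (U : set 'rV[R]_n)
    (F : 'rV[R]_n -> M) : Prop :=
  {within U, continuous F} /\
  forall phi, A phi ->
    Ck k (U `&` F @^-1` cdom phi) (cmap phi \o F) /\
    (forall u, U u -> cdom phi (F u) -> injective ('d (cmap phi \o F) u)).

(* The determinant of the first fundamental form, computed in the chart [phi]
   around [F u]. *)
Definition B_F (R : realType) (n m : nat) (M : topologicalType)
    (g : chart R m M -> 'rV[R]_m -> 'M[R]_m) (F : 'rV[R]_n -> M)
    (phi : chart R m M) (u : 'rV[R]_n) : R :=
  \det (\matrix_(i < n, j < n)
          gform (g phi (cmap phi (F u)))
                (pd i (cmap phi \o F) u) (pd j (cmap phi \o F) u)).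

Definition light_like (R : realType) (n m : nat) (M : topologicalType)
    (A : set (chart R m M)) (g : chart R m M -> 'rV[R]_m -> 'M[R]_m)
    (U : set 'rV[R]_n) (F : 'rV[R]_n -> M) : Prop :=
  forall phi, A phi -> forall u, U u -> cdom phi (F u) -> B_F g F phi u = 0.

(** One-dimensional foliations of class C^1 of an open subset of R^n. *)

(* [h] is a C^1 diffeomorphism from [V] onto [W], with inverse [k]. *)
Definition C1_diffeo (R : realType) (n : nat) (V W : set 'rV[R]_n)
    (h k : 'rV[R]_n -> 'rV[R]_n) : Prop :=
  [/\ Ck 1 V h, Ck 1 W k, h @` V = W & forall x, V x -> k (h x) = x].

(* A decomposition of [U] into connected leaves such that, in suitable local
   coordinates [h] around each point, the components of the traces of the leaves
   are the curves where all coordinates but the first are constant. The norm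
   of ['rV[R]_n] being the sup norm, [ball 0 1] is the open cube ]-1, 1[^n. *)
Definition foliation_by_curves (R : realType) (n : nat) (U : set 'rV[R]_n)
    (leaves : set (set 'rV[R]_n)) : Prop :=
  [/\ partition leaves id U,
      forall L, leaves L -> connected L &
      forall p, U p -> exists (V : set 'rV[R]_n) (h k : 'rV[R]_n -> 'rV[R]_n),
        [/\ open V, V p, V `<=` U, C1_diffeo V (ball (0 : 'rV[R]_n) 1) h k &
            forall L x, leaves L -> (V `&` L) x ->
              connected_component (V `&` L) x =
              V `&` [set y | forall j : 'I_n, (0 < j)%N -> h y 0 j = h x 0 j]]].

(* Every leaf is parametrized by a curve [c] whose image under [F] is a
   light-like geodesic of M. When [F] is an immersion, a continuous [c] with
   [F \o c] regular of class C^1 is itself regular of class C^1. The curve [c]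
   may wind around a closed leaf. *)
Definition foliated_by_light_like_geodesics (R : realType) (n m : nat)
    (M : topologicalType) (A : set (chart R m M))
    (g : chart R m M -> 'rV[R]_m -> 'M[R]_m)
    (U : set 'rV[R]_n) (F : 'rV[R]_n -> M) : Prop :=
  exists leaves : set (set 'rV[R]_n),
    foliation_by_curves U leaves /\
    forall L, leaves L -> exists (I : set R) (c : R -> 'rV[R]_n),
      [/\ open I, is_interval I, {within I, continuous c}, c @` I = L &
          light_like_geodesic A g I (F \o c)].

(* Main.v *)
Require Import Defs.
From HB Require Import structures.
From mathcomp Require Import all_boot all_order all_algebra.
From mathcomp Require Import all_classical all_reals all_analysis.
From mathcomp Require Import perm.
From mathcomp Require Import ring lra.
Import Order.TTheory GRing.Theory Num.Theory.
Import numFieldNormedType.Exports.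

Set Implicit Arguments.
Unset Strict Implicit.
Unset Printing Implicit Defensive.

Local Open Scope classical_set_scope.
Local Open Scope ring_scope.
Implicit Types (R : realType) (n : nat).

(** Let B be the first fundamental form of F. Its determinant vanishes while F is an immersion
and the metric is nondegenerate. If v B = 0, the covector g(dF v, .) kills the image of dF, which
is a hyperplane; such covectors form a line, so the kernel of B is a line at every point
([kernel_line]). A formula for this line ([bordered_kernel]) shows that it is spanned, locally, by
a field X of class C^1 ([null_field_exists]).

The integral curves of X are light-like geodesics up to parametrization. Differentiate the
identities g(dF X, F_j) = 0 along X and g(dF X, dF X) = 0 along the j-th coordinate: since second
derivatives of F are symmetric, the covariant acceleration of dF X is orthogonal to every F_j
([acceleration_frame]), hence it is a multiple lam of dF X by the same dimension count. A curve
with c' = mu X is then mapped to a geodesic, affine parameter included, if and only if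
mu' = - lam mu^2 ([momentum_of_speed], [speed_of_momentum]). Geodesics are handled throughout by
the Euler-Lagrange equation of the energy, d/ds (G x') = dG(x', x') / 2 ([momentum_law]); it is
invariant under changes of chart ([momentum_change]) and implies the equation with Christoffel
symbols ([geodesic_of_momentum]).

It remains to see that these curves are the leaves of a foliation. The flow box theorem for X
([flow_box]) rests on the differentiability of the flow of a C^1 field in the initial point
([flow_derivable]). In a flow box, the curves with the right speed run along the lines of the
first coordinate, and each of them is determined by a position and a velocity ([box_of_flow]).
These two facts, together with the invariance of the curves under affine changes of parameter
and the fact that two of them through a point have the same direction, yield the foliation
([foliation_of_germs]): leaves are the images of maximal curves. *)

(** * Differential calculus for functions of a row vector *)

Lemma is_derive_row R (V : normedModType R) (n : nat) (c : V -> 'rV[R]_n) (t v : V)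
    (d : 'rV[R]_n) :
  (forall i, is_derive t v (fun s => c s 0 i) (d 0 i)) -> is_derive t v c d.
Proof.
move=> H; have D : derivable c t v.
  by apply/derivable_mxP => i j; rewrite (ord1 i); have [] := H j.
apply: DeriveDef => //; rewrite derive_mx //; apply/rowP => j.
by rewrite mxE; have [_ <-] := H j.
Qed.

Lemma is_derive_coord R (V : normedModType R) (n : nat) (c : V -> 'rV[R]_n) (t v : V)
    (d : 'rV[R]_n) (i : 'I_n) :
  is_derive t v c d -> is_derive t v (fun s => c s 0 i) (d 0 i).
Proof.
move=> [D <-]; apply: DeriveDef; first by move/derivable_mxP: D; apply.
by rewrite derive_mx // mxE.
Qed.

Lemma row_norm_ge R n (v : 'rV[R]_n) (i : 'I_n) : `|v 0 i| <= `|v|.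
Proof.
rewrite [leRHS]/Num.Def.normr/= mx_normrE.
exact: (le_bigmax _ (fun ij => `|v ij.1 ij.2|) (0, i)).
Qed.

Lemma row_norm_le R n (v : 'rV[R]_n) (a : R) :
  0 <= a -> (forall i, `|v 0 i| <= a) -> `|v| <= a.
Proof.
move=> a0 H; rewrite [leLHS]/Num.Def.normr/= mx_normrE; apply: bigmax_le => //.
by case=> i j _ /=; rewrite (ord1 i).
Qed.

Lemma row_norm_lt R n (v : 'rV[R]_n) (a : R) :
  0 < a -> (forall i, `|v 0 i| < a) -> `|v| < a.
Proof.
move=> a0 H; rewrite [ltLHS]/Num.Def.normr/= mx_normrE; apply/bigmax_ltP; split=> //.
by case=> i j _ /=; rewrite (ord1 i).
Qed.

Lemma mean_value R (u du : R -> R) (a b : R) :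
  a <= b -> (forall t, a <= t <= b -> is_derive t 1 u (du t)) ->
  exists2 c, a <= c <= b & u b - u a = du c * (b - a).
Proof.
move=> ab H; have [||c cab E] := @MVT_segment R u du a b ab.
- by move=> x /[!in_itv]/= /andP[/ltW ? /ltW ?]; apply: H; apply/andP.
- apply: continuous_in_subspaceT => x /[1!inE] /= /[!in_itv]/= xab.
  by apply/differentiable_continuous/derivable1_diffP; have [] := H x xab.
- by exists c => //; move: cab; rewrite in_itv.
Qed.

(** Both [v + u] and [v - u] are nondecreasing. *)
Lemma mean_value_le R (u du v dv : R -> R) (a b : R) :
  a <= b -> (forall t, a <= t <= b -> is_derive t 1 u (du t)) ->
  (forall t, a <= t <= b -> is_derive t 1 v (dv t)) ->
  (forall t, a <= t <= b -> `|du t| <= dv t) ->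
  `|u b - u a| <= v b - v a.
Proof.
move=> ab Hu Hv H.
have K (w dw : R -> R) : (forall t, a <= t <= b -> is_derive t 1 w (dw t)) ->
    (forall t, a <= t <= b -> 0 <= dw t) -> w a <= w b.
  move=> Hw H0; have [c cab E] := mean_value ab Hw.
  by rewrite -subr_ge0 E mulr_ge0 ?H0 ?subr_ge0.
rewrite ler_norml; apply/andP; split.
- have := K (v + u) (fun t => dv t + du t).
  have /[swap] /[apply] : forall t : R, a <= t <= b -> is_derive t 1 (v + u) (dv t + du t).
    by move=> t tab; have := Hu t tab; have := Hv t tab => ? ?; exact: is_deriveD.
  have /[swap] /[apply] : forall t : R, a <= t <= b -> 0 <= dv t + du t.
    by move=> t tab; have := H t tab; rewrite ler_norml => /andP[]; lra.
  by rewrite !fctE; lra.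
- have := K (v - u) (fun t => dv t - du t).
  have /[swap] /[apply] : forall t : R, a <= t <= b -> is_derive t 1 (v - u) (dv t - du t).
    by move=> t tab; have := Hu t tab; have := Hv t tab => ? ?; exact: is_deriveB.
  have /[swap] /[apply] : forall t : R, a <= t <= b -> 0 <= dv t - du t.
    by move=> t tab; have := H t tab; rewrite ler_norml => /andP[]; lra.
  by rewrite !fctE; lra.
Qed.

Lemma row_subE R n (v w : 'rV[R]_n) (i : 'I_n) :
  (v - w) 0 i = v 0 i - w 0 i.
Proof. by rewrite !mxE. Qed.

Lemma derive_of R (V W : normedModType R) (f : V -> W) (x v : V) (d : W) :
  is_derive x v f d -> 'D_v f x = d.
Proof. by move=> D; exact: derive_val. Qed.

Lemma mean_value_any R (u du : R -> R) (a b : R) :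
  (forall t, Num.min a b <= t <= Num.max a b -> is_derive t 1 u (du t)) ->
  exists2 c, Num.min a b <= c <= Num.max a b & u b - u a = du c * (b - a).
Proof.
have [ab|/ltW ba] := leP a b => H; first exact: mean_value.
have [c cab E] := mean_value ba H; exists c => //.
by rewrite -[LHS]opprB E -mulrN opprB.
Qed.

Lemma is_derive_line R (V W : normedModType R) (f : V -> W) (x v : V) (t : R) :
  derivable f (t *: v + x) v ->
  is_derive t 1 (fun s => f (s *: v + x)) ('D_v f (t *: v + x)).
Proof.
have E : (fun h : R => h^-1 *: (f ((h *: 1 + t) *: v + x) - f (t *: v + x))) =
         (fun h : R => h^-1 *: (f (h *: v + (t *: v + x)) - f (t *: v + x))).
  by apply/funext => h; rewrite scalerDl [h *: 1]mulr1 addrA.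
move=> D; split; first by rewrite /derivable /= E.
by rewrite /derive /= E.
Qed.

(** Walking from [b] to [a] parallel to the axes: the first [i] coordinates have been updated. *)
Definition mixed_row R n (a b : 'rV[R]_n) (i : nat) : 'rV[R]_n :=
  \row_(j < n) if (j < i)%N then a 0 j else b 0 j.

Lemma cvg_sum_ord R (V : normedModType R) (T : Type) (F : set_system T)
    (FF : Filter F) (n : nat) (f : 'I_n -> T -> V) (l : 'I_n -> V) :
  (forall i, f i x @[x --> F] --> l i) ->
  \sum_(i < n) f i x @[x --> F] --> \sum_(i < n) l i.
Proof.
by move=> H; apply: cvg_big => // -[u v]; exact: add_continuous.
Qed.

(** The mean value theorem on each of the [n] segments between consecutive [mixed_row]s; they lie
in the ball because the norm is the sup norm. For [c] the partial derivatives at a point, this is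
an estimate of strict differentiability there. *)
Lemma mean_telescope R n (f : 'rV[R]_n -> R) (z : 'rV[R]_n)
    (r e : R) (c : 'I_n -> R) (a b : 'rV[R]_n) :
  (forall w, `|w - z| < r -> forall i, derivable f w (delta_mx 0 i)) ->
  (forall w, `|w - z| < r -> forall i, `|pd i f w - c i| <= e) ->
  `|a - z| < r -> `|b - z| < r ->
  `|f a - f b - \sum_(i < n) (a - b) 0 i * c i| <= n%:R * (e * `|a - b|).
Proof.
move=> Df He az bz.
have r0 : 0 < r by exact: le_lt_trans az.
have Em (i : 'I_n) (t : R) : t *: delta_mx 0 i + (mixed_row a b i - b 0 i *: delta_mx 0 i) =
    \row_j if (j < i)%N then a 0 j else if j == i then t else b 0 j.
  apply/rowP => j; rewrite !mxE eqxx /=; have [->|ji] := eqVneq j i.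
    by rewrite ltnn !mulr1 subrr addr0.
  by rewrite !mulr0 add0r subr0.
have Hball (i : 'I_n) (t : R) : Num.min (b 0 i) (a 0 i) <= t <= Num.max (b 0 i) (a 0 i) ->
    `|t *: delta_mx 0 i + (mixed_row a b i - b 0 i *: delta_mx 0 i) - z| < r.
  move=> ht; rewrite Em; apply: row_norm_lt => // j; rewrite !mxE.
  have aj := le_lt_trans (row_norm_ge (a - z) j) az.
  have bj := le_lt_trans (row_norm_ge (b - z) j) bz.
  rewrite !mxE in aj bj.
  case: ifP => // _; case: eqP => // ->{j} in aj bj *.
  move: aj bj ht; rewrite !ltr_norml; case: (leP (b 0 i) (a 0 i)); lra.
have Hstep (i : 'I_n) : exists2 w : 'rV[R]_n, `|w - z| < r &
   f (mixed_row a b i.+1) - f (mixed_row a b i) = (a - b) 0 i * pd i f w.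
  have := @mean_value_any R
    (fun t => f (t *: delta_mx 0 i + (mixed_row a b i - b 0 i *: delta_mx 0 i)))
    (fun t => pd i f (t *: delta_mx 0 i + (mixed_row a b i - b 0 i *: delta_mx 0 i)))
    (b 0 i) (a 0 i).
  case=> [t /Hball ht|t /Hball ht E].
    by apply: is_derive_line; apply: Df.
  exists (t *: delta_mx 0 i + (mixed_row a b i - b 0 i *: delta_mx 0 i)) => //.
  rewrite mulrC !mxE -E !Em; congr (f _ - f _); apply/rowP => j; rewrite !mxE.
    have [->|ji] := eqVneq j i; first by rewrite ltnS leqnn ltnn.
    rewrite ltnS.
    by rewrite leq_eqVlt val_eqE (negbTE ji).
  by have [->|//] := eqVneq j i; rewrite ltnn.
have -> : f a - f b = \sum_(i < n) (f (mixed_row a b i.+1) - f (mixed_row a b i)).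
  rewrite -(big_mkord xpredT (fun i => f (mixed_row a b i.+1) - f (mixed_row a b i))).
  rewrite telescope_sumr //; congr (f _ - f _); apply/rowP => j; rewrite !mxE //.
  by rewrite ltn_ord.
rewrite -sumrB.
apply: le_trans (ler_norm_sum _ _ _) _.
have -> : n%:R * (e * `|a - b|) = \sum_(i < n) (e * `|a - b|).
  by rewrite sumr_const card_ord mulr_natl.
apply: ler_sum => i _; have [w wz ->] := Hstep i.
rewrite -mulrBr normrM mulrC; apply: ler_pM => //; first exact: He.
exact: row_norm_ge.
Qed.

Lemma differentiable_of_partial R n (f : 'rV[R]_n -> R) (x : 'rV[R]_n) :
  (\forall w \near x, forall i, derivable f w (delta_mx 0 i)) ->
  (forall i, {for x, continuous (pd i f)}) ->
  differentiable f x.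
Proof.
move=> Df Cf.
pose d (v : 'rV[R]_n) : R^o := \sum_(i < n) v 0 i * pd i f x.
have lind : linear d.
  move=> k u v; rewrite /d scaler_sumr -big_split /=; apply: eq_bigr => i _.
  by rewrite !mxE mulrDl -mulrA.
pose dM := GRing.isLinear.Build _ _ _ _ _ lind.
pose dL : {linear _ -> _} := HB.pack d dM.
have contd : continuous (dL : 'rV[R]_n -> R^o).
  move=> v; apply: (@cvg_sum_ord R R _ _ (nbhs_filter v) _ (fun i (w : 'rV[R]_n) => w 0 i * pd i f x)) => i.
  by apply: cvgM; [exact: coord_continuous|exact: cvg_cst].
have H : (f : _ -> R^o) \o shift x = cst (f x : R^o) + dL +o_ (0 : 'rV[R]_n) id.
  apply/eqaddoP => _ /posnumP[e].
  have e'0 : 0 < e%:num / n.+1%:R by rewrite divr_gt0.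
  have : \forall w \near x, forall i, derivable f w (delta_mx 0 i) /\
        `|pd i f w - pd i f x| <= e%:num / n.+1%:R.
    near=> w => i; split; first by move: i; near: w.
    move: i; near: w; apply: filter_forall => i.
    by have /cvgrPdistC_le/(_ _ e'0) := Cf i.
  move=> /nbhs_ballP[r /= r0 Hr].
  have Hr' w : `|w - x| < r -> forall i, derivable f w (delta_mx 0 i) /\
        `|pd i f w - pd i f x| <= e%:num / n.+1%:R.
    by move=> wx; apply: Hr; rewrite -ball_normE /= distrC.
  apply/nbhs_ballP; exists r => //= v; rewrite -ball_normE /= sub0r normrN => vr.
  have /(_ (v + x) x) := @mean_telescope R n f x r (e%:num / n.+1%:R) (fun i => pd i f x).
  rewrite subrr normr0 addrK => /(_ (fun w wx i => (Hr' w wx i).1) (fun w wx i => (Hr' w wx i).2) vr r0).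
  rewrite -[X in _ -> X <= _]/(`|f (v + x) - (f x + d v)|) opprD addrA => /le_trans; apply.
  rewrite mulrA; apply: ler_wpM2r => //.
  rewrite mulrCA; apply: ler_piMr => //.
  by rewrite ler_pdivrMr ?ltr0n // mul1r ler_nat.
apply/diff_locallyP; split.
  by rewrite (diff_unique contd H).
by rewrite (diff_unique contd H).
Unshelve. all: by end_near. Qed.

Lemma diff_row R n (W : normedModType R) (f : 'rV[R]_n -> W)
    (x v : 'rV[R]_n) : differentiable f x ->
  'd f x v = \sum_(i < n) v 0 i *: pd i f x.
Proof.
move=> Df; rewrite {1}(row_sum_delta v) linear_sum; apply: eq_bigr => i _.
by rewrite linearZ /pd deriveE.
Qed.

Lemma derive_along R (V W : normedModType R) (f : V -> W) (x v : V) :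
  'D_v f x = 'D_1 (fun h : R => f (h *: v + x)) 0.
Proof.
rewrite /derive; set g1 := fun h => h^-1 *: _; set g2 := fun h => h^-1 *: _.
suff -> : g1 = g2 by []; apply/funext => h; rewrite /g1 /g2 /=.
by rewrite addr0 scale0r add0r [h%:A]mulr1.
Qed.

Lemma is_derive_along R (V W : normedModType R) (f : V -> W) (x v : V) (d : W) :
  is_derive (0 : R) 1 (fun t => f (t *: v + x)) d -> is_derive x v f d.
Proof. by move=> [D1 D2]; split; [rewrite derivable1P|rewrite derive_along]. Qed.

Lemma is_derive_chain R (V : normedModType R) (n : nat) (W : normedModType R)
    (f : 'rV[R]_n -> W)
    (c : V -> 'rV[R]_n) (t v : V) (d : 'rV[R]_n) :
  differentiable f (c t) -> is_derive t v c d ->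
  is_derive t v (f \o c) (\sum_(i < n) d 0 i *: pd i f (c t)).
Proof.
move=> Df [Dc <-].
have [g gE] : exists g : R -> 'rV[R]_n, g = fun h => c (h *: v + t) by eexists.
have g0 : g 0 = c t by rewrite gE scale0r add0r.
have Dg : differentiable g 0.
  by rewrite -derivable1_diffP gE; move: Dc; rewrite derivable1P.
have -> : 'D_v c t = 'D_1 g 0 by rewrite derive_along gE.
have fgE : (fun h : R => (f \o c) (h *: v + t)) = f \o g by rewrite gE.
rewrite -g0 in Df *.
have Dfg : differentiable (f \o g) 0 by exact: differentiable_comp.
apply: DeriveDef; first by rewrite derivable1P derivable1_diffP fgE.
by rewrite derive_along fgE -(diff_row _ Df) (deriveE _ Dfg) (deriveE _ Dg) diff_comp.
Qed.

Lemma eq_derive1_near R (W : normedModType R) (f g : R -> W) (t : R) :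
  (\near t, f t = g t) -> derive1 f t = derive1 g t.
Proof. by move=> H; rewrite !derive1E; exact: near_eq_derive. Qed.

(** The second difference of [f] over a square of side [h] is [h * h] times either mixed derivative
at some point of the square: apply the mean value theorem twice, in either order of the
variables. *)
Lemma pd_comm R n (f : 'rV[R]_n -> R) (x : 'rV[R]_n) (i j : 'I_n) :
  (\forall w \near x, derivable f w (delta_mx 0 i) /\ derivable f w (delta_mx 0 j) /\
     derivable (pd i f) w (delta_mx 0 j) /\ derivable (pd j f) w (delta_mx 0 i)) ->
  {for x, continuous (pd j (pd i f))} -> {for x, continuous (pd i (pd j f))} ->
  pd i (pd j f) x = pd j (pd i f) x.
Proof.
move=> /nbhs_ballP[r0 /= r00 Hr0] Cij Cji.
have key (k l : 'I_n) (r h : R) : 0 < r -> 0 < h -> h + h < r ->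
   (forall w, `|w - x| < r -> derivable f w (delta_mx 0 k)) ->
   (forall w, `|w - x| < r -> derivable (pd k f) w (delta_mx 0 l)) ->
   exists2 w, `|w - x| <= h + h & f (h *: delta_mx 0 k + (h *: delta_mx 0 l + x))
      - f (h *: delta_mx 0 k + x) - (f (h *: delta_mx 0 l + x) - f x) = pd l (pd k f) w * (h * h).
  move=> r_gt0 h0 hr Dk Dl.
  have nd (q : 'I_n) (t : R) : 0 <= t <= h -> `|t *: (delta_mx 0 q : 'rV[R]_n)| <= h.
    move=> /andP[t0 th]; apply: row_norm_le; first exact: ltW.
    move=> p; rewrite !mxE eqxx /=; case: (p == q); last by rewrite mulr0 normr0 ltW.
    by rewrite mulr1 ger0_norm.
  have hh (s t : R) : 0 <= t <= h -> 0 <= s <= h ->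
      `|t *: delta_mx 0 k + (s *: delta_mx 0 l + x) - x| <= h + h.
    move=> th sh; rewrite addrA addrK; apply: le_trans (ler_normD _ _) _.
    by apply: lerD; apply: nd.
  have h00 : (0 : R) <= 0 <= h by rewrite lexx ltW.
  pose u t := f (t *: delta_mx 0 k + (h *: delta_mx 0 l + x)) - f (t *: delta_mx 0 k + x).
  have [|t th E] := @mean_value R u (fun t => pd k f (t *: delta_mx 0 k + (h *: delta_mx 0 l + x))
     - pd k f (t *: delta_mx 0 k + x)) 0 h (ltW h0).
    move=> t th; apply: is_deriveB; apply: is_derive_line; apply: Dk.
      by apply: le_lt_trans hr; apply: hh => //; rewrite ltW //=.
    by have := hh 0 t th h00; rewrite scale0r add0r => /le_lt_trans; exact.
  have [|s sh E'] := @mean_value R (fun s => pd k f (s *: delta_mx 0 l + (t *: delta_mx 0 k + x)))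
     (fun s => pd l (pd k f) (s *: delta_mx 0 l + (t *: delta_mx 0 k + x))) 0 h (ltW h0).
    move=> s sh; apply: is_derive_line; apply: Dl.
    by rewrite addrCA; apply: le_lt_trans hr; apply: hh.
  exists (s *: delta_mx 0 l + (t *: delta_mx 0 k + x)).
    by rewrite addrCA; apply: hh.
  move: E; rewrite /u !scale0r !add0r subr0 => ->.
  move: E'; rewrite scale0r add0r subr0 addrCA => ->.
  by rewrite mulrA.
apply/eqP; rewrite -subr_eq0 -normr_le0; apply/ler_addgt0Pr => _ /posnumP[e].
rewrite add0r.
have e2 : 0 < e%:num / 2 by [].
move/cvgrPdistC_le: Cij => /(_ _ e2) /nbhs_ballP[r1 /= r10 Hr1].
move/cvgrPdistC_le: Cji => /(_ _ e2) /nbhs_ballP[r2 /= r20 Hr2].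
pose r := Num.min r0 (Num.min r1 r2).
have r_gt0 : 0 < r by rewrite !lt_min r00 r10 r20.
have h0 : 0 < r / 4 by rewrite divr_gt0.
have hr : r / 4 + r / 4 < r by lra.
have wr w : `|w - x| < r -> [/\ ball x r0 w, ball x r1 w & ball x r2 w].
  by rewrite !lt_min => /and3P[? ? ?]; split; rewrite -ball_normE /= distrC.
have [||w wx Ew] := @key i j r (r / 4) r_gt0 h0 hr.
- by move=> w /wr[/Hr0[]].
- by move=> w /wr[/Hr0[_ [_ []]]].
have [||w' w'x Ew'] := @key j i r (r / 4) r_gt0 h0 hr.
- by move=> v /wr[/Hr0[_ []]].
- by move=> v /wr[/Hr0[_ [_ []]]].
have {Ew Ew'} E : pd j (pd i f) w = pd i (pd j f) w'.
  apply: (@mulIf _ (r / 4 * (r / 4))); first by rewrite mulf_neq0 // gt_eqF.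
  apply: etrans (esym Ew) (etrans _ Ew'); rewrite (addrCA (r / 4 *: delta_mx 0 j)).
  move: (f (_ + (_ + _))) (f (_ *: delta_mx 0 i + x)) (f (_ *: delta_mx 0 j + x)) (f x).
  by move=> ? ? ? ?; ring.
have [_ /Hr1 + _] := wr w (le_lt_trans wx hr).
have [_ _ /Hr2 +] := wr w' (le_lt_trans w'x hr).
rewrite /= E; move: (pd i (pd j f) w') (pd j (pd i f) x) (pd i (pd j f) x) (e%:num) => q a b d.
clear; rewrite !ler_norml => /andP[? ?] /andP[? ?]; apply/andP; split; lra.
Qed.

(** * Global solutions of bounded Lipschitz differential equations *)

(** The antiderivative that vanishes at 0. The base point [- N] must lie to the left of [t], so it
recedes with [t]; the second integral makes the value independent of it. *)
Definition primitive R (f : R -> R) (t : R) : R :=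
  let N : R := (Num.truncn `|t|).+1%:R in
  \int[@lebesgue_measure R]_(s in `[- N, t]) f s
  - \int[@lebesgue_measure R]_(s in `[- N, 0]) f s.

Lemma is_derive_primitive R (f : R -> R) (t : R) :
  continuous f -> is_derive t 1 (primitive f) (f t).
Proof.
move=> cf.
pose G (N s : R) : R := \int[@lebesgue_measure R]_(s in `[- N, s]) f s
  - \int[@lebesgue_measure R]_(s in `[- N, 0]) f s.
have dG (N s : R) : - N < s -> is_derive s 1 (G N) (f s).
  move=> Ns; have [||D E] := @continuous_FTC1 R f (BLeft (- N)) s (s + 1) _ _ Ns (cf s).
  - by rewrite ltrDl.
  - apply: continuous_compact_integrable; first exact: segment_compact.
    exact: continuous_subspaceT.
  rewrite -E -[X in is_derive _ _ _ X]subr0; apply: is_deriveB.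
  by rewrite derive1E; apply: derivableP.
have G0 (N : R) : G N 0 = 0 by rewrite /G subrr.
have GG (N M s : R) : 0 < N -> N <= M -> - N < s -> G N s = G M s.
  move=> N0 NM Ns.
  have [|c _] := @mean_value_any R (G N - G M) (fun=> 0) 0 s.
    move=> r hr; rewrite -(subrr (f r)); apply: is_deriveB; apply: dG.
      by move: hr; case: (leP 0 s); lra.
    by move: hr; case: (leP 0 s); lra.
  by rewrite mul0r !fctE !G0 !subr0 => /eqP; rewrite subr_eq0 => /eqP.
pose N0 : R := `|t| + 2.
have tr (s : R) : `|s| < (Num.truncn `|s|).+1%:R.
  exact: truncnS_gt.
have trle (s : R) : (Num.truncn `|s|).+1%:R <= `|s| + 1.
  by rewrite -natr1 lerD2r truncn_le.
have N00 : - N0 < t by rewrite /N0; have := ler_norm (- t); rewrite normrN; lra.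
apply: (near_eq_is_derive _ (dG N0 t N00)).
near=> s; symmetry; apply: GG.
- by rewrite ltr0n.
- apply: le_trans (trle s) _.
  have : `|s - t| <= 1.
    near: s; apply/nbhs_ballP; exists 1 => //= s; rewrite /ball /= distrC; exact: ltW.
  by have := ler_normD (s - t) t; rewrite subrK /N0; lra.
- by have := tr s; rewrite ltr_norml => /andP[].
Unshelve. all: by end_near. Qed.

Lemma primitive0 R (f : R -> R) : primitive f 0 = 0.
Proof. by rewrite /primitive subrr. Qed.

Lemma le_half_pow R (a b c : R) :
  (forall k : nat, a <= b + c * 2^-1 ^+ k) -> a <= b.
Proof.
move=> H; apply/ler_addgt0Pr => e e0.
have [c0|c0] := leP c 0.
  apply: le_trans (H 0) _; rewrite expr0 mulr1; lra.
pose k := (Num.truncn (c / e)).+1.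
apply: le_trans (H k) _; rewrite lerD2l.
have kc : c / e < k%:R by exact: truncnS_gt.
have k2 : (k%:R : R) <= 2 ^+ k.
  by rewrite -natrX ler_nat ltnW // ltn_expl.
rewrite exprVn ler_pdivrMr ?exprn_gt0 // mulrC -ler_pdivrMr //.
by apply: le_trans k2; exact: ltW.
Qed.

(** The intervals with center [u k] and radius [2 * A * 2^-1 ^+ k] are nested. *)
Lemma half_pow_cvg R (u : nat -> R) (A : R) : 0 <= A ->
  (forall k, `|u k.+1 - u k| <= A * 2^-1 ^+ k) ->
  exists l, forall k, `|u k - l| <= 2 * A * 2^-1 ^+ k.
Proof.
move=> A0 H.
pose lo k := u k - 2 * A * 2^-1 ^+ k; pose hi k := u k + 2 * A * 2^-1 ^+ k.
have los k : lo k <= lo k.+1.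
  by have := H k; rewrite /lo ler_norml exprS => /andP[]; lra.
have his k : hi k.+1 <= hi k.
  by have := H k; rewrite /hi ler_norml exprS => /andP[]; lra.
have lohi k : lo k <= hi k.
  have : 0 <= A * 2^-1 ^+ k by rewrite mulr_ge0 // exprn_ge0 // invr_ge0.
  by rewrite /lo /hi; lra.
have lom j k : (j <= k)%N -> lo j <= lo k.
  by move/subnK => <-; elim: (k - j)%N => // i; rewrite addSn => /le_trans; apply.
have him j k : (j <= k)%N -> hi k <= hi j.
  by move/subnK => <-; elim: (k - j)%N => // i IH; rewrite addSn; apply: le_trans IH.
have lh j k : lo j <= hi k.
  have := lom _ _ (leq_maxl j k); have := him _ _ (leq_maxr j k).
  by have := lohi (maxn j k); lra.
have ub k : ubound (range lo) (hi k) by move=> _ [j _ <-].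
have ex : range lo !=set0 by exists (lo 0%N); exists 0%N.
exists (sup (range lo)) => k; rewrite ler_distl; apply/andP; split.
  suff : sup (range lo) <= hi k by rewrite /hi; lra.
  exact: ge_sup.
suff : lo k <= sup (range lo) by rewrite /lo; lra.
by apply: ub_le_sup; [exists (hi 0%N)|exists k].
Qed.

Lemma is_deriveMc R (f : R -> R) (c t d : R) :
  is_derive t 1 f d -> is_derive t 1 (fun s => c * f s) (c * d).
Proof. exact: (@is_deriveZ R R R f c). Qed.

Lemma is_derive_expRMc R (c t : R) :
  is_derive t 1 (fun s => expR (c * s)) (c * expR (c * t)).
Proof.
rewrite mulrC; apply: (@is_derive1_comp R expR (fun s => c * s)).
by rewrite -[X in is_derive _ _ _ X]mulr1; exact: is_deriveMc.
Qed.

(** Comparison with the solution of [w' = A * expR (B * t)], on each half line. *)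
Lemma exp_growth R (u du : R -> R) (A B : R) : 0 < B ->
  (forall t : R, is_derive t 1 u (du t)) -> (forall t, `|du t| <= A * expR (B * `|t|)) ->
  forall t, `|u t - u 0| <= A / B * expR (B * `|t|).
Proof.
move=> B0.
have A0 (w : R -> R) : (forall t, `|w t| <= A * expR (B * `|t|)) -> 0 <= A.
  by move=> /(_ 0); rewrite normr0 mulr0 expR0 mulr1; apply: le_trans.
have pos (w dw : R -> R) : (forall t : R, is_derive t 1 w (dw t)) ->
    (forall t, `|dw t| <= A * expR (B * `|t|)) ->
    forall t, 0 <= t -> `|w t - w 0| <= A / B * expR (B * `|t|).
  move=> Dw H t t0; rewrite (ger0_norm t0).
  have := @mean_value_le R w dw (fun s => A / B * expR (B * s))
     (fun s => A * expR (B * s)) 0 t t0 (fun s _ => Dw s).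
  have D (s : R) : 0 <= s <= t -> is_derive s 1 (fun s => A / B * expR (B * s)) (A * expR (B * s)).
    move=> _; apply: (is_derive_eq (is_deriveMc _ (is_derive_expRMc B s))).
    by rewrite mulrA divfK // gt_eqF.
  move=> /(_ D) H'; apply: le_trans (H' _) _.
    by move=> s /andP[s0 _]; have := H s; rewrite (ger0_norm s0).
  by rewrite gerDl oppr_le0 mulr_ge0 ?expR_ge0 // divr_ge0 ?(A0 _ H) // ltW.
move=> Du H t; have [t0|/ltW t0] := leP 0 t; first exact: pos Du H t t0.
have := pos (u \o -%R) (fun s => - du (- s)).
rewrite /= => /(_ _ _ (- t)); rewrite oppr_ge0 opprK oppr0 normrN; apply => //.
- move=> s; apply: (is_derive_eq (is_derive1_comp (Du (- s)) (is_deriveNid s 1))).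
  by rewrite mulrN1.
- by move=> s; rewrite normrN; have := H (- s); rewrite normrN.
Qed.

Lemma lipschitz_continuous R (V W : normedModType R) (f : V -> W) (C : R) :
  (forall x y, `|f x - f y| <= C * `|x - y|) -> continuous f.
Proof.
move=> H x; apply/cvgrPdist_lt => e e0.
have C0 : 0 < `|C| + 1 by rewrite ltr_wpDl.
have d0 : 0 < e / (`|C| + 1) by rewrite divr_gt0.
near=> y; apply: le_lt_trans (H _ _) _.
apply: (@le_lt_trans _ _ ((`|C| + 1) * `|x - y|)).
  by apply: ler_wpM2r => //; have := ler_norm C; lra.
rewrite mulrC -ltr_pdivlMr //; near: y; exact: cvgr_dist_lt.
Unshelve. all: by end_near. Qed.

Lemma derive_bound_lipschitz R n (w dw : R -> 'rV[R]_n) (K : R) : 0 <= K ->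
  (forall t : R, is_derive t 1 w (dw t)) -> (forall t, `|dw t| <= K) ->
  forall t s, `|w t - w s| <= K * `|t - s|.
Proof.
move=> K0 D H t s; apply: row_norm_le => [|i]; first exact: mulr_ge0.
rewrite !mxE; have [r _ ->] := @mean_value_any R (fun t => w t 0 i) (fun t => dw t 0 i) s t
  (fun r _ => is_derive_coord i (D r)).
rewrite normrM ler_wpM2r //; apply: le_trans (H r); exact: row_norm_ge.
Qed.

Definition row_primitive R n (x : 'rV[R]_n) (f : R -> 'rV[R]_n) (t : R) :
    'rV[R]_n :=
  x + \row_i primitive (fun s => f s 0 i) t.

Lemma row_primitive0 R n (x : 'rV[R]_n) (f : R -> 'rV[R]_n) :
  row_primitive x f 0 = x.
Proof. by apply/rowP => i; rewrite !mxE primitive0 addr0. Qed.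

Lemma is_derive_row_primitive R n (x : 'rV[R]_n) (f : R -> 'rV[R]_n) (t : R) :
  continuous f -> is_derive t 1 (row_primitive x f) (f t).
Proof.
move=> cf; apply: is_derive_row => i.
have -> : (fun s => row_primitive x f s 0 i) = (fun s => x 0 i + primitive (fun s => f s 0 i) s).
  by apply/funext => s; rewrite !mxE.
have cfi : continuous (fun s => f s 0 i).
  move=> s; apply: (@continuous_comp _ _ _ f (fun M : 'rV[R]_n => M 0 i)); first exact: cf.
  exact: coord_continuous.
have D := is_derive_primitive t cfi.
rewrite -[X in is_derive _ _ _ X]add0r.
exact: (@is_deriveD R R R (fun=> x 0 i) _ t 1 0 _ (is_derive_cst _ _ _) D).
Qed.

Definition bounded_lipschitz R n (K L : R) (X : 'rV[R]_n -> 'rV[R]_n) : Prop :=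
  [/\ 0 <= K, 0 < L, forall a b, `|X a - X b| <= L * `|a - b| & forall a, `|X a| <= K].

(** Picard iteration. The weight [expR (2 * L * `|t|)] makes it a contraction of ratio 1/2 on the
whole line at once: integrating [L] times the weight costs a factor [L / (2 * L)], by
[exp_growth]. *)
Lemma global_solution R n (X : 'rV[R]_n -> 'rV[R]_n) (K L : R) :
  bounded_lipschitz K L X -> forall x, exists c : R -> 'rV[R]_n, c 0 = x /\ forall t : R, is_derive t 1 c (X (c t)).
Proof.
move=> [K0 L0 XL XK] x.
pose phi := fix phi (k : nat) : R -> 'rV[R]_n :=
  if k is k'.+1 then row_primitive x (fun s => X (phi k' s)) else fun=> x.
have cX : continuous X by exact: lipschitz_continuous XL.
have cXw (w : R -> 'rV[R]_n) : (forall t s, `|w t - w s| <= K * `|t - s|) -> continuous (X \o w).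
  move=> wK; apply: (@lipschitz_continuous _ _ _ _ (L * K)) => t s.
  apply: le_trans (XL _ _) _; rewrite -mulrA ler_wpM2l ?(ltW L0) //; exact: wK.
have phiK k : forall t s, `|phi k t - phi k s| <= K * `|t - s|.
  elim: k => [t s|k IH]; first by rewrite subrr normr0 mulr_ge0.
  apply: (@derive_bound_lipschitz _ _ _ (X \o phi k)) => // t; last exact: XK.
  exact/is_derive_row_primitive/cXw.
have Dphi : forall (k : nat) (t : R), is_derive t 1 (phi k.+1) (X (phi k t)).
  move=> k t; exact: (is_derive_row_primitive _ _ (cXw _ (phiK k))).
have phi0 k : phi k 0 = x by case: k => //= k; exact: row_primitive0.
pose C := K / (2 * L).
have C0 : 0 <= C by rewrite divr_ge0 // mulr_ge0 // ltW.
have L2 : 0 < 2 * L by rewrite mulr_gt0.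
pose E (t : R) := expR (2 * L * `|t|).
have E0 t : 0 <= E t by exact: expR_ge0.
have half0 k : 0 <= 2^-1 ^+ k :> R by rewrite exprn_ge0 // invr_ge0.
have H k : forall t, `|phi k.+1 t - phi k t| <= C * E t * 2^-1 ^+ k.
  elim: k => [t|k IH t].
    have := @derive_bound_lipschitz _ _ (phi 1%N) _ K K0 (Dphi 0%N) (fun=> XK _) t 0.
    rewrite {2}/phi row_primitive0 expr0 mulr1 subr0 => /le_trans; apply.
    have -> : K * `|t| = C * (2 * L * `|t|) by rewrite /C; field; rewrite gt_eqF.
    rewrite ler_wpM2l //; apply: le_trans (expR_ge1Dx _); lra.
  apply: row_norm_le => [|i]; first by rewrite mulr_ge0 ?half0 // mulr_ge0 ?E0.
  pose u t := phi k.+2 t 0 i - phi k.+1 t 0 i.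
  have D1 : forall s : R, is_derive s 1 u (X (phi k.+1 s) 0 i - X (phi k s) 0 i).
    by move=> s; exact: (is_deriveB (is_derive_coord i (Dphi k.+1 s)) (is_derive_coord i (Dphi k s))).
  have D2 s : `|X (phi k.+1 s) 0 i - X (phi k s) 0 i| <= L * (C * 2^-1 ^+ k) * expR (2 * L * `|s|).
    have := row_norm_ge (X (phi k.+1 s) - X (phi k s)) i; rewrite !mxE => /le_trans; apply.
    apply: le_trans (XL _ _) _; rewrite -/(E s) -mulrA ler_wpM2l ?(ltW L0) //.
    by rewrite mulrAC; exact: IH.
  have := exp_growth L2 D1 D2 t.
  have -> : (phi k.+2 t - phi k.+1 t) 0 i = u t by rewrite row_subE.
  have -> : u 0 = 0 by rewrite /u !phi0 subrr.
  rewrite subr0 => /le_trans; apply.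
  rewrite -/(E t) exprS.
  have -> : L * (C * 2^-1 ^+ k) / (2 * L) = C * 2^-1 ^+ k / 2.
    by field; rewrite gt_eqF.
  lra.
have lim_ex t i : exists l, forall k, `|phi k t 0 i - l| <= 2 * (C * E t) * 2^-1 ^+ k.
  apply: half_pow_cvg => [|k]; first exact: mulr_ge0.
  apply: le_trans (H k t); have := row_norm_ge (phi k.+1 t - phi k t) i.
  by rewrite !mxE.
pose c t := \row_i sval (cid (lim_ex t i)).
have phic k t : `|phi k t - c t| <= 2 * (C * E t) * 2^-1 ^+ k.
  apply: row_norm_le => [|i]; first by rewrite mulr_ge0 ?half0 // mulr_ge0 // mulr_ge0 ?E0.
  by rewrite !mxE; exact: (svalP (cid (lim_ex t i)) k).
have cK t s : `|c t - c s| <= K * `|t - s|.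
  apply: (@le_half_pow _ _ _ (2 * (C * E t) + 2 * (C * E s))) => k.
  have -> : c t - c s = (c t - phi k t) + (phi k t - phi k s) + (phi k s - c s).
    by rewrite !subrKA.
  have := ler_normD (c t - phi k t + (phi k t - phi k s)) (phi k s - c s).
  have := ler_normD (c t - phi k t) (phi k t - phi k s).
  have := phic k t; have := phic k s; rewrite (distrC (phi k t)); have := phiK k t s.
  by rewrite mulrDl; lra.
pose psi := row_primitive x (X \o c).
have Dpsi : forall t : R, is_derive t 1 psi (X (c t)) by move=> t; exact/is_derive_row_primitive/cXw.
(* [psi], the Picard iterate of the limit, is at distance O(2^-k) from every [phi k.+1] *)
suff E' : psi = c.
  exists c; split=> [|t]; first by rewrite -E' /psi row_primitive0.
  by have := Dpsi t; rewrite E'.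
apply/funext => t; apply/rowP => i; apply/eqP; rewrite -subr_eq0 -normr_le0.
apply: (@le_half_pow _ _ _ (2 * (C * E t))) => k; rewrite add0r.
pose u t := psi t 0 i - phi k.+1 t 0 i.
have D1 : forall s : R, is_derive s 1 u (X (c s) 0 i - X (phi k s) 0 i).
  by move=> s; exact: (is_deriveB (is_derive_coord i (Dpsi s)) (is_derive_coord i (Dphi k s))).
have D2 s : `|X (c s) 0 i - X (phi k s) 0 i| <= L * (2 * C * 2^-1 ^+ k) * expR (2 * L * `|s|).
  have := row_norm_ge (X (c s) - X (phi k s)) i; rewrite !mxE => /le_trans; apply.
  apply: le_trans (XL _ _) _; rewrite -/(E s) -mulrA ler_wpM2l ?(ltW L0) //.
  by rewrite distrC; apply: le_trans (phic _ _) _; rewrite mulrA mulrAC.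
have := exp_growth L2 D1 D2 t; rewrite -/(E t).
have -> : u 0 = 0 by rewrite /u /psi phi0 row_primitive0 subrr.
rewrite /u subr0.
have -> : L * (2 * C * 2^-1 ^+ k) / (2 * L) = C * 2^-1 ^+ k.
  by field; rewrite gt_eqF.
have := phic k.+1 t; have := row_norm_ge (phi k.+1 t - c t) i; rewrite !row_subE exprS.
have := ler_normD (psi t 0 i - phi k.+1 t 0 i) (phi k.+1 t 0 i - c t 0 i).
rewrite addrA subrK mulrA; move: (psi t 0 i) (phi k.+1 t 0 i) (c t 0 i) (`|_|) => p q r d.
have := E0 t; have := half0 k; move: (E t) (2^-1 ^+ k) => e h h0 e0.
have : 0 <= C * e * h by rewrite mulr_ge0 // mulr_ge0.
clear; lra.
Qed.

(** * The flow and its derivative in the initial point *)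

Lemma is_derive_sum_sqr R n (w : R -> 'rV[R]_n) (dw : 'rV[R]_n) (t : R) :
  is_derive t 1 w dw ->
  is_derive t 1 (fun s => \sum_(i < n) w s 0 i ^+ 2) (\sum_(i < n) 2 * (w t 0 i * dw 0 i)).
Proof.
move=> D.
have -> : (fun s => \sum_(i < n) w s 0 i ^+ 2) = \sum_(i < n) (fun s => w s 0 i ^+ 2).
  by apply/funext => s; rewrite fct_sumE.
apply: is_derive_sum => i; have Di := is_derive_coord i D.
have -> : (fun s => w s 0 i ^+ 2) = (fun s => w s 0 i) * (fun s => w s 0 i).
  by apply/funext => s; rewrite expr2.
by apply: (is_derive_eq (is_deriveM Di Di)); rewrite /GRing.scale /=; ring.
Qed.

(** The energy [Z], the squared Euclidean norm plus [e ^+ 2], is differentiable, unlike the sup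
norm; adding [e ^+ 2] absorbs the inhomogeneous term, so that [dZ <= c * Z] with a constant [c]
that depends on [n] and [L] only. Negative times follow by reversing time. *)
Lemma gronwall R n (L T : R) : 0 <= L ->
  exists2 D : R, 0 < D & forall (w dw : R -> 'rV[R]_n) (e : R), 0 <= e ->
    (forall t : R, `|t| <= T -> is_derive t 1 w (dw t)) ->
    (forall t : R, `|t| <= T -> `|dw t| <= L * `|w t| + e) ->
    forall t : R, `|t| <= T -> `|w t| <= D * (`|w 0| + e).
Proof.
move=> L0; pose c : R := n%:R * (2 * L + 1).
have c0 : 0 <= c by rewrite mulr_ge0 // addr_ge0 // mulr_ge0.
pose D : R := n.+1%:R * expR (c * `|T|).
have D1 : 1 <= D.
  rewrite /D -[leLHS]mulr1 ler_pM ?ler1n //.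
  by apply: le_trans (expR_ge1Dx _); rewrite lerDl mulr_ge0.
exists D; first exact: lt_le_trans D1.
have pos (w dw : R -> 'rV[R]_n) (e : R) : 0 <= e ->
    (forall t : R, `|t| <= T -> is_derive t 1 w (dw t)) ->
    (forall t : R, `|t| <= T -> `|dw t| <= L * `|w t| + e) ->
    forall t : R, 0 <= t -> `|t| <= T -> `|w t| <= D * (`|w 0| + e).
  move=> e0 Dw H t t0 tT.
  pose Z s := \sum_(i < n) w s 0 i ^+ 2 + e ^+ 2.
  have wZ s i : w s 0 i ^+ 2 + e ^+ 2 <= Z s.
    by rewrite lerD2r (bigD1 i) //= lerDl sumr_ge0 // => j _; exact: sqr_ge0.
  have nZ s : `|w s| ^+ 2 + e ^+ 2 <= Z s.
    have [w0|] := eqVneq `|w s| 0.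
      by rewrite w0 expr0n /= add0r lerDr sumr_ge0 // => j _; exact: sqr_ge0.
    move=> /mx_norm_neq0[[i j] /=]; rewrite (ord1 i) => E.
    by rewrite [`|w s|]E real_normK ?num_real.
  pose dZ s := \sum_(i < n) 2 * (w s 0 i * dw s 0 i).
  have DZ : forall s : R, 0 <= s <= t ->
      is_derive s 1 (fun s => Z s * expR (- c * s)) ((dZ s - c * Z s) * expR (- c * s)).
    move=> s /andP[s0 st].
    have sT : `|s| <= T by rewrite ger0_norm // (le_trans st) // -(ger0_norm t0).
    have D1' : is_derive s 1 Z (dZ s).
      rewrite -[X in is_derive _ _ _ X]addr0.
      exact: (is_deriveD (is_derive_sum_sqr (Dw s sT)) (is_derive_cst _ _ _)).
    apply: (is_derive_eq (is_deriveM D1' (is_derive_expRMc (- c) s))).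
    by rewrite /GRing.scale /=; ring.
  have [r /andP[r0 rt]] := mean_value t0 DZ.
  rewrite mulr0 expR0 mulr1 subr0 => E.
  have rT : `|r| <= T by rewrite ger0_norm // (le_trans rt) // -(ger0_norm t0).
  have dZr : dZ r <= c * Z r.
    apply: (@le_trans _ _ (\sum_(i < n) (2 * L + 1) * Z r)); last first.
      by rewrite sumr_const card_ord -[_ *+ n]mulr_natl mulrA.
    apply: ler_sum => i _; apply: (@le_trans _ _ (2 * (`|w r| * (L * `|w r| + e)))).
      rewrite ler_pM2l //; apply: le_trans (ler_norm _) _; rewrite normrM.
      apply: ler_pM => //; first exact: row_norm_ge.
      by apply: le_trans (H r rT); exact: row_norm_ge.
    have := nZ r; have := sqr_ge0 (`|w r| - e).
    have := sqr_ge0 e; move: (`|w r|) (Z r) => a z.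
    move=> e2 ae az.
    have : L * (a ^+ 2 + e ^+ 2) <= L * z by rewrite ler_wpM2l.
    have : 0 <= L * e ^+ 2 by rewrite mulr_ge0 // sqr_ge0.
    move: e2 ae az; rewrite !expr2; clear; nra.
  have ZtZ0 : Z t * expR (- c * t) <= Z 0.
    rewrite -subr_le0 E; apply: mulr_le0_ge0 => //.
    by apply: mulr_le0_ge0; rewrite ?expR_ge0 // subr_le0.
  have Zt : Z t <= expR (c * T) * Z 0.
    have Z00 : 0 <= Z 0 by apply: le_trans (nZ 0); rewrite addr_ge0 ?sqr_ge0 //.
    apply: (@le_trans _ _ (expR (c * t) * Z 0)).
      move: ZtZ0; rewrite mulNr expRN -ler_pdivlMr ?invr_gt0 ?expR_gt0 //.
      by rewrite invrK mulrC.
    by rewrite ler_wpM2r // ler_expR ler_wpM2l // -(ger0_norm t0).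
  have Z0 : Z 0 <= n.+1%:R * (`|w 0| + e) ^+ 2.
    apply: (@le_trans _ _ (\sum_(i < n) (`|w 0| + e) ^+ 2 + (`|w 0| + e) ^+ 2)).
      apply: lerD; last by rewrite lerXn2r ?nnegrE ?addr_ge0 // lerDr.
      apply: ler_sum => i _; rewrite -[leLHS]real_normK ?num_real //.
      rewrite lerXn2r ?nnegrE ?addr_ge0 //.
      by apply: le_trans (row_norm_ge _ i) _; rewrite lerDl.
    by rewrite sumr_const card_ord -natr1 mulrDl mul1r mulr_natl.
  rewrite -(@ler_pXn2r _ 2) ?nnegrE ?mulr_ge0 ?addr_ge0 ?(le_trans _ D1) //.
  apply: (@le_trans _ _ (Z t)); first by apply: le_trans (nZ t); rewrite lerDl sqr_ge0.
  apply: le_trans Zt _; rewrite exprMn.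
  apply: (@le_trans _ _ (expR (c * T) * (n.+1%:R * (`|w 0| + e) ^+ 2))).
    by rewrite ler_wpM2l // expR_ge0.
  rewrite mulrA ler_wpM2r ?sqr_ge0 //.
  apply: (@le_trans _ _ D); last by rewrite expr2 ler_peMl // (le_trans _ D1).
  rewrite /D mulrC ler_wpM2l // ler_expR ler_wpM2l //; exact: ler_norm.
move=> w dw e e0 Dw H t tT; have [t0|/ltW t0] := leP 0 t; first exact: pos Dw H t t0 tT.
have := pos (fun s => w (- s)) (fun s => - dw (- s)) e e0.
rewrite /= => /(_ _ _ (- t)); rewrite oppr_ge0 opprK oppr0 normrN; apply => //.
- move=> s sT; rewrite -scaleN1r; apply: is_derive_row => i; rewrite mxE.
  have Di : is_derive (- s) 1 (fun s => w s 0 i) (dw (- s) 0 i).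
    by apply: is_derive_coord; apply: Dw; rewrite normrN.
  by apply: (is_derive_eq (is_derive1_comp Di (is_deriveNid s 1))); rewrite mulrC.
- by move=> s sT; rewrite normrN; apply: H; rewrite normrN.
Qed.

Definition is_flow R n (X : 'rV[R]_n -> 'rV[R]_n)
    (Phi : R -> 'rV[R]_n -> 'rV[R]_n) : Prop :=
  (forall x, Phi 0 x = x) /\
  forall x (t : R), is_derive t 1 (Phi ^~ x) (X (Phi t x)).

Lemma flow_exists R n (X : 'rV[R]_n -> 'rV[R]_n) (K L : R) :
  bounded_lipschitz K L X -> exists Phi, is_flow X Phi.
Proof.
move=> XB; have [c Hc] := choice (global_solution XB).
by exists (fun t x => c x t); split=> x; have [] := Hc x.
Qed.

Lemma flow_time R n (X : 'rV[R]_n -> 'rV[R]_n) (K : R) Phi :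
  0 <= K -> (forall a, `|X a| <= K) -> is_flow X Phi ->
  forall x t s, `|Phi t x - Phi s x| <= K * `|t - s|.
Proof.
move=> K0 XK [P0 DP] x; apply: (derive_bound_lipschitz K0 (DP x)) => t; exact: XK.
Qed.

Lemma flow_lipschitz R n (X : 'rV[R]_n -> 'rV[R]_n) (L T : R) Phi :
  0 <= L -> (forall a b, `|X a - X b| <= L * `|a - b|) -> is_flow X Phi ->
  exists2 D : R, 0 < D & forall x y t, `|t| <= T -> `|Phi t x - Phi t y| <= D * `|x - y|.
Proof.
move=> L0 XL [P0 DP]; have [D D0 H] := gronwall n T L0; exists D => // x y t tT.
have := H (fun t => Phi t x - Phi t y) (fun t => X (Phi t x) - X (Phi t y)) 0 (lexx 0).
rewrite !P0 addr0; apply => // s sT; rewrite addr0; exact: XL.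
Qed.

Lemma is_derive_affine R n (f : R -> 'rV[R]_n) (a t s : R) (d : 'rV[R]_n) :
  is_derive (a * t + s) 1 f d -> is_derive t 1 (fun r => f (a * r + s)) (a *: d).
Proof.
move=> D; apply: is_derive_row => i; rewrite mxE mulrC.
have Da : is_derive t 1 (fun r : R => a * r + s) a.
  rewrite -[X in is_derive _ _ _ X]addr0.
  apply: (@is_deriveD R R R (fun r => a * r) (fun=> s) t 1 a 0).
  by rewrite -[X in is_derive _ _ _ X]mulr1; exact: is_deriveMc.
exact: (@is_derive1_comp R (fun u => f u 0 i) (fun r => a * r + s) t _ _ (is_derive_coord i D) Da).
Qed.

(** Uniqueness of solutions: two orbits with the same initial point differ by 0 in [gronwall]. *)
Lemma flow_add R n (X : 'rV[R]_n -> 'rV[R]_n) (L : R) Phi :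
  0 <= L -> (forall a b, `|X a - X b| <= L * `|a - b|) -> is_flow X Phi ->
  forall x t s, Phi (t + s) x = Phi t (Phi s x).
Proof.
move=> L0 XL [P0 DP] x t s; have [D D0 H] := gronwall n `|t| L0.
have := H (fun t => Phi (t + s) x - Phi t (Phi s x))
  (fun t => X (Phi (t + s) x) - X (Phi t (Phi s x))) 0 (lexx 0).
move=> /(_ _ _ t (lexx _)); rewrite P0 add0r subrr normr0 addr0 mulr0 => H'.
apply/eqP; rewrite -subr_eq0 -normr_le0; apply: H' => r rt; last by rewrite addr0; exact: XL.
apply: is_deriveB.
have := @is_derive_affine R n (Phi ^~ x) 1 r s (X (Phi (r + s) x)).
rewrite mul1r scale1r => /(_ (DP x _)).
by under [X in is_derive _ _ X _]eq_fun do rewrite mul1r.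
Qed.

(** Strict differentiability with jacobian [J], uniformly on the ball. The bound on [J] is the
Lipschitz constant of the linear equation [w' = w *m J] along an orbit. *)
Definition strict_jacobian R n (p : 'rV[R]_n) (rho L : R)
    (X : 'rV[R]_n -> 'rV[R]_n) (J : 'rV[R]_n -> 'M[R]_n) : Prop :=
  (forall z (v : 'rV[R]_n), `|z - p| < rho -> `|v *m J z| <= L * `|v|) /\
  forall e, 0 < e -> exists2 d, 0 < d & forall a b z : 'rV[R]_n,
    `|a - p| < rho -> `|b - p| < rho -> `|z - p| < rho -> `|a - z| < d -> `|b - z| < d ->
    `|X a - X b - (a - b) *m J z| <= e * `|a - b|.

Definition flow_quotient R n (Phi : R -> 'rV[R]_n -> 'rV[R]_n)
    (e : 'rV[R]_n) (h t : R) (x : 'rV[R]_n) : 'rV[R]_n :=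
  h^-1 *: (Phi t (h *: e + x) - Phi t x).

(** Difference quotients of the flow solve, up to an error of order [eps1], the same linear equation
[w' = w *m J (Phi s x0)] with the same initial value [e], so [gronwall] bounds their difference:
they form a Cauchy family, uniformly in the time [t] and in the base point. The condition on
[K * T] keeps the orbits in the ball where [J] is controlled. *)
Lemma flow_quotient_cauchy R n (X : 'rV[R]_n -> 'rV[R]_n) (K L T rho : R)
    Phi (J : 'rV[R]_n -> 'M[R]_n) (p : 'rV[R]_n) :
  bounded_lipschitz K L X -> is_flow X Phi -> 0 <= T -> K * T <= rho / 2 ->
  strict_jacobian p rho L X J ->
  forall (x0 e : 'rV[R]_n) (eps : R), `|x0 - p| < rho / 2 -> 0 < eps ->
  exists2 eta, 0 < eta & forall (x x' : 'rV[R]_n) (h h' : R), `|x - x0| < eta -> `|x' - x0| < eta ->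
    h != 0 -> h' != 0 -> `|h| < eta -> `|h'| < eta -> forall t, `|t| <= T ->
    `|flow_quotient Phi e h t x - flow_quotient Phi e h' t x'| <= eps.
Proof.
move=> [K0 /ltW L0 XL XK] fP T0 KT [JL SD] x0 e eps x0p eps0.
have [D D0 G] := gronwall n T L0.
have [D2 D20 PL] := flow_lipschitz T L0 XL fP.
have PK := flow_time K0 XK fP.
have [P0 DP] := fP.
have e1 : 0 < 1 + `|e| by rewrite ltr_pwDl.
pose eps1 := eps / (2 * D * D2 * (1 + `|e|)).
have eps10 : 0 < eps1 by rewrite divr_gt0 // !mulr_gt0.
have eps1E : eps1 = eps / (2 * D * D2 * (1 + `|e|)) by [].
clearbody eps1; have [d d0 Hd] := SD _ eps10.
pose r := Num.min (d / D2) (rho / 2 - `|x0 - p|).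
have r0 : 0 < r by rewrite lt_min divr_gt0 //= subr_gt0.
have eta0 : 0 < r / (1 + `|e|) by rewrite divr_gt0.
exists (r / (1 + `|e|)) => // x x' h h' xx0 x'x0 h0 h'0 hr h'r t tT.
have etar : r / (1 + `|e|) <= r by rewrite ler_pdivrMr // ler_peMr ?(ltW r0) // lerDl.
have near_r y k : `|y - x0| < r / (1 + `|e|) -> `|k| < r / (1 + `|e|) -> `|k *: e + y - x0| < r.
  move=> yx kr; rewrite -addrA; apply: le_lt_trans (ler_normD _ _) _; rewrite normrZ.
  have -> : r = r / (1 + `|e|) * `|e| + r / (1 + `|e|) by field; rewrite gt_eqF.
  by apply: ler_ltD => //; rewrite ler_wpM2r // ltW.
have trajQ y s : `|s| <= T -> `|y - x0| < r -> `|Phi s y - p| < rho.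
  move=> sT; rewrite lt_min => /andP[_ yx].
  have -> : Phi s y - p = (Phi s y - Phi 0 y) + (y - x0) + (x0 - p).
    by rewrite P0 !subrKA.
  have := PK y s 0; rewrite subr0 => H1.
  have H2 : K * `|s| <= K * T by rewrite ler_wpM2l.
  have H3 := ler_normD (Phi s y - Phi 0 y + (y - x0)) (x0 - p).
  have H4 := ler_normD (Phi s y - Phi 0 y) (y - x0).
  move: H1 H2 H3 H4 yx KT; move: (`|_ + _ + _|) (`|Phi s y - Phi 0 y + (y - x0)|)
    (`|Phi s y - Phi 0 y|) (K * `|s|) (K * T) (`|y - x0|) (`|x0 - p|) => ? ? ? ? ? ? ?; clear; lra.
have trajz y s : `|s| <= T -> `|y - x0| < r -> `|Phi s y - Phi s x0| < d.
  move=> sT; rewrite lt_min => /andP[yx _]; apply: le_lt_trans (PL _ _ _ sT) _.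
  by rewrite mulrC -ltr_pdivlMr.
pose err k s y := k^-1 *: (X (Phi s (k *: e + y)) - X (Phi s y))
   - flow_quotient Phi e k s y *m J (Phi s x0).
have x0x0 : `|x0 - x0| < r by rewrite subrr normr0.
have Herr k s y : k != 0 -> `|s| <= T -> `|y - x0| < r / (1 + `|e|) -> `|k| < r / (1 + `|e|) ->
    `|err k s y| <= eps1 * D2 * `|e|.
  move=> k0 sT yx kr.
  have yx' : `|y - x0| < r by exact: lt_le_trans etar.
  have kyx := near_r _ _ yx kr.
  rewrite /err /flow_quotient -scalemxAl -scalerBr normrZ normfV.
  rewrite mulrC ler_pdivrMr ?normr_gt0 //.
  apply: le_trans (Hd _ _ _ _ _ _ _ _) _; [exact: trajQ|exact: trajQ|exact: trajQ|
    exact: trajz|exact: trajz|].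
  rewrite -!mulrA ler_wpM2l ?(ltW eps10) //.
  apply: le_trans (PL _ _ _ sT) _; rewrite addrK normrZ ler_wpM2l ?(ltW D20) //.
  by rewrite mulrC.
pose w s := flow_quotient Phi e h s x - flow_quotient Phi e h' s x'.
pose dw s := h^-1 *: (X (Phi s (h *: e + x)) - X (Phi s x))
          - h'^-1 *: (X (Phi s (h' *: e + x')) - X (Phi s x')).
have e20 : 0 <= 2 * (eps1 * D2 * `|e|).
  by rewrite !mulr_ge0 ?(ltW eps10) ?(ltW D20).
have Dw : forall s : R, `|s| <= T -> is_derive s 1 w (dw s).
  by move=> s sT; apply: is_deriveB; apply: is_deriveZ; apply: is_deriveB; exact: DP.
have Bw : forall s : R, `|s| <= T -> `|dw s| <= L * `|w s| + 2 * (eps1 * D2 * `|e|).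
  move=> s sT.
  have -> : dw s = w s *m J (Phi s x0) + (err h s x - err h' s x').
    rewrite /dw /w /err mulmxBl.
    move: (_ *m _) (_ *m _) (h^-1 *: _) (h'^-1 *: _) => a b c f.
    by rewrite opprB [c - b + _]addrC addrA subrKA addrC subrKA.
  apply: le_trans (ler_normD _ _) _; apply: lerD; first exact/JL/trajQ.
  apply: le_trans (ler_normB _ _) _.
  by rewrite mulr_natl mulr2n; apply: lerD; exact: Herr.
apply: le_trans (G _ _ _ e20 Dw Bw t tT) _.
rewrite /w /flow_quotient !P0 !addrK !scalerA !mulVf // subrr normr0 add0r.
have -> : D * (2 * (eps1 * D2 * `|e|)) = eps * (`|e| / (1 + `|e|)).
    by rewrite eps1E; field; rewrite !gt_eqF.
  rewrite ler_piMr ?(ltW eps0) // ler_pdivrMr // mul1r; lra.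
Qed.

(** The limit of the quotients in [flow_quotient_cauchy]; its dependence on time and point is
continuous because they converge uniformly. *)
Lemma flow_derivable R n (X : 'rV[R]_n -> 'rV[R]_n) (K L T rho : R)
    Phi (J : 'rV[R]_n -> 'M[R]_n) (p : 'rV[R]_n) :
  bounded_lipschitz K L X -> is_flow X Phi -> 0 <= T -> K * T <= rho / 2 ->
  strict_jacobian p rho L X J ->
  forall x0 e : 'rV[R]_n, `|x0 - p| < rho / 2 ->
  (forall t, `|t| <= T -> derivable (Phi t) x0 e) /\
  forall t0 eps, `|t0| < T -> 0 < eps -> exists2 eta, 0 < eta & forall t x,
    `|t - t0| < eta -> `|x - x0| < eta -> `|'D_e (Phi t) x - 'D_e (Phi t0) x0| <= eps.
Proof.
move=> XB fP T0 KT SJ; have [K0 _ XL XK] := XB.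
have C := flow_quotient_cauchy XB fP T0 KT SJ.
have PK := flow_time K0 XK fP.
have Dv x0 e : `|x0 - p| < rho / 2 -> forall t, `|t| <= T -> derivable (Phi t) x0 e.
  move=> x0p t tT; apply: cauchy_cvg; apply: cauchy_exP => eps eps0.
  have [|eta eta0 H] := C x0 e (eps / 2) x0p; first by rewrite divr_gt0.
  exists (flow_quotient Phi e (eta / 2) t x0).
  have eta2 : `|eta / 2| < eta by rewrite gtr0_norm ?divr_gt0 // ltr_pdivrMr // ltr_pMr // ltr1n.
  suff : \forall h \near (0 : R)^',
      ball (flow_quotient Phi e (eta / 2) t x0) eps (flow_quotient Phi e h t x0) by [].
  near=> h; rewrite -ball_normE /=.
  apply: (@le_lt_trans _ _ (eps / 2)); last by rewrite ltr_pdivrMr // ltr_pMr // ltr1n.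
  apply: (H x0 x0 (eta / 2) h) => //; rewrite ?subrr ?normr0 //; first by rewrite gt_eqF ?divr_gt0.
    by near: h; exact: nbhs_dnbhs_neq.
  by near: h; exact: dnbhs0_lt.
move=> x0 e x0p; split; first exact: Dv.
move=> t0 eps t0T eps0.
have eps3 : 0 < eps / 3 by rewrite divr_gt0.
have [eta eta0 H] := C x0 e (eps / 3) x0p eps3.
have x0x0 : `|x0 - x0| < eta by rewrite subrr normr0.
pose h := eta / 2.
have h0 : 0 < h by rewrite divr_gt0.
have hn0 : h != 0 by rewrite gt_eqF.
have heta : `|h| < eta by rewrite gtr0_norm // /h ltr_pdivrMr // ltr_pMr // ltr1n.
have lim_q t x : `|t| <= T -> `|x - x0| < eta -> `|x - p| < rho / 2 ->
    `|flow_quotient Phi e h t x0 - 'D_e (Phi t) x| <= eps / 3.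
  move=> tT xx0 xp; apply/ler_addgt0Pr => d d0.
  have := Dv x e xp t tT; rewrite /derivable -/('D_e (Phi t) x) => /cvgrPdist_le /(_ d d0) nd.
  near (0 : R)^' => k.
  have -> : flow_quotient Phi e h t x0 - 'D_e (Phi t) x =
    (flow_quotient Phi e h t x0 - flow_quotient Phi e k t x) +
    (flow_quotient Phi e k t x - 'D_e (Phi t) x) by rewrite subrKA.
  apply: le_trans (ler_normD _ _) _; apply: lerD.
    apply: H => //; first by near: k; exact: nbhs_dnbhs_neq.
    by near: k; exact: dnbhs0_lt.
  rewrite distrC; near: k; exact: nd.
pose c := 2 * K * `|h^-1| + 1.
have c0 : 0 < c by rewrite ltr_wpDl // !mulr_ge0.
pose eta' := Num.min (Num.min eta (rho / 2 - `|x0 - p|)) (Num.min (T - `|t0|) (eps / 3 / c)).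
exists eta'; first by rewrite !lt_min eta0 !subr_gt0 x0p t0T divr_gt0.
move=> t x; rewrite !lt_min => /and3P[_ tT tc] /and3P[/andP[xeta xp] _ _].
have tT' : `|t| <= T.
  have := ler_normD (t - t0) t0; rewrite subrK => /le_trans; apply.
  by move: tT; rewrite ltrBrDr => /ltW.
have xp' : `|x - p| < rho / 2.
  have := ler_normD (x - x0) (x0 - p); rewrite subrKA => /le_lt_trans; apply.
  by rewrite -ltrBrDr.
have A := lim_q t x tT' xeta xp'.
have B := lim_q t0 x0 (ltW t0T) x0x0 x0p.
have E : `|flow_quotient Phi e h t x0 - flow_quotient Phi e h t0 x0| <= eps / 3.
  rewrite /flow_quotient -scalerBr normrZ.
  have -> : Phi t (h *: e + x0) - Phi t x0 - (Phi t0 (h *: e + x0) - Phi t0 x0) =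
      (Phi t (h *: e + x0) - Phi t0 (h *: e + x0)) - (Phi t x0 - Phi t0 x0).
    by rewrite !opprB addrACA [RHS]addrACA; congr (_ + _); rewrite addrC.
  have := ler_normB (Phi t (h *: e + x0) - Phi t0 (h *: e + x0)) (Phi t x0 - Phi t0 x0).
  have := PK (h *: e + x0) t t0; have := PK x0 t t0.
  move: tc; rewrite ltr_pdivlMr // /c.
  move: (`|_ - _ - _|) (`|_ - _ : 'rV[R]_n|) (`|Phi t x0 - _|) => q1 q2 q3.
  have := normr_ge0 h^-1; have := normr_ge0 (t - t0).
  move: (`|t - t0|) (`|h^-1|) => u v u0 v0 H1 H2 H3 H4.
  apply: (@le_trans _ _ (v * (2 * (K * u)))); first rewrite ler_wpM2l //.
    by move: H2 H3 H4; clear; lra.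
  by move: H1 u0; rewrite mulrDr mulr1; clear; lra.
have -> : 'D_e (Phi t) x - 'D_e (Phi t0) x0 = - (flow_quotient Phi e h t x0 - 'D_e (Phi t) x)
  + (flow_quotient Phi e h t x0 - flow_quotient Phi e h t0 x0)
  + (flow_quotient Phi e h t0 x0 - 'D_e (Phi t0) x0) by rewrite opprB !subrKA.
have e3 : eps = eps / 3 + eps / 3 + eps / 3 by field.
rewrite [leRHS]e3; apply: le_trans (ler_normD _ _) _.
apply: lerD; last exact: B.
apply: le_trans (ler_normD _ _) _; apply: lerD; last exact: E.
rewrite normrN; exact: A.
Unshelve. all: by end_near. Qed.

(** * Extension of a field of class C^1 to a bounded Lipschitz field *)

Definition C1on R n (V : set 'rV[R]_n) (f : 'rV[R]_n -> R) : Prop :=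
  forall x, V x -> differentiable f x /\ forall i, {for x, continuous (pd i f)}.

Lemma closed_norm_ball R (V : normedModType R) (p : V) (r : R) :
  closed [set z | `|z - p| <= r].
Proof.
apply: (@closed_comp _ _ (fun z : V => `|z - p|) [set x | x <= r]); last exact: closed_le.
by move=> z _; apply: cvg_norm; apply: cvgB; [exact: cvg_id|exact: cvg_cst].
Qed.

Lemma norm_comp_continuous R (T : topologicalType) (V : normedModType R)
    (f : T -> V) (x : T) : {for x, continuous f} -> {for x, continuous (fun z => `|f z|)}.
Proof. by move=> cf; apply: cvg_norm; exact: cf. Qed.

Lemma compact_closed_ball_row R n (p : 'rV[R]_n) (r : R) :
  compact [set z | `|z - p| <= r].
Proof.
apply: bounded_closed_compact.
  exists (r + `|p|); split; first exact: num_real.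
  move=> x xr z /= zp; apply: le_trans (ltW xr).
  by rewrite -[z](subrK p); apply: le_trans (ler_normD _ _) _; rewrite lerD2r.
exact: closed_norm_ball.
Qed.

Lemma bounded_on_ball R n (p : 'rV[R]_n) (r : R) (f : 'rV[R]_n -> R) :
  0 <= r -> (forall z, `|z - p| <= r -> {for z, continuous f}) ->
  exists2 M : R, 0 <= M & forall z, `|z - p| <= r -> `|f z| <= M.
Proof.
move=> r0 cf.
have [||c _ H] := @EVT_max_rV R n (fun z => `|f z|) [set z | `|z - p| <= r] _
  (@compact_closed_ball_row R n p r).
- by exists p; rewrite /= subrr normr0.
- apply: continuous_in_subspaceT => z /[1!inE] /= zp.
  by apply: norm_comp_continuous; exact: cf.
- exists `|f c| => // z zp; apply: H; by rewrite inE.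
Qed.

Lemma finite_bound R n (T : Type) (Q : T -> Prop) (f : 'I_n -> T -> R) :
  (forall i, exists2 M : R, 0 <= M & forall z, Q z -> `|f i z| <= M) ->
  exists2 M : R, 0 <= M & forall i z, Q z -> `|f i z| <= M.
Proof.
move=> H; have /choice[M HM] : forall i, exists M : R, 0 <= M /\ forall z, Q z -> `|f i z| <= M.
  by move=> i; have [M] := H i; exists M.
exists (\sum_i M i); first by apply: sumr_ge0 => i _; have [] := HM i.
move=> i z Qz; apply: (@le_trans _ _ (M i)); first by apply: (HM i).2.
by rewrite (bigD1 i) //= lerDl sumr_ge0 // => j _; have [] := HM j.
Qed.

Lemma uniform_continuity_ball R n (p : 'rV[R]_n) (r e : R) (f : 'rV[R]_n -> R) :
  0 < e -> (forall z, `|z - p| <= r -> {for z, continuous f}) ->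
  exists2 d : R, 0 < d & forall z w, `|z - p| <= r -> `|w - z| < d -> `|f w - f z| <= e.
Proof.
move=> e0 cf.
have /compact_near_coveringP := @compact_closed_ball_row R n p r.
move=> /(_ R (0 : R)^'+ (fun d z => forall w, `|w - z| < d -> `|f w - f z| <= e) _) H.
have : \forall d \near (0 : R)^'+, [set z | `|z - p| <= r] `<=`
    (fun z => forall w, `|w - z| < d -> `|f w - f z| <= e).
  apply: H => x /= xp.
  have e2 : 0 < e / 2 by rewrite divr_gt0.
  have /cvgrPdist_le/(_ _ e2)/nbhs_ballP[s /= s0 Hs] := cf x xp.
  have Hs' w : `|w - x| < s -> `|f x - f w| <= e / 2.
    by move=> ws; apply: Hs; rewrite -ball_normE /= distrC.
  have s2 : 0 < s / 2 by rewrite divr_gt0.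
  exists (ball x (s / 2), [set d | d < s / 2]).
    split; first by apply/nbhs_ballP; exists (s / 2).
    exact: nbhs_right_lt.
  move=> [z d] /= [xz ds] w wz.
  have xz' : `|z - x| < s / 2 by move: xz; rewrite -ball_normE /= distrC.
  have wx : `|w - x| < s.
    have := ler_normD (w - z) (z - x); rewrite subrKA => /le_lt_trans; apply.
    by rewrite [ltRHS]splitr; apply: ltrD => //; exact: lt_trans ds.
  have zx : `|z - x| < s by by apply: lt_trans xz' _; clear -s0; lra.
  have -> : f w - f z = - (f x - f w) + (f x - f z) by rewrite opprB subrKA.
  apply: le_trans (ler_normD _ _) _; rewrite normrN [leRHS]splitr.
  by apply: lerD; exact: Hs'.
move=> H'; have [d [d0 Hd]] := filter_ex (filterI (nbhs_right_gt (0 : R)) H').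
by exists d => // z w zp wz; exact: Hd zp w wz.
Qed.

(** Uniform continuity of the partial derivatives on a compact ball makes the estimate of
[mean_telescope] uniform. *)
Lemma C1on_uniform R n (W : set 'rV[R]_n) (f : 'rV[R]_n -> R)
    (p : 'rV[R]_n) (r : R) : 0 < r -> (forall z, `|z - p| <= r + r -> W z) -> C1on W f ->
  (exists2 L : R, 0 <= L & forall a b, `|a - p| <= r -> `|b - p| <= r ->
     `|f a - f b| <= L * `|a - b|) /\
  (forall e, 0 < e -> exists2 d : R, 0 < d & forall a b z, `|z - p| <= r ->
     `|a - z| < d -> `|b - z| < d ->
     `|f a - f b - \sum_(i < n) (a - b) 0 i * pd i f z| <= e * `|a - b|).
Proof.
move=> r0 QW Cf.
have rr : r < r + r by rewrite ltrDl.
have r2 : 0 <= r + r by rewrite addr_ge0 // ltW.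
have df z : `|z - p| < r + r -> forall i, derivable f z (delta_mx 0 i).
  by move=> /ltW/QW/Cf[Df _] i; exact: diff_derivable.
split.
  have [M M0 HM] : exists2 M : R, 0 <= M & forall i z, `|z - p| <= r + r -> `|pd i f z| <= M.
    by apply: finite_bound => i; apply: bounded_on_ball => // z /QW/Cf[].
  exists (n%:R * M); first by rewrite mulr_ge0.
  move=> a b ap bp.
  have := @mean_telescope R n f p (r + r) M (fun=> 0) a b df.
  have E (v : 'rV[R]_n) : \sum_(i < n) v 0 i * 0 = 0 by rewrite big1 // => i _; rewrite mulr0.
  rewrite E subr0 -mulrA; apply; [|exact: le_lt_trans rr|exact: le_lt_trans rr].
  by move=> w wp i; rewrite subr0; apply: HM; exact: ltW.
move=> e e0.
have en : 0 < e / n.+1%:R by rewrite divr_gt0.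
have /choice[d Hd] : forall i, exists d : R, 0 < d /\ forall z w, `|z - p| <= r ->
    `|w - z| < d -> `|pd i f w - pd i f z| <= e / n.+1%:R.
  move=> i; have [|d d0 H] := @uniform_continuity_ball R n p r (e / n.+1%:R) (pd i f) en.
    by move=> z zp; apply: (Cf z _).2; apply: QW; exact: le_trans (ltW rr).
  by exists d.
pose d0 := \big[Num.min/r]_i d i.
have d00 : 0 < d0 by apply/bigmin_gtP; split=> // i _; have [] := Hd i.
exists d0 => // a b z zp az bz.
have := @mean_telescope R n f z d0 (e / n.+1%:R) (fun i => pd i f z) a b.
move=> /(_ _ _ az bz) H; apply: le_trans (H _ _) _.
- move=> w wz i; apply: df; rewrite -(subrKA z).
  apply: le_lt_trans (ler_normD _ _) _; rewrite addrC; apply: ler_ltD => //.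
  apply: lt_le_trans wz _; exact: bigmin_le_id.
- move=> w wz i; apply: (Hd i).2 => //; apply: lt_le_trans wz _; exact: bigmin_le_cond.
- rewrite mulrA ler_wpM2r // mulrCA ler_piMr ?(ltW e0) //.
  by rewrite ler_pdivrMr // mul1r ler_nat.
Qed.

(** The retraction onto the closed ball of center [p] and radius [r] of the sup norm. *)
Definition clamp R n (p : 'rV[R]_n) (r : R) (u : 'rV[R]_n) : 'rV[R]_n :=
  \row_i Num.max (p 0 i - r) (Num.min (p 0 i + r) (u 0 i)).

Lemma clamp_id R n (p : 'rV[R]_n) (r : R) (u : 'rV[R]_n) :
  `|u - p| <= r -> clamp p r u = u.
Proof.
move=> H; apply/rowP => i; rewrite mxE.
have := le_trans (row_norm_ge (u - p) i) H; rewrite row_subE ler_distl => /andP[h1 h2].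
by rewrite (min_idPr h2) (max_idPr h1).
Qed.

Lemma clamp_ball R n (p : 'rV[R]_n) (r : R) (u : 'rV[R]_n) :
  0 <= r -> `|clamp p r u - p| <= r.
Proof.
move=> r0; apply: row_norm_le => // i; rewrite row_subE mxE ler_distl.
rewrite le_max lexx /= ge_max ge_min lexx /= andbT; lra.
Qed.

Lemma dist_max R (a x y : R) : `|Num.max a x - Num.max a y| <= `|x - y|.
Proof.
have := ler_norm (x - y); have := ler_norm (y - x); rewrite (distrC y).
move: (`|x - y|) => d; rewrite ler_distl.
by case: (leP a x); case: (leP a y) => *; apply/andP; split; lra.
Qed.

Lemma dist_min R (a x y : R) : `|Num.min a x - Num.min a y| <= `|x - y|.
Proof.
have := ler_norm (x - y); have := ler_norm (y - x); rewrite (distrC y).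
move: (`|x - y|) => d; rewrite ler_distl.
by case: (leP a x); case: (leP a y) => *; apply/andP; split; lra.
Qed.

Lemma clamp_lipschitz R n (p : 'rV[R]_n) (r : R) (u v : 'rV[R]_n) :
  0 <= r -> `|clamp p r u - clamp p r v| <= `|u - v|.
Proof.
move=> r0; apply: row_norm_le => // i; rewrite row_subE !mxE.
apply: le_trans (row_norm_ge (u - v) i); rewrite row_subE.
by apply: le_trans (dist_max _ _ _) _; exact: dist_min.
Qed.

Lemma open_ball_sub R n (W : set 'rV[R]_n) (p : 'rV[R]_n) :
  open W -> W p -> exists2 r : R, 0 < r & forall z, `|z - p| <= r -> W z.
Proof.
move=> oW Wp; have /nbhs_ballP[r /= r0 H] := open_nbhs_nbhs (conj oW Wp).
exists (r / 2); first by rewrite divr_gt0.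
move=> z zp; apply: H; rewrite -ball_normE /= distrC; apply: le_lt_trans zp _.
by rewrite ltr_pdivrMr // ltr_pMr // ltr1n.
Qed.

(** Take [Y] to be [X] after the retraction [clamp] onto a small ball: it is bounded and Lipschitz
on the whole space, so it has a complete flow. Its values being values of [X], it inherits
identities such as a constant coordinate. *)
Lemma global_extension R n (W : set 'rV[R]_n) (X : 'rV[R]_n -> 'rV[R]_n)
    (p : 'rV[R]_n) : open W -> W p -> (forall k, C1on W (fun u => X u 0 k)) ->
  exists (rho K L : R) (Y : 'rV[R]_n -> 'rV[R]_n) (J : 'rV[R]_n -> 'M[R]_n),
  [/\ 0 < rho, forall u, `|u - p| <= rho -> W u /\ Y u = X u,
    forall u, exists2 w, W w & Y u = X w, bounded_lipschitz K L Y &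
    strict_jacobian p rho L Y J].
Proof.
move=> oW Wp CX; have [r0 r00 Wr0] := open_ball_sub oW Wp.
pose r := r0 / 2.
have r_gt0 : 0 < r by rewrite divr_gt0.
have rr z : `|z - p| <= r + r -> W z by rewrite /r -splitr; exact: Wr0.
have r_ge0 := ltW r_gt0.
have Wr z : `|z - p| <= r -> W z by move=> /le_trans H; apply/rr/H; rewrite lerDl.
have U k := C1on_uniform r_gt0 rr (CX k).
pose Y u := X (clamp p r u).
have Wc u : W (clamp p r u) by apply/Wr/clamp_ball.
have [K K0 HK] : exists2 K : R, 0 <= K & forall k z, `|z - p| <= r -> `|X z 0 k| <= K.
  apply: finite_bound => k; apply: bounded_on_ball => // z /Wr/(CX k)[Dz _].
  exact: differentiable_continuous.
have [L1 L10 HL1] : exists2 L : R, 0 <= L & forall k (ab : 'rV[R]_n * 'rV[R]_n), `|ab.1 - p| <= r /\ `|ab.2 - p| <= r ->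
    `|(X ab.1 0 k - X ab.2 0 k) / `|ab.1 - ab.2| | <= L.
  apply: finite_bound => k; have [[L L0 H] _] := U k; exists L => // -[a b] /= [ap bp].
  have [ab|ab] := eqVneq (`|a - b|) 0; first by rewrite ab invr0 mulr0 normr0.
  rewrite normrM normfV normr_id ler_pdivrMr ?lt_neqAle 1?eq_sym ?ab ?normr_ge0 //.
  exact: H.
have [M M0 HM] : exists2 M : R, 0 <= M & forall k z, `|z - p| <= r ->
    `|\sum_(i < n) `|pd i (fun u => X u 0 k) z| | <= M.
  apply: finite_bound => k; apply: bounded_on_ball => // z /Wr/(CX k)[_ Cz].
  by apply: (cvg_sum_ord (nbhs_filter z)) => i; apply: norm_comp_continuous; exact: Cz.
pose L := L1 + M + 1.
have L0 : 0 < L by rewrite ltr_wpDl // addr_ge0.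
have YL a b : `|Y a - Y b| <= L * `|a - b|.
  apply: (@le_trans _ _ (L1 * `|clamp p r a - clamp p r b|)); last first.
    by apply: ler_pM => //; [rewrite /L; lra|exact: clamp_lipschitz].
  apply: row_norm_le => [|k]; first exact: mulr_ge0.
  have := HL1 k (clamp p r a, clamp p r b) (conj (clamp_ball _ _ r_ge0) (clamp_ball _ _ r_ge0)).
  rewrite /= row_subE; have [/eqP|ab] := eqVneq (`|clamp p r a - clamp p r b|) 0.
    by rewrite normr_eq0 subr_eq0 => /eqP E _; rewrite /Y E !subrr !normr0 mulr0.
  by rewrite normrM normfV normr_id ler_pdivrMr ?lt_neqAle 1?eq_sym ?ab ?normr_ge0.
pose J z := \matrix_(i < n, k < n) pd i (fun u => X u 0 k) z.
have JE (v z : 'rV[R]_n) k : (v *m J z) 0 k = \sum_(i < n) v 0 i * pd i (fun u => X u 0 k) z.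
  by rewrite mxE; apply: eq_bigr => i _; rewrite mxE.
have YX u : `|u - p| <= r -> Y u = X u by move=> up; rewrite /Y clamp_id.
exists r, K, L, Y, J; split=> //.
- by move=> u up; split; [exact: Wr|exact: YX].
- by move=> u; exists (clamp p r u).
- split=> // a; apply: row_norm_le => // k; apply: HK; exact: clamp_ball.
split.
- move=> z v /ltW zp; apply: row_norm_le => [|k]; first by rewrite mulr_ge0 // ltW.
  rewrite JE; apply: le_trans (ler_norm_sum _ _ _) _.
  apply: (@le_trans _ _ (\sum_(i < n) `|pd i (fun u => X u 0 k) z| * `|v|)).
    apply: ler_sum => i _; rewrite normrM mulrC ler_wpM2l //; exact: row_norm_ge.
  rewrite -mulr_suml ler_wpM2r //.
  apply: le_trans (ler_norm _) _; apply: le_trans (HM k z zp) _; rewrite /L; lra.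
- move=> e e0; have /choice[d Hd] : forall k, exists d : R, 0 < d /\ forall a b z : 'rV[R]_n, `|z - p| <= r ->
     `|a - z| < d -> `|b - z| < d ->
     `|X a 0 k - X b 0 k - \sum_(i < n) (a - b) 0 i * pd i (fun u => X u 0 k) z| <= e * `|a - b|.
    by move=> k; have [_ /(_ e e0)[d d0 H]] := U k; exists d.
  exists (\big[Num.min/r]_k d k).
    by apply/bigmin_gtP; split=> // k _; have [] := Hd k.
  move=> a b z /ltW ap /ltW bp /ltW zp az bz; rewrite (YX a ap) (YX b bp).
  apply: row_norm_le => [|k]; first by rewrite mulr_ge0 // ltW.
  rewrite !row_subE JE; apply: (Hd k).2 => //.
    by apply: lt_le_trans az _; exact: bigmin_le_cond.
  by apply: lt_le_trans bz _; exact: bigmin_le_cond.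
Qed.

(** * Flow boxes *)

Section pointwise_continuity.
Context {R : realType} {T : topologicalType}.
Implicit Types (x : T).

Lemma cont_cst (U : topologicalType) (a : U) x : {for x, continuous (fun=> a)}.
Proof. exact: cvg_cst. Qed.

Lemma cont_id x : {for x, continuous (fun u : T => u)}.
Proof. exact: cvg_id. Qed.

Lemma contD (V : normedModType R) (f g : T -> V) x : {for x, continuous f} ->
  {for x, continuous g} -> {for x, continuous (fun u => f u + g u)}.
Proof. by move=> cf cg; apply: cvgD. Qed.

Lemma contB (V : normedModType R) (f g : T -> V) x : {for x, continuous f} ->
  {for x, continuous g} -> {for x, continuous (fun u => f u - g u)}.
Proof. by move=> cf cg; apply: cvgB. Qed.

Lemma contN (V : normedModType R) (f : T -> V) x : {for x, continuous f} ->
  {for x, continuous (fun u => - f u)}.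
Proof. by move=> cf; apply: cvgN. Qed.

Lemma contM (f g : T -> R) x : {for x, continuous f} ->
  {for x, continuous g} -> {for x, continuous (fun u => f u * g u)}.
Proof. by move=> cf cg; apply: cvgM. Qed.

Lemma contV (f : T -> R) x : f x != 0 -> {for x, continuous f} ->
  {for x, continuous (fun u => (f u)^-1)}.
Proof. by move=> f0 cf; apply: cvgV. Qed.

Lemma contZ (V : normedModType R) (f : T -> R) (g : T -> V) x : {for x, continuous f} ->
  {for x, continuous g} -> {for x, continuous (fun u => f u *: g u)}.
Proof. by move=> cf cg; apply: cvgZ. Qed.

Lemma cont_sum (V : normedModType R) (n : nat) (f : 'I_n -> T -> V) x :
  (forall i, {for x, continuous (f i)}) -> {for x, continuous (fun u => \sum_(i < n) f i u)}.
Proof. by move=> cf; apply: cvg_sum_ord => i; exact: cf. Qed.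

Lemma cont_comp (U W : topologicalType) (f : T -> U) (g : U -> W) x : {for x, continuous f} ->
  {for f x, continuous g} -> {for x, continuous (fun u => g (f u))}.
Proof. by move=> cf cg; exact: (cvg_comp _ _ cf cg). Qed.

End pointwise_continuity.

Lemma continuous_row R (T : topologicalType) (n : nat) (f : T -> 'rV[R]_n) (x : T) :
  (forall i, {for x, continuous (fun u => f u 0 i)}) -> {for x, continuous f}.
Proof.
move=> H; apply/cvgrPdist_le => e e0.
have : \forall u \near x, forall i, `|f x 0 i - f u 0 i| <= e.
  apply: filter_forall => i; have := H i => /cvgrPdist_le; exact.
apply: filterS => u Hu; apply: row_norm_le => [|i]; [exact: ltW|rewrite row_subE; exact: Hu].
Qed.

Lemma continuous_coord R (T : topologicalType) (n : nat) (f : T -> 'rV[R]_n) (x : T)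
    (i : 'I_n) : {for x, continuous f} -> {for x, continuous (fun u => f u 0 i)}.
Proof.
move=> H; apply/cvgrPdist_le => e e0.
have /cvgrPdist_le/(_ e e0) := H; apply: filterS => u /(le_trans _); apply.
by rewrite -row_subE; exact: row_norm_ge.
Qed.

Lemma cont_coord R n (i : 'I_n) (x : 'rV[R]_n) :
  {for x, continuous (fun u : 'rV[R]_n => u 0 i)}.
Proof. exact: coord_continuous. Qed.

Lemma continuous_near_eq (T U : topologicalType) (f g : T -> U) (x : T) :
  (\forall u \near x, f u = g u) -> {for x, continuous f} -> {for x, continuous g}.
Proof.
move=> fg cf; rewrite /prop_for /continuous_at -(nbhs_singleton fg).
exact: cvg_trans (near_eq_cvg fg) cf.
Qed.

Lemma flow_comp_continuous R n (X : 'rV[R]_n -> 'rV[R]_n) (K L : R) Phi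
    (T : topologicalType) (a : T -> R) (b : T -> 'rV[R]_n) (u0 : T) :
  bounded_lipschitz K L X -> is_flow X Phi ->
  {for u0, continuous a} -> {for u0, continuous b} ->
  {for u0, continuous (fun u => Phi (a u) (b u))}.
Proof.
move=> [K0 /ltW L0 XL XK] fP ca cb.
have [D D0 PL] := flow_lipschitz `|a u0| L0 XL fP.
have PK := flow_time K0 XK fP.
apply/cvgrPdist_le => e e0.
have e1 : 0 < e / (2 * (K + 1)) by rewrite divr_gt0 // mulr_gt0 // ltr_wpDl.
have e2 : 0 < e / (2 * D) by rewrite divr_gt0 // mulr_gt0.
near=> u.
have -> : Phi (a u0) (b u0) - Phi (a u) (b u) =
  (Phi (a u0) (b u0) - Phi (a u0) (b u)) + (Phi (a u0) (b u) - Phi (a u) (b u)) by rewrite subrKA.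
apply: le_trans (ler_normD _ _) _; rewrite [leRHS]splitr; apply: lerD.
  apply: le_trans (PL _ _ _ (lexx _)) _; rewrite mulrC -ler_pdivlMr //.
  rewrite -mulrA -invfM; near: u; exact: cvgr_dist_le.
apply: le_trans (PK _ _ _) _.
apply: (@le_trans _ _ ((K + 1) * `|a u0 - a u|)); first by rewrite ler_wpM2r // lerDl.
rewrite mulrC -ler_pdivlMr ?ltr_wpDl // -mulrA -invfM; near: u; exact: cvgr_dist_le.
Unshelve. all: by end_near. Qed.

Lemma is_derive_of_quadratic R (V : normedModType R) (m : R -> V) (d : V) (C : R) :
  (forall t, `|m t - m 0 - t *: d| <= C * `|t| ^+ 2) -> is_derive (0 : R) 1 m d.
Proof.
move=> H.
have L : (fun h => h^-1 *: ((m \o shift (0 : R)) (h *: 1) - m 0)) @ (0 : R)^' --> d.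
  apply/cvgrPdist_le => e e0.
  have C0 : 0 < `|C| + 1 by rewrite ltr_wpDl.
  have eC : 0 < e / (`|C| + 1) by rewrite divr_gt0.
  near=> h.
  have h0 : h != 0 by near: h; exact: nbhs_dnbhs_neq.
  have -> : (m \o shift (0 : R)) (h *: 1) = m h by rewrite /= addr0 [h *: 1]mulr1.
  have -> : d - h^-1 *: (m h - m 0) = - h^-1 *: (m h - m 0 - h *: d).
    move: (m h - m 0) => w.
    by rewrite scaleNr scalerBr scalerA mulVf // scale1r opprB.
  rewrite normrZ normrN normfV mulrC ler_pdivrMr ?normr_gt0 //.
  apply: le_trans (H h) _; rewrite expr2 mulrA ler_wpM2r //.
  apply: (@le_trans _ _ ((`|C| + 1) * `|h|)).
    by rewrite ler_wpM2r //; have := ler_norm C; clear; lra.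
  rewrite mulrC -ler_pdivlMr // ltW //; near: h; exact: dnbhs0_lt.
split; first by apply/cvg_ex; exists d.
exact: cvg_lim.
Unshelve. all: by end_near. Qed.

(** Follows from [Phi s y = y + s *: X y + O(s ^+ 2)], uniformly in [y]. In a flow box, moving a point
changes at once the point and the time needed to flow back to the transversal. *)
Lemma flow_diagonal_derive R n (X : 'rV[R]_n -> 'rV[R]_n) (K L : R) Phi
    (x e : 'rV[R]_n) (c : R) :
  bounded_lipschitz K L X -> is_flow X Phi ->
  is_derive (0 : R) 1 (fun t => Phi (- (t * c)) (t *: e + x)) (e - c *: X x).
Proof.
move=> [K0 /ltW L0 XL XK] fP; have [P0 DP] := fP.
have PK := flow_time K0 XK fP.
have quad s y : `|Phi s y - y - s *: X y| <= L * K * `|s| ^+ 2.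
  apply: row_norm_le => [|i]; first by rewrite !mulr_ge0 // exprn_ge0.
  have D : forall r : R, is_derive r 1 (fun r => Phi r y 0 i - r * X y 0 i) (X (Phi r y) 0 i - X y 0 i).
    move=> r; apply: is_deriveB; first exact: is_derive_coord.
    have -> : (fun r : R => r * X y 0 i) = (fun r => X y 0 i * r).
      by apply/funext => q; rewrite mulrC.
    by rewrite -[X in is_derive _ _ _ X]mulr1; exact: is_deriveMc.
  have [r rs E] := @mean_value_any R _ _ 0 s (fun r _ => D r).
  rewrite row_subE row_subE !mxE.
  move: E; rewrite P0 mul0r !subr0 => E.
  rewrite addrAC E normrM expr2 mulrA ler_wpM2r //.
  apply: (@le_trans _ _ `|X (Phi r y) - X y|); first by rewrite -row_subE; exact: row_norm_ge.
  apply: le_trans (XL _ _) _; rewrite -mulrA ler_wpM2l //.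
  have := PK y r 0; rewrite P0 subr0 => /le_trans; apply; rewrite ler_wpM2l //.
  move: rs; clear; rewrite ler_norml; case: (leP 0 s) => s0 /andP[? ?].
    by rewrite ger0_norm //; apply/andP; split; lra.
  by rewrite ltr0_norm //; apply/andP; split; lra.
apply: (@is_derive_of_quadratic _ _ _ _ (L * K * c ^+ 2 + `|c| * L * `|e|)) => t.
rewrite mul0r oppr0 P0 scale0r add0r.
have -> : Phi (- (t * c)) (t *: e + x) - x - t *: (e - c *: X x) =
  (Phi (- (t * c)) (t *: e + x) - (t *: e + x) - (- (t * c)) *: X (t *: e + x))
  - (t * c) *: (X (t *: e + x) - X x).
  by apply/rowP => i; rewrite !mxE; ring.
apply: le_trans (ler_normB _ _) _; rewrite mulrDl; apply: lerD.
  apply: le_trans (quad _ _) _; rewrite normrN normrM exprMn [`|c| ^+ 2]real_normK ?num_real //.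
  by rewrite [X in _ * X]mulrC mulrA.
rewrite normrZ normrM; apply: (@le_trans _ _ (`|t| * `|c| * (L * `|t *: e|))).
  by rewrite ler_wpM2l // ?mulr_ge0 //; have := XL (t *: e + x) x; rewrite addrK.
by rewrite normrZ; rewrite le_eqVlt; apply/orP; left; apply/eqP; ring.
Qed.

Lemma unit_ballE R n (x : 'rV[R]_n) :
  ball (0 : 'rV[R]_n) 1 x = (`|x| < 1) :> Prop.
Proof. by rewrite -ball_normE /= sub0r normrN. Qed.

Definition set_first R n (y : 'rV[R]_n.+1) (t : R) : 'rV[R]_n.+1 :=
  \row_i if i == 0 then t else y 0 i.

(** Since [X] has component 1 along [j0], the hyperplane where that coordinate equals [p 0 j0] is a
transversal, and the time since an orbit crossed it is [tau x = x 0 j0 - p 0 j0]. Hence the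
chart, which flows from the transversal during the time [delta * y 0 0], has an explicit inverse:
flow back by [tau x]. *)
Lemma flow_box R n (j0 : 'I_n.+1) (W : set 'rV[R]_n.+1)
    (X : 'rV[R]_n.+1 -> 'rV[R]_n.+1) (p : 'rV[R]_n.+1) :
  open W -> W p -> (forall k, C1on W (fun u => X u 0 k)) -> (forall u, W u -> X u 0 j0 = 1) ->
  exists (V : set 'rV[R]_n.+1) (h k : 'rV[R]_n.+1 -> 'rV[R]_n.+1) (delta : R),
  [/\ 0 < delta, open V, V p, V `<=` W & C1_diffeo V (ball (0 : 'rV[R]_n.+1) 1) h k] /\
  [/\ continuous k, forall y, `|y| <= 1 -> W (k y) &
    forall y t, `|set_first y t| <= 1 ->
      is_derive t 1 (fun s => k (set_first y s)) (delta *: X (k (set_first y t)))].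
Proof.
move=> oW Wp CX Xj0.
have [rho [K [L [Y [J [rho0 YX YW BL SJ]]]]]] := global_extension oW Wp CX.
have [K0 L_gt0 YL YK] := BL; have L0 := ltW L_gt0.
have [Phi fP] := flow_exists BL.
have [P0 DP] := fP.
have PK := flow_time K0 YK fP.
have Padd := flow_add L0 YL fP.
have K1 : 0 < 2 * (K + 1) by rewrite mulr_gt0 // ltr_wpDl.
pose T := rho / (2 * (K + 1)).
have T0 : 0 < T by rewrite divr_gt0.
have KT : K * T <= rho / 2.
  rewrite /T mulrCA ler_pM2l // ler_pdivrMr //.
  by rewrite mulrA mulVf // mul1r lerDl.
have FD := flow_derivable BL fP (ltW T0) KT SJ.
have Fc := fun (U : topologicalType) a b (u0 : U) =>
  @flow_comp_continuous R n.+1 Y K L Phi U a b u0 BL fP.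
(* the image of the cube must stay where [Y] is [X] and where the flow is differentiable *)
pose delta := Num.min (rho / 8) (T / 2).
have d0 : 0 < delta by rewrite lt_min !divr_gt0.
have dn0 : delta != 0 by rewrite gt_eqF.
have dr : delta <= rho / 8 by rewrite ge_min lexx.
have dT2 : delta <= T / 2 by rewrite ge_min lexx orbT.
have dT : delta < T by apply: le_lt_trans dT2 _; rewrite ltr_pdivrMr // ltr_pMr // ltr1n.
have Kd : K * delta <= rho / 4.
  apply: (@le_trans _ _ (K * (T / 2))); first by rewrite ler_wpM2l.
  by move: KT; clear; lra.
clearbody delta.
have Y1 u : Y u 0 j0 = 1 by have [w Ww ->] := YW u; exact: Xj0.
have Pj0 t x : Phi t x 0 j0 = x 0 j0 + t.
  have D : forall r : R, is_derive r 1 (fun r => Phi r x 0 j0 - r) 0.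
    move=> r; rewrite -(subrr (1 : R)); apply: is_deriveB.
    by have := is_derive_coord j0 (DP x r); rewrite Y1.
  have [c _] := @mean_value_any R _ _ 0 t (fun r _ => D r).
  rewrite mul0r P0 subr0 => /eqP; rewrite subr_eq0 subr_eq => /eqP.
  by rewrite addrC.
(* [E] embeds the coordinates other than 0 in the transversal, with 0 and [j0] exchanged *)
pose s : 'I_n.+1 -> 'I_n.+1 := tperm ord0 j0.
have ss i : s (s i) = i by exact: tpermK.
have s0 : s 0 = j0 by exact: tpermL.
have sj0 : s j0 = 0 by exact: tpermR.
have sE i : (s i == j0) = (i == 0) by rewrite -s0 (inj_eq perm_inj).
have sE' i : (s i == 0) = (i == j0) by rewrite -sj0 (inj_eq perm_inj).
pose E (y : 'rV[R]_n.+1) : 'rV[R]_n.+1 := \row_j (p 0 j + if j == j0 then 0 else delta * y 0 (s j)).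
pose k (y : 'rV[R]_n.+1) := Phi (delta * y 0 0) (E y).
pose tau (x : 'rV[R]_n.+1) := x 0 j0 - p 0 j0.
pose psi (x : 'rV[R]_n.+1) := Phi (- tau x) x.
pose h (x : 'rV[R]_n.+1) : 'rV[R]_n.+1 :=
  \row_i ((if i == 0 then tau x else psi x 0 (s i) - p 0 (s i)) / delta).
have tauk (y : 'rV[R]_n.+1) : tau (k y) = delta * y 0 0.
  by rewrite /tau /k Pj0 mxE eqxx addr0 addrAC subrr add0r.
have hk (y : 'rV[R]_n.+1) : h (k y) = y.
  apply/rowP => i; rewrite mxE; case: eqP => [->|/eqP i0].
    by rewrite tauk mulrAC mulfV // mul1r.
  rewrite /psi tauk /k -Padd addNr P0 mxE sE (negbTE i0) ss.
  by rewrite addrAC subrr add0r mulrAC mulfV // mul1r.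
have Eh (x : 'rV[R]_n.+1) : E (h x) = psi x.
  apply/rowP => j; rewrite mxE; case: eqP => [->|/eqP jj].
    by rewrite /psi Pj0 /tau opprB addr0 addrC subrK.
  by rewrite mxE sE' (negbTE jj) ss mulrC divfK // addrC subrK.
have kh (x : 'rV[R]_n.+1) : k (h x) = x.
  rewrite /k Eh [X in delta * X]mxE eqxx mulrC divfK // /psi -Padd subrr; exact: P0.
have tau_c : continuous tau.
  by move=> x; apply: contB; [exact: cont_coord|exact: cont_cst].
have E_c : continuous E.
  move=> y; apply: continuous_row => j.
  have -> : (fun u => E u 0 j) = (fun u => p 0 j + if j == j0 then 0 else delta * u 0 (s j)).
    by apply/funext => u; rewrite mxE.
  apply: contD; first exact: cont_cst.
  case: eqP => _; first exact: cont_cst.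
  by apply: contM; [exact: cont_cst|exact: cont_coord].
have psi_c : continuous psi.
  by move=> x; exact: (Fc _ (fun x => - tau x) id x (contN (tau_c x)) (@cont_id _ x)).
have psi_ci i (x : 'rV[R]_n.+1) : {for x, continuous (fun u => psi u 0 i)}.
  by apply: continuous_coord; exact: psi_c.
have k_c : continuous k.
  move=> y; apply: (Fc _ (fun y : 'rV[R]_n.+1 => delta * y 0 0) E y _ (E_c y)).
  by apply: contM; [exact: cont_cst|exact: cont_coord].
have h_c : continuous h.
  move=> x; apply: continuous_row => i.
  have -> : (fun u => h u 0 i) = (fun x => (if i == 0 then tau x else psi x 0 (s i) - p 0 (s i)) / delta).
    by apply/funext => u; rewrite mxE.
  apply: contM; last exact: cont_cst.
  case: eqP => _; first exact: tau_c.
  by apply: contB; [exact: psi_ci|exact: cont_cst].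
have Ep (y : 'rV[R]_n.+1) : `|y| <= 1 -> `|E y - p| <= delta.
  move=> y1; apply: row_norm_le => [|j]; first exact: ltW.
  rewrite row_subE mxE addrAC subrr add0r; case: eqP => _; first by rewrite normr0 ltW.
  rewrite normrM (gtr0_norm d0) ler_piMr // ?(ltW d0) //.
  by apply: le_trans y1; exact: row_norm_ge.
have kp (y : 'rV[R]_n.+1) : `|y| <= 1 -> `|k y - p| < rho / 2.
  move=> y1; have -> : k y - p = (Phi (delta * y 0 0) (E y) - Phi 0 (E y)) + (E y - p).
    by rewrite P0 subrKA.
  apply: le_lt_trans (ler_normD _ _) _.
  have A := PK (E y) (delta * y 0 0) 0.
  have B : K * `|delta * y 0 0 - 0| <= K * delta.
    rewrite subr0 ler_wpM2l // normrM (gtr0_norm d0) ler_piMr // ?(ltW d0) //.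
    by apply: le_trans y1; exact: row_norm_ge.
  have C := Ep y y1.
  move: A B C Kd dr rho0; clear; lra.
have kp' (y : 'rV[R]_n.+1) : `|y| <= 1 -> `|k y - p| <= rho.
  by move=> /kp/ltW/le_trans; apply; rewrite ler_pdivrMr // ler_pMr // ler1n.
have kW (y : 'rV[R]_n.+1) : `|y| <= 1 -> W (k y) by move=> /kp'/YX[].
have kY (y : 'rV[R]_n.+1) : `|y| <= 1 -> Y (k y) = X (k y) by move=> /kp'/YX[].
pose V : set 'rV[R]_n.+1 := [set x | `|h x| < 1].
have oV : open V.
  have -> : V = h @^-1` (ball (0 : 'rV[R]_n.+1) 1).
    by apply/seteqP; split=> x; rewrite /V /= unit_ballE.
  apply: open_comp; first by move=> x _; exact: h_c.
  exact: ball_open.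
have Vk (x : 'rV[R]_n.+1) : V x -> exists2 y, `|y| < 1 & x = k y by move=> Vx; exists (h x); rewrite ?kh.
have Vp (x : 'rV[R]_n.+1) : V x -> `|x - p| < rho / 2 /\ `|tau x| < T.
  move=> /Vk[y y1 ->]; split; first by apply: kp; exact: ltW.
  rewrite tauk normrM (gtr0_norm d0); apply: le_lt_trans dT.
  rewrite ler_piMr ?(ltW d0) //; apply: le_trans (ltW y1); exact: row_norm_ge.
have Y_c : continuous Y by exact: lipschitz_continuous YL.
have cG (U : topologicalType) (a : U -> R) (b : U -> 'rV[R]_n.+1) (u0 : U) (e : 'rV[R]_n.+1) :
    `|b u0 - p| < rho / 2 -> `|a u0| < T ->
    {for u0, continuous a} -> {for u0, continuous b} ->
    {for u0, continuous (fun u => 'D_e (Phi (a u)) (b u))}.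
  move=> bp aT ca cb; apply/cvgrPdistC_le => eps eps0.
  have [_ /(_ (a u0) eps aT eps0)[eta eta0 H]] := FD (b u0) e bp.
  move/cvgrPdistC_lt: ca => /(_ _ eta0); move/cvgrPdistC_lt: cb => /(_ _ eta0).
  by apply: filterS2 => u ub ua; exact: H.
pose dk (j : 'I_n.+1) (y : 'rV[R]_n.+1) : 'rV[R]_n.+1 := if j == 0 then delta *: Y (k y) else
  'D_(delta *: delta_mx 0 (s j)) (Phi (delta * y 0 0)) (E y).
have dp : delta < rho / 2 by move: dr rho0; clear; lra.
have dy (y : 'rV[R]_n.+1) : `|y| < 1 -> `|delta * y 0 0| < T.
  move=> /ltW y1; apply: le_lt_trans dT; rewrite normrM (gtr0_norm d0) ler_piMr ?(ltW d0) //.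
  by apply: le_trans y1; exact: row_norm_ge.
have Dk (y : 'rV[R]_n.+1) j : `|y| < 1 -> is_derive y (delta_mx 0 j) k (dk j y).
  move=> y1; apply: is_derive_along; rewrite /dk; case: eqP => [->|/eqP jn0].
    have -> : (fun t => k (t *: delta_mx 0 0 + y)) = (fun t => Phi (delta * t + delta * y 0 0) (E y)).
      apply/funext => t; rewrite /k !mxE !eqxx mulr1 mulrDr; congr (Phi _ _).
      apply/rowP => q; rewrite !mxE; case: eqP => // /eqP qj; rewrite sE' (negbTE qj).
      by rewrite andbF mulr0 add0r.
    have -> : k y = Phi (delta * 0 + delta * y 0 0) (E y) by rewrite mulr0 add0r.
    by apply: is_derive_affine; exact: DP.
  have -> : (fun t => k (t *: delta_mx 0 j + y)) =
      (fun t => Phi (delta * y 0 0) (t *: (delta *: delta_mx 0 (s j)) + E y)).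
    apply/funext => t; rewrite /k !mxE eqxx (eq_sym 0 j) (negbTE jn0) mulr0 add0r; congr (Phi _ _).
    apply/rowP => q; rewrite !mxE eqxx /=; case: eqP => [->|/eqP qj].
      by rewrite (eq_sym j0) sE (negbTE jn0) !mulr0 add0r.
    have -> : (s q == j) = (q == s j) by rewrite -{2}(ss q) (inj_eq perm_inj).
    by case: (q == s j); rewrite ?mulr1 ?mulr0; ring.
  have [+ _] := FD (E y) (delta *: delta_mx 0 (s j)) (le_lt_trans (Ep y (ltW y1)) dp).
  move=> /(_ _ (ltW (dy y y1))) D.
  have := @is_derive_line R _ _ (Phi (delta * y 0 0)) (E y) (delta *: delta_mx 0 (s j)) 0.
  have -> : 0 *: (delta *: delta_mx 0 (s j)) + E y = E y by rewrite scale0r add0r.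
  by move=> H; apply: H; exact: D.
have dk_c j (y : 'rV[R]_n.+1) : `|y| < 1 -> {for y, continuous (dk j)}.
  move=> y1; rewrite /dk; case: eqP => _.
    by apply: contZ; [exact: cont_cst|apply: cont_comp; [exact: k_c|exact: Y_c]].
  apply: cG; [exact: le_lt_trans (Ep y (ltW y1)) dp|exact: dy| |exact: E_c].
  by apply: contM; [exact: cont_cst|exact: cont_coord].
(* [psi] flows back by [tau]; near [x] this is the flow during the fixed time [- tau x] after the
   flow during the remaining short time, whence [d j x] by [flow_diagonal_derive] *)
pose cj (j : 'I_n.+1) : R := (delta_mx 0 j : 'rV[R]_n.+1) 0 j0.
pose d (j : 'I_n.+1) (x : 'rV[R]_n.+1) : 'rV[R]_n.+1 := delta_mx 0 j - cj j *: Y x.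
pose dpsi (j l : 'I_n.+1) (x : 'rV[R]_n.+1) : R :=
  \sum_(i < n.+1) d j x 0 i * ('D_(delta_mx 0 i) (Phi (- tau x)) x) 0 l.
have Dpsi (x : 'rV[R]_n.+1) j l : V x -> is_derive x (delta_mx 0 j) (fun u => psi u 0 l) (dpsi j l x).
  move=> /Vp[xp xT]; apply: is_derive_along.
  pose f (u : 'rV[R]_n.+1) := Phi (- tau x) u 0 l.
  pose m (t : R) : 'rV[R]_n.+1 := Phi (- (t * cj j)) (t *: delta_mx 0 j + x).
  have -> : (fun t => psi (t *: delta_mx 0 j + x) 0 l) = f \o m.
    apply/funext => t; rewrite /psi /f /m /= -Padd; congr (Phi _ _ 0 l).
    by rewrite /tau !mxE /cj mxE; ring.
  have xT' : `|- tau x| < T by rewrite normrN.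
  have nearx : \forall u \near x, `|u - p| < rho / 2.
    apply/nbhs_ballP; exists (rho / 2 - `|x - p|); first by rewrite /= subr_gt0.
    move=> u; rewrite -ball_normE /= distrC ltrBrDr => ux.
    by have := ler_normD (u - x) (x - p); rewrite subrKA => /le_lt_trans; apply.
  have Df (u : 'rV[R]_n.+1) i : `|u - p| < rho / 2 -> derivable (Phi (- tau x)) u (delta_mx 0 i).
    by move=> up; have [+ _] := FD u (delta_mx 0 i) up; apply; exact: ltW.
  have pdf (u : 'rV[R]_n.+1) i : `|u - p| < rho / 2 -> pd i f u = ('D_(delta_mx 0 i) (Phi (- tau x)) u) 0 l.
    by move=> up; rewrite (derive_mx (Df u i up)) mxE.
  have m0 : m 0 = x by rewrite /m mul0r oppr0 P0 scale0r add0r.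
  have dfx : differentiable f (m 0).
    rewrite m0; apply: differentiable_of_partial.
      by apply: filterS nearx => u up i; move/derivable_mxP: (Df u i up); exact.
    move=> i; apply: (@continuous_near_eq _ _ (fun u => ('D_(delta_mx 0 i) (Phi (- tau x)) u) 0 l)).
      by apply: filterS nearx => u up; rewrite pdf.
    apply: continuous_coord; exact: (cG _ (fun=> - tau x) id x _ xp xT' (@cont_cst _ _ _ _) (@cont_id _ _)).
  have := @is_derive_chain _ _ _ _ f m 0 1 _ dfx (flow_diagonal_derive x (delta_mx 0 j) (cj j) BL fP).
  rewrite m0; congr is_derive; apply: eq_bigr => i _; by rewrite pdf.
pose dh (j i : 'I_n.+1) (x : 'rV[R]_n.+1) : R :=
  (if i == 0 then cj j else dpsi j (s i) x) / delta.
have Dh (x : 'rV[R]_n.+1) j : V x -> is_derive x (delta_mx 0 j) h (\row_i dh j i x).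
  move=> Vx; apply: is_derive_row => i; rewrite mxE /dh.
  have hi : (fun u => h u 0 i) =
     (fun u => delta^-1 * (if i == 0 then tau u else psi u 0 (s i) - p 0 (s i))).
    by apply/funext => u; rewrite mxE mulrC.
  rewrite hi [X in is_derive _ _ _ X]mulrC; apply: (@is_deriveZ R _ R).
  case: eqP => _; last first.
    rewrite -[X in is_derive _ _ _ X]subr0.
    exact: (is_deriveB (Dpsi x j (s i) Vx) (is_derive_cst _ _ _)).
  rewrite -[X in is_derive _ _ _ X]subr0; apply: (is_deriveB _ (is_derive_cst _ _ _)).
  exact: is_derive_coord.
have dh_c j (x : 'rV[R]_n.+1) : V x -> {for x, continuous (fun x => \row_i dh j i x)}.
  move=> /Vp[xp xT]; apply: continuous_row => i.
  have -> : (fun u => (\row_i dh j i u) 0 i) = dh j i by apply/funext => u; rewrite mxE.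
  apply: contM; last exact: cont_cst.
  case: eqP => _; first exact: cont_cst.
  apply: cont_sum => q; apply: contM.
    have -> : (fun u => d j u 0 q) = (fun u => (delta_mx 0 j : 'rV[R]_n.+1) 0 q - cj j * Y u 0 q).
      by apply/funext => u; rewrite !mxE.
    apply: contB; first exact: cont_cst.
    by apply: contM; [exact: cont_cst|apply: continuous_coord; exact: Y_c].
  apply: continuous_coord; have xT' : `|- tau x| < T by rewrite normrN.
  exact: (cG _ (fun x => - tau x) id x _ xp xT' (contN (tau_c x)) (@cont_id _ _)).
exists V, h, k, delta.
have E_first (y : 'rV[R]_n.+1) t : E (set_first y t) = E y.
  by apply/rowP => j; rewrite !mxE; case: eqP => // /eqP jj; rewrite sE' (negbTE jj).
have Dfirst (y : 'rV[R]_n.+1) (t : R) : is_derive t 1 (fun s => k (set_first y s)) (delta *: Y (k (set_first y t))).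
  have -> : (fun s => k (set_first y s)) = (fun s => Phi (delta * s + 0) (E y)).
    by apply/funext => r; rewrite /k E_first mxE eqxx addr0.
  have -> : k (set_first y t) = Phi (delta * t + 0) (E y).
    by rewrite /k E_first mxE eqxx addr0.
  by apply: is_derive_affine; exact: DP.
split; last by split=> // y t yt; rewrite -kY //; exact: Dfirst.
split=> //.
- have -> : p = k 0; last by rewrite /V /= hk normr0 ltr01.
  rewrite /k mxE mulr0 P0; apply/rowP => j; rewrite !mxE.
  by case: eqP; rewrite ?mulr0 addr0.
- by move=> x /Vk[y y1 ->]; apply: kW; exact: ltW.
split; last by move=> x _; exact: kh.
- split; first by move=> x _; exact: h_c.
  move=> j; split; first by move=> x Vx; have [] := Dh x j Vx.
  split=> // x Vx; apply: (@continuous_near_eq _ _ (fun x => \row_i dh j i x)).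
    by apply: (filterS _ (open_nbhs_nbhs (conj oV Vx))) => u Vu; rewrite /pd (derive_of (Dh u j Vu)).
  exact: dh_c.
- split; first by move=> x _; exact: k_c.
  move=> j; split; first by move=> y; rewrite unit_ballE => y1; have [] := Dk y j y1.
  split=> // y By; apply: (@continuous_near_eq _ _ (dk j)).
    apply: (filterS _ (open_nbhs_nbhs (conj (ball_open _ _) By))) => u; rewrite unit_ballE => u1.
    by rewrite /pd (derive_of (Dk u j u1)).
  by apply: dk_c; move: By; rewrite unit_ballE.
apply/seteqP; split=> [_ [x Vx <-]|y]; rewrite unit_ballE // => y1.
by exists (k y) => //; rewrite /V /= hk.
Qed.

(** * Foliations from germs of curves *)

Definition good_curve R n (P : (R -> 'rV[R]_n) -> R -> Prop) (I : set R)
    (c : R -> 'rV[R]_n) : Prop :=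
  [/\ open I, is_interval I & forall s, I s -> P c s].

(** [P c s] is a property of the germ of [c] at the parameter [s], meant to select the geodesics
whose velocity lies in a given field of lines. *)
Record curve_germs R n (U : set 'rV[R]_n)
    (P : (R -> 'rV[R]_n) -> R -> Prop) : Prop := {
  germ_local : forall (c c' : R -> 'rV[R]_n) (s : R),
    (\forall r \near s, c r = c' r) -> P c s -> P c' s;
  germ_affine : forall (c : R -> 'rV[R]_n) (a b s : R), a != 0 ->
    P c (a * s + b) -> P (fun r => c (a * r + b)) s;
  germ_regular : forall (c : R -> 'rV[R]_n) (s : R), P c s ->
    [/\ U (c s), derivable c s 1 & derive1 c s != 0];
  germ_direction : forall (c1 c2 : R -> 'rV[R]_n) (s1 s2 : R), P c1 s1 -> P c2 s2 ->
    c1 s1 = c2 s2 -> exists a, derive1 c1 s1 = a *: derive1 c2 s2 }.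

(** A chart in which the curves selected by [P] run along the lines of the first coordinate.
[box_unique] is the uniqueness statement of an equation of second order. *)
Record curve_box R n (U : set 'rV[R]_n)
    (P : (R -> 'rV[R]_n) -> R -> Prop) (V : set 'rV[R]_n) (h k : 'rV[R]_n -> 'rV[R]_n) : Prop := {
  box_open : open V;
  box_sub : V `<=` U;
  box_diffeo : C1_diffeo V (ball (0 : 'rV[R]_n) 1) h k;
  box_transverse : forall I c, good_curve P I c -> (forall s, I s -> V (c s)) ->
    forall s s', I s -> I s' -> forall j : 'I_n, (0 < j)%N -> h (c s) 0 j = h (c s') 0 j;
  box_plaque : forall x, V x -> exists I c, good_curve P I c /\
    c @` I = V `&` [set y | forall j : 'I_n, (0 < j)%N -> h y 0 j = h x 0 j];
  box_unique : forall I c1 c2 s0, good_curve P I c1 -> good_curve P I c2 ->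
    (forall s, I s -> V (c1 s)) -> (forall s, I s -> V (c2 s)) ->
    I s0 -> c1 s0 = c2 s0 -> derive1 c1 s0 = derive1 c2 s0 ->
    forall s, I s -> c1 s = c2 s }.

Lemma countable_connected_eq R (S : set R) (a b : R) :
  connected S -> countable S -> S a -> S b -> a = b.
Proof.
move=> cS countS.
have lt_absurd x y : S x -> S y -> ~ x < y.
  move=> Sx Sy xy.
  have sub : [set` `[x, y]] `<=` S.
    by move=> z; rewrite /= in_itv /= => xzy; exact: ((connected_intervalP S).1 cS x y Sx Sy).
  have := countable_lebesgue_measure0 (sub_countable (subset_card_le sub) countS).
  rewrite lebesgue_measure_itv /= lte_fin xy -EFinD => /eqP.
  by rewrite eqe subr_eq0 gt_eqF.
move=> Sa Sb; case: (ltgtP a b) => // H; first by case: (lt_absurd a b).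
by case: (lt_absurd b a).
Qed.

Section Leaves.
Context {R : realType} {n : nat}.
Implicit Types (I J : set R) (c : R -> 'rV[R]_n) (p : 'rV[R]_n).

Lemma near_open I s : open I -> I s -> \forall r \near s, I r.
Proof. by move=> oI Is; exact: open_nbhs_nbhs (conj oI Is). Qed.

Lemma itv_of_near (s : R) (Q : R -> Prop) : (\forall r \near s, Q r) ->
  exists2 e : R, 0 < e & forall r, [set` `]s - e, s + e[] r -> Q r.
Proof.
move=> /nbhs_ballP[e /= e0 He]; exists e => // r; rewrite /= in_itv /= => re.
by apply: He; rewrite ball_itv /= in_itv.
Qed.

Lemma itv_center (s e : R) : 0 < e -> [set` `]s - e, s + e[] s.
Proof. by move=> e0; rewrite /= in_itv /= ltrBlDr ltrDl e0. Qed.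

Lemma is_interval_affine I (a b : R) : is_interval I -> is_interval [set r | I (a * r + b)].
Proof.
move=> iI x y /= Ix Iy z /andP[xz zy]; have [a0|/ltW a0] := leP 0 a.
  by apply: (iI _ _ Ix Iy); rewrite !lerD2r !ler_wpM2l.
by apply: (iI _ _ Iy Ix); rewrite !lerD2r !ler_wnM2l.
Qed.

Lemma open_affine I (a b : R) : open I -> open [set r | I (a * r + b)].
Proof.
move=> oI; apply: (@open_comp _ _ (fun r => a * r + b)) => // r _.
by apply: contD; [apply: contM; [exact: cont_cst|exact: cont_id]|exact: cont_cst].
Qed.

Lemma derive1_affine c (a b s : R) : derivable c (a * s + b) 1 ->
  derive1 (fun r => c (a * r + b)) s = a *: derive1 c (a * s + b).
Proof.
move=> D; rewrite !derive1E.
have := @is_derive_affine R n c a s b _ (derivableP D).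
by move=> D'; rewrite (derive_of D').
Qed.

Context {U : set 'rV[R]_n} {P : (R -> 'rV[R]_n) -> R -> Prop}.
Hypothesis PG : curve_germs U P.
Hypothesis PB : forall p, U p -> exists V h k, V p /\ curve_box U P V h k.

Lemma good_curve_sub I J c : open J -> is_interval J -> J `<=` I -> good_curve P I c ->
  good_curve P J c.
Proof. by move=> oJ iJ JI [_ _ H]; split=> // s /JI; exact: H. Qed.

Lemma good_continuous c s : P c s -> {for s, continuous c}.
Proof.
by move=> /(germ_regular PG)[_ D _]; apply: differentiable_continuous; rewrite -derivable1_diffP.
Qed.

Lemma good_stays I c s (V : set 'rV[R]_n) : open I -> I s -> P c s -> open V -> V (c s) ->
  \forall r \near s, I r /\ V (c r).
Proof.
move=> oI Is Ps oV Vs; apply: filterI; first exact: near_open.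
by apply: (good_continuous Ps); apply: open_nbhs_nbhs.
Qed.

(** The set of parameters where positions and velocities agree is open by [box_unique]. At a limit
point of it, positions agree by continuity, and velocities because the difference quotients of
[c1 - c2] vanish at parameters arbitrarily close. *)
Lemma good_curve_unique I c1 c2 s0 : good_curve P I c1 -> good_curve P I c2 -> I s0 ->
  c1 s0 = c2 s0 -> derive1 c1 s0 = derive1 c2 s0 -> forall s, I s -> c1 s = c2 s.
Proof.
move=> g1 g2 Is0 e0 d0; have [oI iI P1] := g1; have [_ _ P2] := g2.
pose A := [set s | I s /\ (c1 s = c2 s /\ derive1 c1 s = derive1 c2 s)].
have Aloc s : A s -> \forall r \near s, A r.
  move=> [Is [es ds]]; have [Us _ _] := germ_regular PG (P1 s Is).
  have [V [h [k [Vs B]]]] := PB Us; have oV := box_open B.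
  have n1 := good_stays oI Is (P1 s Is) oV Vs.
  rewrite es in Vs; have n2 := good_stays oI Is (P2 s Is) oV Vs.
  have [e e_gt0 He] := itv_of_near (filterI n1 n2).
  have oJ : open [set` `]s - e, s + e[] by exact: itv_open.
  have iJ : is_interval [set` `]s - e, s + e[] by exact: interval_is_interval.
  have JI : [set` `]s - e, s + e[] `<=` I by move=> r /He[[]].
  have E := @box_unique _ _ _ _ _ _ _ B _ c1 c2 s (good_curve_sub oJ iJ JI g1)
    (good_curve_sub oJ iJ JI g2) (fun r Jr => (He r Jr).1.2)
    (fun r Jr => (He r Jr).2.2) (itv_center s e_gt0) es ds.
  apply: filterS (near_open oJ (itv_center s e_gt0)) => r Jr; split; first exact: JI.
  split; first exact: E.
  by apply: eq_derive1_near; apply: filterS (near_open oJ Jr) => q; exact: E.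
have oA : open A by rewrite openE => s /Aloc.
suff : A = I by move=> AI s; rewrite -AI => -[_ []].
have /connected_intervalP cI := iI; apply: cI.
- exists s0; split; [exact: Is0|split; [exact: e0|exact: d0]].
- by exists A => //; apply/seteqP; split=> s; [move=> As; split=> //; case: As|case].
exists (closure A); first exact: closed_closure.
apply/seteqP; split=> s; first by move=> As; split; [case: As|exact: subset_closure].
move=> [Is clA].
have D : is_derive s 1 (fun r => c1 r - c2 r) (derive1 c1 s - derive1 c2 s).
  rewrite !derive1E; apply: is_deriveB; apply: derivableP.
    by have [] := germ_regular PG (P1 s Is).
  by have [] := germ_regular PG (P2 s Is).
have cw : {for s, continuous (fun r => c1 r - c2 r)}.
  by apply: contB; apply: good_continuous; [exact: P1|exact: P2].
have es : c1 s = c2 s.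
  apply/eqP; rewrite -subr_eq0 -normr_le0; apply/ler_addgt0Pr => e e_gt0; rewrite add0r.
  move/cvgrPdist_le: cw => /(_ e e_gt0) nd.
  have [r [[_ [er _]]]] := clA _ nd.
  by rewrite /= er subrr subr0.
have [As //|nAs] := pselect (A s).
split; first exact: Is.
split; first exact: es.
apply/eqP; rewrite -subr_eq0 -normr_le0; apply/ler_addgt0Pr => e e_gt0.
rewrite add0r.
have [Dv Dval] := D.
have := Dv; rewrite /derivable -/('D_1 (fun r => c1 r - c2 r) s) Dval => /cvgrPdist_le/(_ e e_gt0) nd.
have : \forall r \near s, r != s -> `|derive1 c1 s - derive1 c2 s - (r - s)^-1 *: ((c1 r - c2 r) - (c1 s - c2 s))| <= e.
  move: nd => /nbhs_ballP[f /= f0 Hf]; apply/nbhs_ballP; exists f => //= r rs rns.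
  have := Hf (r - s); rewrite /= [(r - s) *: 1]mulr1 subrK; apply.
    by move: rs; rewrite -!ball_normE /= sub0r normrN distrC.
  by rewrite subr_eq0.
move=> nd'; have [r [Ar Hr]] := clA _ nd'.
have rs : r != s by apply/eqP => rs; apply: nAs; rewrite -rs.
move: (Hr rs); case: Ar => _ [er _]; rewrite er es !subrr scaler0 subr0 => H; exact: H.
Qed.

Definition normalized_curve p (v : 'rV[R]_n) I c : Prop :=
  [/\ good_curve P I c, I 0, c 0 = p & derive1 c 0 = v].

Definition maximal_normalized p (v : 'rV[R]_n) I c : Prop := normalized_curve p v I c /\
    forall I' c', normalized_curve p v I' c' -> I' `<=` I /\ forall s, I' s -> c s = c' s.

(** The union of all normalized curves; any two agree on their common domain. *)
Lemma maximal_curve p (v : 'rV[R]_n) : (exists I c, normalized_curve p v I c) ->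
  exists I c, maximal_normalized p v I c.
Proof.
move=> [I0 [c0 N0]].
pose I := [set s : R | exists I' c', normalized_curve p v I' c' /\ I' s].
have /choice[f Hf] : forall s : R, exists Jc : set R * (R -> 'rV[R]_n), I s ->
    normalized_curve p v Jc.1 Jc.2 /\ Jc.1 s.
  move=> s; have [[J [c Hc]]|nI] := pselect (I s); first by exists (J, c).
  by exists (I0, c0) => /nI.
pose c s := (f s).2 s.
have cE I' c' : normalized_curve p v I' c' -> forall s, I' s -> c s = c' s.
  move=> N' s I's; have Is : I s by exists I', c'.
  have [[gJ J0 e0 d0] Js] := Hf s Is; have [oJ iJ _] := gJ.
  have [g' I'0 e0' d0'] := N'; have [oI' iI' _] := g'.
  have oK : open ((f s).1 `&` I') by exact: openI.
  have iK : is_interval ((f s).1 `&` I').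
    by move=> x y [Jx Ix] [Jy Iy] z xyz; split; [exact: iJ xyz|exact: iI' xyz].
  apply: (@good_curve_unique ((f s).1 `&` I') (f s).2 c' 0).
  - exact: (good_curve_sub oK iK (fun r Kr => Kr.1) gJ).
  - exact: (good_curve_sub oK iK (fun r Kr => Kr.2) g').
  - by split.
  - by rewrite e0 e0'.
  - by rewrite d0 d0'.
  - by split.
have nearE I' c' : normalized_curve p v I' c' -> forall s, I' s -> \forall r \near s, c' r = c r.
  move=> N' s I's; have [[oI' _ _] _ _ _] := N'.
  by apply: filterS (near_open oI' I's) => r Ir; rewrite (cE _ _ N').
have N00 := N0; have [_ I00 e00 d00] := N00.
exists I, c; split; last first.
  by move=> I' c' N'; split; [move=> s I's; exists I', c'|exact: cE N'].
split; first split.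
- rewrite openE => s [I' [c' [N' I's]]]; have [[oI' _ _] _ _ _] := N'.
  by apply: filterS (near_open oI' I's) => r Ir; exists I', c'.
- move=> x y [I1 [c1 [N1 I1x]]] [I2 [c2 [N2 I2y]]] z /andP[xz zy].
  have [[_ i1 _] I10 _ _] := N1; have [[_ i2 _] I20 _ _] := N2.
  have [z0|/ltW z0] := leP 0 z.
    by exists I2, c2; split; [exact: N2|apply: (i2 0 y) => //; rewrite z0].
  by exists I1, c1; split; [exact: N1|apply: (i1 x 0) => //; rewrite xz].
- move=> s [I' [c' [N' I's]]]; have [[_ _ H'] _ _ _] := N'.
  exact: (germ_local PG (nearE _ _ N' s I's) (H' s I's)).
- by exists I0, c0.
- by rewrite (cE _ _ N0).
- by rewrite -(eq_derive1_near (nearE _ _ N0 0 I00)).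
Qed.

Lemma glue_curves I1 I2 c1 c2 s0 : good_curve P I1 c1 -> good_curve P I2 c2 -> I1 s0 -> I2 s0 ->
  c1 s0 = c2 s0 -> derive1 c1 s0 = derive1 c2 s0 ->
  exists c, [/\ good_curve P (I1 `|` I2) c, forall s, I1 s -> c s = c1 s & forall s, I2 s -> c s = c2 s].
Proof.
move=> g1 g2 s01 s02 e0 d0.
have [ope1 i1 H1] := g1; have [ope2 i2 H2] := g2.
pose c s := if pselect (I1 s) then c1 s else c2 s.
have cE1 s : I1 s -> c s = c1 s by rewrite /c; case: pselect.
have cE2 s : I2 s -> c s = c2 s.
  rewrite /c; case: pselect => // I1s I2s.
  have oK : open (I1 `&` I2) by exact: openI.
  have iK : is_interval (I1 `&` I2).
    by move=> x y [Jx Ix] [Jy Iy] z xyz; split; [exact: i1 xyz|exact: i2 xyz].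
  apply: (@good_curve_unique (I1 `&` I2) c1 c2 s0) => //.
  - exact: (good_curve_sub oK iK (fun r Kr => Kr.1) g1).
  - exact: (good_curve_sub oK iK (fun r Kr => Kr.2) g2).
exists c; split => //; split; first exact: openU.
  move=> x y Ix Iy z /andP[xz zy].
  have [zs|/ltW sz] := leP z s0.
    case: Ix => [Ix|Ix]; [left; apply: (i1 x s0)|right; apply: (i2 x s0)] => //; exact/andP.
  case: Iy => [Iy|Iy]; [left; apply: (i1 s0 y)|right; apply: (i2 s0 y)] => //; exact/andP.
move=> s [Is|Is].
  by apply: (germ_local PG _ (H1 s Is)); apply: filterS (near_open ope1 Is) => r Ir; rewrite cE1.
by apply: (germ_local PG _ (H2 s Is)); apply: filterS (near_open ope2 Is) => r Ir; rewrite cE2.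
Qed.

(** By [germ_direction], an affine change of parameter gives both curves the same velocity at their
common point. Then they glue to a normalized curve, which is contained in the maximal one. *)
Lemma maximal_absorbs p (v : 'rV[R]_n) I c I' c' s s' : maximal_normalized p v I c ->
  good_curve P I' c' -> I s -> I' s' -> c s = c' s' -> c' @` I' `<=` c @` I.
Proof.
move=> [[g I0 c0 dc0] max] g' Is I's' E; have [oI iI H] := g; have [oI' iI' H'] := g'.
have [a Ea] := germ_direction PG (H s Is) (H' s' I's') E.
have a0 : a != 0.
  have [_ _] := germ_regular PG (H s Is); apply: contraNneq => a0.
  by rewrite Ea a0 scale0r.
pose b := s' - a * s.
have abs : a * s + b = s' by rewrite /b addrC subrK.
pose I2 := [set r | I' (a * r + b)].
pose c2 r := c' (a * r + b).
have g2 : good_curve P I2 c2.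
  split; [exact: open_affine|exact: is_interval_affine|].
  by move=> r Ir; apply: (germ_affine PG) => //; exact: H'.
have I2s : I2 s by rewrite /I2 /= abs.
have [c3 [g3 E1 E2]] : exists c3, [/\ good_curve P (I `|` I2) c3,
    forall s, I s -> c3 s = c s & forall s, I2 s -> c3 s = c2 s].
  apply: (@glue_curves I I2 c c2 s) => //; first by rewrite /c2 abs.
  rewrite derive1_affine abs //; by have [] := germ_regular PG (H' s' I's').
have N3 : normalized_curve p v (I `|` I2) c3.
  split=> //; [by left|by rewrite E1|].
  rewrite -dc0; apply: eq_derive1_near.
  by apply: filterS (near_open oI I0) => r Ir; rewrite E1.
have [sub eqc] := max _ _ N3.
move=> _ [t It <-].
have I2r : I2 ((t - b) / a) by rewrite /I2 /= mulrC divfK // subrK.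
exists ((t - b) / a); first by apply: sub; right.
by rewrite eqc; [rewrite E2 // /c2 mulrC divfK // subrK|right].
Qed.

(** The leaves are the images of the maximal curves; by [maximal_absorbs], two that meet are equal.
In a box, a connected part of the trace of a leaf lies in one plaque: the transverse coordinates
are constant on every interval of parameters spent in the box, so they take countably many values
on the trace, one for each rational parameter at most, and a countable connected set of real
numbers is a point. *)
Lemma foliation_of_germs : exists leaves : set (set 'rV[R]_n),
  foliation_by_curves U leaves /\
  forall L, leaves L -> exists I c, [/\ good_curve P I c, {within I, continuous c} & c @` I = L].
Proof.
have start p : U p -> exists v I c, maximal_normalized p v I c.
  move=> Up; have [V [h [k [Vp B]]]] := PB Up.
  have [I [c [g cI]]] := box_plaque B Vp; have [oI iI H] := g.
  have [s0 Is0 cs0] : (c @` I) p by rewrite cI; split.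
  have N : normalized_curve p (derive1 (fun r => c (1 * r + s0)) 0) [set r | I (1 * r + s0)] (fun r => c (1 * r + s0)).
    split; [|by rewrite /= mulr0 add0r|by rewrite mulr0 add0r|by []].
    split; [exact: open_affine|exact: is_interval_affine|move=> r Ir].
    apply: (germ_affine PG); [exact: oner_neq0|exact: H].
  have [I' [c' M]] := @maximal_curve p (derive1 (fun r => c (1 * r + s0)) 0) (ex_intro _ _ (ex_intro _ _ N)).
  by exists (derive1 (fun r => c (1 * r + s0)) 0), I', c'.
have /choice[f Hf] : forall p, exists vIc : 'rV[R]_n * set R * (R -> 'rV[R]_n), U p ->
    maximal_normalized p vIc.1.1 vIc.1.2 vIc.2.
  move=> p; have [Up|nUp] := pselect (U p).
    by have [v [I [c M]]] := start p Up; exists (v, I, c).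
  by exists (0, set0, fun=> 0) => /nUp.
pose leaf p := (f p).2 @` (f p).1.2.
have good_leaf p : U p -> good_curve P (f p).1.2 (f p).2 by move=> /Hf[[]].
have absorb p I' c' s' : U p -> good_curve P I' c' -> I' s' -> leaf p (c' s') -> c' @` I' `<=` leaf p.
  by move=> Up g' I's' [s Is E]; exact: (maximal_absorbs (Hf p Up) g' Is I's' E).
have leaf_self p : U p -> leaf p p.
  by move=> /Hf[[_ I0 c0 _] _]; exists 0.
have leaf_sub p q z : U p -> U q -> leaf p z -> leaf q z -> leaf q `<=` leaf p.
  move=> Up Uq pz [s Is E]; apply: (absorb p _ _ s Up (good_leaf q Uq) Is).
  by rewrite E.
pose leaves := [set L | exists2 p, U p & L = leaf p].
have leaf_U p : U p -> leaf p `<=` U.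
  move=> Up _ [s Is <-]; have [_ _ H] := good_leaf p Up.
  by have [] := germ_regular PG (H s Is).
have cont_leaf p : U p -> {within (f p).1.2, continuous (f p).2}.
  move=> Up; have [_ _ H] := good_leaf p Up.
  by apply: continuous_in_subspaceT => s /[1!inE] Is; exact/good_continuous/H.
exists leaves; split; last first.
  move=> L [p Up ->]; exists (f p).1.2, (f p).2; split => //; [exact: good_leaf|exact: cont_leaf].
split.
- split.
  + apply/seteqP; split=> z.
      by move=> [L [p Up ->] Lz]; exact: (leaf_U p Up).
    by move=> Uz; exists (leaf z); [exists z|exact: leaf_self].
  + move=> L L' [p Up ->] [q Uq ->] [z [pz qz]].
    by apply/seteqP; split; [exact: (leaf_sub q p z)|exact: (leaf_sub p q z)].
  + by move=> L [p Up ->]; exists p; exact: leaf_self.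
- move=> L [p Up ->]; apply: connected_continuous_connected; last exact: cont_leaf.
  by apply/connected_intervalP; have [] := good_leaf p Up.
move=> p0 Up0; have [V [h [k [Vp B]]]] := PB Up0.
exists V, h, k; split=> //; [exact: box_open B|exact: box_sub B|exact: box_diffeo B|].
move=> L x [p Up ->] [Vx Lx].
have [[hc _] _ _ _] := box_diffeo B.
have oV := box_open B.
apply/seteqP; split=> y.
- move=> [C [Cx CVL cC] Cy]; split; first by have [] := CVL y Cy.
  move=> j j0; pose hj z := h z 0 j.
  have chj : connected (hj @` C).
    apply: connected_continuous_connected => //.
    apply: continuous_in_subspaceT => z /[1!inE] /CVL[Vz _].
    by apply: continuous_coord; exact: hc.
  have [oI iI H] := good_leaf p Up.
  have count : countable (hj @` C).
    apply: (@sub_countable _ _ _ ((fun q : rat => hj ((f p).2 (ratr q))) @` [set: rat])); last first.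
      exact: (sub_countable (card_image_le _ _)).
    apply: subset_card_le => _ [z Cz <-]; have [Vz [s Is E]] := CVL z Cz.
    rewrite -E in Vz; have [e e0 He] := itv_of_near (good_stays oI Is (H s Is) oV Vz).
    have se : s - e < s + e by rewrite ltrBlDr -addrA ltrDl addr_gt0.
    have [q qe] := rat_in_itvoo se.
    exists q => //; rewrite /hj -E.
    have oJ : open [set` `]s - e, s + e[] by exact: itv_open.
    have iJ : is_interval [set` `]s - e, s + e[] by exact: interval_is_interval.
    apply: (@box_transverse _ _ _ _ _ _ _ B [set` `]s - e, s + e[] (f p).2) => //.
    + exact: (good_curve_sub oJ iJ (fun r Jr => (He r Jr).1) (good_leaf p Up)).
    + by move=> r /He[].
    + exact: itv_center.
  by apply: (countable_connected_eq chj count); [exists y|exists x].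
- move=> [Vy hy]; have [I' [c' [g' E']]] := box_plaque B Vx; have [oI' iI' H'] := g'.
  exists (c' @` I'); last by rewrite E'.
  have [s' I's' E] : (c' @` I') x by rewrite E'.
  split.
  + by rewrite E'.
  + move=> z c'z; split; first by move: c'z; rewrite E' => -[].
    by apply: (absorb p I' c' s' Up g' I's'); rewrite ?E.
  + apply: connected_continuous_connected; first exact/connected_intervalP.
    by apply: continuous_in_subspaceT => r /[1!inE] Ir; exact/good_continuous/H'.
Qed.

End Leaves.

(** * Maps of class C^1 and C^k *)

Lemma is_derive_pd R n (W : normedModType R) (f : 'rV[R]_n -> W)
    (x : 'rV[R]_n) (i : 'I_n) :
  differentiable f x -> is_derive x (delta_mx 0 i) f (pd i f x).
Proof. by move=> Df; apply: derivableP; exact: diff_derivable. Qed.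

Lemma pd_val R n (W : normedModType R) (f : 'rV[R]_n -> W)
    (x : 'rV[R]_n) (i : 'I_n) (d : W) : is_derive x (delta_mx 0 i) f d -> pd i f x = d.
Proof. by move=> H; rewrite /pd (derive_of H). Qed.

Section C1on_closure.
Context {R : realType} {n : nat} {V : set 'rV[R]_n}.
Hypothesis oV : open V.
Implicit Types (f g : 'rV[R]_n -> R).

Lemma near_in_open (x : 'rV[R]_n) : V x -> \forall u \near x, V u.
Proof. by move=> Vx; exact: open_nbhs_nbhs (conj oV Vx). Qed.

Lemma C1on_intro f (df : 'I_n -> 'rV[R]_n -> R) :
  (forall x, V x -> differentiable f x) ->
  (forall x i, V x -> is_derive x (delta_mx 0 i) f (df i x)) ->
  (forall x i, V x -> {for x, continuous (df i)}) -> C1on V f.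
Proof.
move=> Df Hd Hc x Vx; split; first exact: Df.
move=> i; apply: (@continuous_near_eq _ _ (df i)); last exact: Hc.
by apply: filterS (near_in_open Vx) => u Vu; rewrite (pd_val (Hd u i Vu)).
Qed.

Lemma C1on_cont f x : C1on V f -> V x -> {for x, continuous f}.
Proof. by move=> Cf /Cf[Df _]; exact: differentiable_continuous. Qed.

Lemma C1on_ext f g : (forall x, V x -> f x = g x) -> C1on V f -> C1on V g.
Proof.
move=> fg Cf.
have near_fg x : V x -> \forall u \near x, f u = g u.
  by move=> Vx; apply: filterS (near_in_open Vx) => u; exact: fg.
move=> x Vx; have [Df cf] := Cf x Vx.
have Hi u i : V u -> is_derive u (delta_mx 0 i) g (pd i f u).
  by move=> Vu; apply: (near_eq_is_derive (near_fg u Vu)); apply: is_derive_pd; case: (Cf u Vu).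
have ci i : {for x, continuous (pd i g)}.
  apply: (@continuous_near_eq _ _ (pd i f)); last exact: cf.
  by apply: filterS (near_in_open Vx) => u Vu; rewrite (pd_val (Hi u i Vu)).
split=> //; apply: differentiable_of_partial => //.
by apply: filterS (near_in_open Vx) => u Vu i; have [] := Hi u i Vu.
Qed.

Lemma C1on_cst (a : R) : C1on V (fun=> a).
Proof.
apply: (@C1on_intro _ (fun _ _ => 0)) => [x _|x i _]; last exact: cont_cst.
exact: differentiable_cst.
Qed.

Lemma C1onD f g : C1on V f -> C1on V g -> C1on V (fun u => f u + g u).
Proof.
move=> Cf Cg; apply: (@C1on_intro _ (fun i u => pd i f u + pd i g u)) => x; first move=> Vx; try move=> i Vx;
  have [Df cf] := Cf x Vx; have [Dg cg] := Cg x Vx.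
- exact: differentiableD.
- by apply: is_deriveD; exact: is_derive_pd.
- by apply: contD.
Qed.

Lemma C1onM f g : C1on V f -> C1on V g -> C1on V (fun u => f u * g u).
Proof.
move=> Cf Cg; apply: (@C1on_intro _ (fun i u => f u * pd i g u + g u * pd i f u)) => x; first move=> Vx; try move=> i Vx;
  have [Df cf] := Cf x Vx; have [Dg cg] := Cg x Vx.
- exact: differentiableM.
- by apply: is_deriveM; exact: is_derive_pd.
- by apply: contD; apply: contM => //; exact: C1on_cont.
Qed.

Lemma C1onV f : (forall x, V x -> f x != 0) -> C1on V f -> C1on V (fun u => (f u)^-1).
Proof.
move=> f0 Cf; apply: (@C1on_intro _ (fun i u => - (f u) ^- 2 * pd i f u)) => x; first move=> Vx; try move=> i Vx;
  have [Df cf] := Cf x Vx; have fx0 := f0 x Vx.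
- exact: differentiableV.
- have Dfi : derivable f x (delta_mx 0 i) by exact: diff_derivable.
  split; first exact: derivableV.
  by rewrite deriveV.
- apply: contM => //; apply: contN; apply: contV; first exact: expf_neq0.
  have -> : (fun u => f u ^+ 2) = (fun u => f u * f u) by apply/funext => u; rewrite expr2.
  by apply: contM; exact: C1on_cont.
Qed.

Lemma C1on_sum (I : Type) (r : seq I) (Q : pred I) (f : I -> 'rV[R]_n -> R) :
  (forall i, C1on V (f i)) -> C1on V (fun u => \sum_(i <- r | Q i) f i u).
Proof.
move=> Cf; elim: r => [|i r IH].
  by apply: C1on_ext (C1on_cst 0) => x _; rewrite big_nil.
have [Qi|Qi] := boolP (Q i).
  by apply: C1on_ext (C1onD (Cf i) IH) => x _; rewrite big_cons Qi.
by apply: C1on_ext IH => x _; rewrite big_cons (negbTE Qi).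
Qed.

Lemma C1on_prod (I : Type) (r : seq I) (Q : pred I) (f : I -> 'rV[R]_n -> R) :
  (forall i, C1on V (f i)) -> C1on V (fun u => \prod_(i <- r | Q i) f i u).
Proof.
move=> Cf; elim: r => [|i r IH].
  by apply: C1on_ext (C1on_cst 1) => x _; rewrite big_nil.
have [Qi|Qi] := boolP (Q i).
  by apply: C1on_ext (C1onM (Cf i) IH) => x _; rewrite big_cons Qi.
by apply: C1on_ext IH => x _; rewrite big_cons (negbTE Qi).
Qed.

Definition C1mx (p q : nat) (A : 'rV[R]_n -> 'M[R]_(p, q)) : Prop :=
  forall i j, C1on V (fun u => A u i j).

Lemma C1mx_mul (p q s : nat) (A : 'rV[R]_n -> 'M[R]_(p, q)) (B : 'rV[R]_n -> 'M[R]_(q, s)) :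
  C1mx A -> C1mx B -> C1mx (fun u => A u *m B u).
Proof.
move=> CA CB i j; apply: (@C1on_ext (fun u => \sum_k A u i k * B u k j)).
  by move=> x _; rewrite mxE.
by apply: C1on_sum => k; exact: C1onM.
Qed.

Lemma C1mx_tr (p q : nat) (A : 'rV[R]_n -> 'M[R]_(p, q)) : C1mx A -> C1mx (fun u => (A u)^T).
Proof. by move=> CA i j; apply: C1on_ext (CA j i) => x _; rewrite mxE. Qed.

Lemma C1on_det (p : nat) (A : 'rV[R]_n -> 'M[R]_p) : C1mx A -> C1on V (fun u => \det (A u)).
Proof.
move=> CA; rewrite /determinant; apply: C1on_sum => s.
apply: C1onM; first exact: C1on_cst.
by apply: C1on_prod => i; exact: CA.
Qed.

Lemma C1mx_inv (p : nat) (A : 'rV[R]_n -> 'M[R]_p) : (forall u, V u -> A u \in unitmx) ->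
  C1mx A -> C1mx (fun u => invmx (A u)).
Proof.
move=> uA CA i j.
apply: (@C1on_ext (fun u => (\det (A u))^-1 * ((-1) ^+ (j + i) * \det (row' j (col' i (A u)))))).
  by move=> u Vu; rewrite /invmx uA // !mxE.
apply: C1onM.
  apply: C1onV; last exact: C1on_det.
  by move=> u Vu; have := uA u Vu; rewrite unitmxE unitfE.
apply: C1onM; first exact: C1on_cst.
apply: C1on_det => a b.
by apply: C1on_ext (CA (lift j a) (lift i b)) => u _; rewrite !mxE.
Qed.

(** The chain rule, applied to each partial derivative; [differentiable_of_partial] concludes. *)
Lemma C1on_comp (m : nat) (O : set 'rV[R]_m) (g : 'rV[R]_m -> R) (c : 'rV[R]_n -> 'rV[R]_m) :
  C1mx c -> C1on O g -> (forall u, V u -> O (c u)) -> C1on V (fun u => g (c u)).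
Proof.
move=> Cc Cg VO.
have Dc u i : V u -> is_derive u (delta_mx 0 i) c (\row_j pd i (fun u => c u 0 j) u).
  move=> Vu; apply: is_derive_row => j; rewrite mxE; apply: is_derive_pd.
  by case: (Cc 0 j u Vu).
have cc u : V u -> {for u, continuous c}.
  by move=> Vu; apply: continuous_row => j; exact: (C1on_cont (Cc 0 j)).
have Di u i : V u -> is_derive u (delta_mx 0 i) (fun u => g (c u))
    (\sum_j pd i (fun u => c u 0 j) u * pd j g (c u)).
  move=> Vu; have [Dg _] := Cg _ (VO u Vu).
  apply: (is_derive_eq (is_derive_chain Dg (Dc u i Vu))).
  by apply: eq_bigr => j _; rewrite mxE.
have ci u i : V u -> {for u, continuous (fun u => \sum_j pd i (fun u => c u 0 j) u * pd j g (c u))}.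
  move=> Vu; apply: cont_sum => j; apply: contM; first by case: (Cc 0 j u Vu).
  apply: cont_comp; first exact: cc.
  by case: (Cg _ (VO u Vu)).
apply: (C1on_intro _ Di) => [x Vx|x i Vx]; last exact: ci.
apply: differentiable_of_partial.
  by apply: filterS (near_in_open Vx) => u Vu i; have [] := Di u i Vu.
move=> i; apply: (@continuous_near_eq _ _ (fun u => \sum_j pd i (fun u => c u 0 j) u * pd j g (c u))); last exact: ci.
by apply: filterS (near_in_open Vx) => u Vu; rewrite (pd_val (Di u i Vu)).
Qed.

Lemma Ck1_C1on f : Ck 1 V f -> C1on V f.
Proof.
move=> [_ Hf] x Vx; have cf i : {for x, continuous (pd i f)} by have [_ [H _]] := Hf i; exact: H.
split=> //; apply: differentiable_of_partial => //.
by apply: filterS (near_in_open Vx) => u Vu i; have [H _] := Hf i; exact: H.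
Qed.

Lemma Ck_ext (W : normedModType R) (k : nat) (f g : 'rV[R]_n -> W) :
  (forall x, V x -> f x = g x) -> Ck k V f -> Ck k V g.
Proof.
elim: k f g => [|k IH] f g fg /=.
  move=> [cf _]; split=> // x Vx; apply: continuous_near_eq (cf x Vx).
  by apply: filterS (near_in_open Vx) => u; exact: fg.
move=> [cf Hf].
have near_fg x : V x -> \forall u \near x, f u = g u.
  by move=> Vx; apply: filterS (near_in_open Vx) => u; exact: fg.
split; first by move=> x Vx; apply: continuous_near_eq (cf x Vx); exact: near_fg.
move=> i; have [Df Cf] := Hf i; split.
  by move=> x Vx; apply: near_eq_derivable (Df x Vx); exact: near_fg.
by apply: IH Cf => x Vx; rewrite /pd; apply: near_eq_derive; exact: near_fg.
Qed.

Lemma Ck_coord (m : nat) (k : nat) (f : 'rV[R]_n -> 'rV[R]_m) (j : 'I_m) :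
  Ck k V f -> Ck k V (fun u => f u 0 j).
Proof.
elim: k f => [|k IH] f /= [cf Hf]; (split; first by move=> x Vx; apply: continuous_coord; exact: cf) => //.
move=> i; have [Df Cf] := Hf i; split.
  by move=> x Vx; move/derivable_mxP: (Df x Vx); exact.
apply: Ck_ext (IH _ Cf) => x Vx.
by rewrite /pd (derive_mx (Df x Vx)) mxE.
Qed.

Lemma CkS (W : normedModType R) (k : nat) (f : 'rV[R]_n -> W) : Ck k.+1 V f -> Ck k V f.
Proof.
elim: k f => [|k IH] f [cf Hf]; split=> // i; have [Df Cf] := Hf i; split=> //; exact: IH.
Qed.

Lemma Ck_le (W : normedModType R) (k l : nat) (f : 'rV[R]_n -> W) : (l <= k)%N -> Ck k V f -> Ck l V f.
Proof.
by move/subnK => <-; elim: (k - l)%N => // j IH; rewrite addSn => /CkS.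
Qed.

Lemma Ck2_pd_comm f (x : 'rV[R]_n) (i j : 'I_n) : Ck 2 V f -> V x ->
  pd i (pd j f) x = pd j (pd i f) x.
Proof.
move=> [_ H] Vx; apply: pd_comm.
- apply: filterS (near_in_open Vx) => u Vu.
  have [Di [_ Hi]] := H i; have [Dj [_ Hj]] := H j.
  by split; [exact: Di|split; [exact: Dj|split; [exact: (Hi j).1|exact: (Hj i).1]]].
- by have [_ [_ /(_ j)[_ [c _]]]] := H i; exact: c.
- by have [_ [_ /(_ i)[_ [c _]]]] := H j; exact: c.
Qed.

End C1on_closure.

Lemma C1on_sub R n (V W : set 'rV[R]_n) (f : 'rV[R]_n -> R) :
  W `<=` V -> C1on V f -> C1on W f.
Proof. by move=> WV Cf x /WV; exact: Cf. Qed.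

Arguments C1mx {R n} V {p q} A.

(** * Degenerate symmetric matrices and quadratic forms *)

Lemma left_kernel_line (F : fieldType) n (A : 'M[F]_(n.+1, n)) (a b : 'rV[F]_n.+1) :
  \rank A = n -> a *m A = 0 -> b *m A = 0 -> b != 0 -> exists c, a = c *: b.
Proof.
move=> rA /sub_kermxP aK /sub_kermxP bK b0.
have rK : \rank (kermx A) = 1 by rewrite mxrank_ker rA subSnn.
have Kb : (kermx A <= b)%MS.
  by rewrite -(geq_leqif (mxrank_leqif_sup bK)) rK rank_rV b0.
by have /sub_rVP[c ->] := submx_trans aK Kb; exists c.
Qed.

(** Pairing [x *m (B + delta_mx j j) = 0] with [v] gives [x 0 j * v 0 j = 0]; then [x] is in the
kernel of [B], hence a multiple of [v], and its coordinate [j] is 0. *)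
Lemma bordered_unitmx (F : fieldType) n (B : 'M[F]_n) (v : 'rV[F]_n) (j : 'I_n) :
  B^T = B -> v *m B = 0 -> (forall x, x *m B = 0 -> exists c, x = c *: v) -> v 0 j != 0 ->
  B + delta_mx j j \in unitmx.
Proof.
move=> sB vB line vj; rewrite unitmxE unitfE; apply/det0P => -[x x0].
have Ex : x *m delta_mx j j = x 0 j *: (delta_mx 0 j : 'rV[F]_n).
  apply/rowP => k; rewrite !mxE (bigD1 j) //= !mxE eqxx /= big1 ?addr0 // => i ij.
  by rewrite !mxE (negbTE ij) mulr0.
rewrite mulmxDr Ex => E.
have Bv : B *m v^T = 0 by rewrite -{1}sB -trmx_mul vB trmx0.
have xj : x 0 j = 0.
  have : (x *m B + x 0 j *: (delta_mx 0 j : 'rV[F]_n)) *m v^T = 0 by rewrite E mul0mx.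
  rewrite mulmxDl -mulmxA Bv mulmx0 add0r -scalemxAl => /(congr1 (fun M : 'M[F]_(1, 1) => M 0 0)).
  rewrite mxE [RHS]mxE.
  have -> : ((delta_mx 0 j : 'rV[F]_n) *m v^T) 0 0 = v 0 j.
    by rewrite -rowE !mxE.
  by move/eqP; rewrite mulf_eq0 (negbTE vj) orbF => /eqP.
move: E; rewrite xj scale0r addr0 => /line[c Ec].
move: xj; rewrite Ec mxE => /eqP; rewrite mulf_eq0 (negbTE vj) orbF => /eqP c0.
by move: x0; rewrite Ec c0 scale0r eqxx.
Qed.

(** A kernel vector that is a rational function of the entries of the matrix, so it is as smooth as
they are. *)
Lemma bordered_kernel (F : fieldType) n (B : 'M[F]_n) (j : 'I_n) :
  B + delta_mx j j \in unitmx -> \det B = 0 ->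
  let X : 'rV[F]_n := delta_mx 0 j *m invmx (B + delta_mx j j) in
  [/\ X *m B = 0, X 0 j = 1 & forall x, x *m B = 0 -> x = x 0 j *: X].
Proof.
move=> uC dB X; have /eqP/det0P[k k0 kB] := dB.
have E (x : 'rV[F]_n) : x *m B = 0 -> x = x 0 j *: X.
  move=> xB; rewrite /X scalemxAl.
  have <- : x *m (B + delta_mx j j) = x 0 j *: (delta_mx 0 j : 'rV[F]_n).
    rewrite mulmxDr xB add0r; apply/rowP => i; rewrite !mxE (bigD1 j) //= !mxE eqxx /=.
    rewrite big1 ?addr0 // => q qj; by rewrite !mxE (negbTE qj) mulr0.
  by rewrite mulmxK.
have kj : k 0 j != 0 by apply: contraNneq k0 => kj; rewrite (E k kB) kj scale0r.
have XB : X *m B = 0.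
  apply: (scalerI kj); rewrite scaler0 scalemxAl -E //.
split=> //.
apply: (mulfI kj); rewrite mulr1.
by have := congr1 (fun v : 'rV[F]_n => v 0 j) (E k kB); rewrite mxE.
Qed.

(** Half the differential in [y] of [gform (G y) v v], the velocity [v] being frozen: the right-hand
side of the Euler-Lagrange equation of the energy. *)
Definition force R (m : nat) (G : 'rV[R]_m -> 'M[R]_m) (y v : 'rV[R]_m) : 'rV[R]_m :=
  \row_k (2^-1 * \sum_a \sum_c pd k (fun z => G z a c) y * v 0 a * v 0 c).

Lemma gformE R (m : nat) (G : 'M[R]_m) (v w : 'rV[R]_m) :
  gform G v w = \sum_a \sum_c G a c * v 0 a * w 0 c.
Proof.
rewrite /gform mxE exchange_big /=; apply: eq_bigr => c _.
by rewrite !mxE mulr_suml; apply: eq_bigr => a _; ring.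
Qed.

Lemma is_derive_sum2 R (V : normedModType R) (p q : nat) (f : 'I_p -> 'I_q -> V -> R)
    (df : 'I_p -> 'I_q -> R) (x v : V) :
  (forall a c, is_derive x v (f a c) (df a c)) ->
  is_derive x v (fun u => \sum_a \sum_c f a c u) (\sum_a \sum_c df a c).
Proof.
move=> H.
have -> : (fun u => \sum_a \sum_c f a c u) = \sum_a \sum_c f a c.
  by apply/funext => u; rewrite fct_sumE; apply: eq_bigr => a _; rewrite fct_sumE.
by apply: is_derive_sum => a; apply: is_derive_sum => c; exact: H.
Qed.

Lemma is_derive_gform R (n m : nat) (G : 'rV[R]_m -> 'M[R]_m)
    (f w : 'rV[R]_n -> 'rV[R]_m) (df dw : 'rV[R]_m) (u e : 'rV[R]_n) :
  (forall a c, differentiable (fun y => G y a c) (f u)) -> (G (f u))^T = G (f u) ->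
  is_derive u e f df -> is_derive u e w dw ->
  is_derive u e (fun u => gform (G (f u)) (w u) (w u))
    (2 * (\sum_b df 0 b * force G (f u) (w u) 0 b + \sum_c (w u *m G (f u)) 0 c * dw 0 c)).
Proof.
move=> DG sG Df Dw.
have -> : (fun u => gform (G (f u)) (w u) (w u)) =
    (fun u => \sum_a \sum_c (G (f u) a c * w u 0 a) * w u 0 c).
  by apply/funext => v; rewrite gformE.
pose dG a c := \sum_b df 0 b * pd b (fun y => G y a c) (f u).
apply: (@is_derive_eq _ _ _ _ _ _ _ (\sum_a \sum_c (G (f u) a c * w u 0 a * dw 0 c +
   w u 0 c * (G (f u) a c * dw 0 a + w u 0 a * dG a c)))).
  apply: is_derive_sum2 => a c; apply: is_deriveM; last exact: is_derive_coord.
  apply: is_deriveM; last exact: is_derive_coord.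
  exact: is_derive_chain (DG a c) Df.
transitivity (\sum_a \sum_c (w u 0 c * w u 0 a * dG a c) +
   ((\sum_a \sum_c G (f u) a c * w u 0 a * dw 0 c) + (\sum_a \sum_c G (f u) a c * w u 0 c * dw 0 a))).
  rewrite -!big_split /=; apply: eq_bigr => a _; rewrite -!big_split /=; apply: eq_bigr => c _; ring.
rewrite mulrDr; congr (_ + _).
  rewrite mulr_sumr.
  transitivity (\sum_b df 0 b * \sum_a \sum_c pd b (fun y => G y a c) (f u) * w u 0 a * w u 0 c); last first.
    by apply: eq_bigr => b _; rewrite mxE; field.
  apply: esym; transitivity (\sum_b \sum_a \sum_c df 0 b *
      (pd b (fun y => G y a c) (f u) * w u 0 a * w u 0 c)).
    apply: eq_bigr => b _; rewrite mulr_sumr; apply: eq_bigr => a _; by rewrite mulr_sumr.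
  rewrite exchange_big /=; apply: eq_bigr => a _; rewrite exchange_big /=; apply: eq_bigr => c _.
  by rewrite /dG mulr_sumr; apply: eq_bigr => b _; ring.
have E1 : \sum_a \sum_c G (f u) a c * w u 0 a * dw 0 c = \sum_c (w u *m G (f u)) 0 c * dw 0 c.
  rewrite exchange_big /=; apply: eq_bigr => c _; rewrite mxE mulr_suml; apply: eq_bigr => a _; ring.
have E2 : \sum_a \sum_c G (f u) a c * w u 0 c * dw 0 a = \sum_c (w u *m G (f u)) 0 c * dw 0 c.
  apply: eq_bigr => a _; rewrite mxE mulr_suml; apply: eq_bigr => c _.
  by rewrite -[in LHS]sG mxE; ring.
by rewrite E1 E2; ring.
Qed.

(** * The acceleration of the null direction is normal *)

(** The rows are the tangent vectors df(d/du_i) of the parametrized hypersurface. *)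
Definition frame R (n m : nat) (f : 'rV[R]_n -> 'rV[R]_m) (u : 'rV[R]_n) : 'M[R]_(n, m) :=
  \matrix_(i, a) pd i f u 0 a.

Definition first_form R (n m : nat) (G : 'rV[R]_m -> 'M[R]_m) (f : 'rV[R]_n -> 'rV[R]_m)
    (u : 'rV[R]_n) : 'M[R]_n :=
  frame f u *m G (f u) *m (frame f u)^T.

(** A light-like hypersurface [f] read in a chart with range [O] and metric components [G]. *)
Record null_chart R n (V : set 'rV[R]_n) (O : set 'rV[R]_n.+1)
    (G : 'rV[R]_n.+1 -> 'M[R]_n.+1) (f : 'rV[R]_n -> 'rV[R]_n.+1) : Prop := {
  null_open : open V;
  null_C2 : Ck 2 V f;
  null_range : forall u, V u -> O (f u);
  null_metric : forall a c, C1on O (fun y => G y a c);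
  null_sym : forall y, O y -> (G y)^T = G y;
  null_unit : forall y, O y -> G y \in unitmx;
  null_free : forall u, V u -> row_free (frame f u);
  null_det : forall u, V u -> \det (first_form G f u) = 0 }.

(** The covector g(df(X), .). *)
Definition normal_covector R (n m : nat) (G : 'rV[R]_m -> 'M[R]_m) (f : 'rV[R]_n -> 'rV[R]_m)
    (X : 'rV[R]_n -> 'rV[R]_n) (u : 'rV[R]_n) : 'rV[R]_m :=
  X u *m frame f u *m G (f u).

(** The covector g(nabla_xi xi, .) for xi = df(X): along an integral curve of [X], the derivative of
the momentum G xi minus the force. *)
Definition acceleration R (n m : nat) (G : 'rV[R]_m -> 'M[R]_m) (f : 'rV[R]_n -> 'rV[R]_m)
    (X : 'rV[R]_n -> 'rV[R]_n) (u : 'rV[R]_n) : 'rV[R]_m :=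
  \row_k (\sum_i X u 0 i * pd i (fun v => normal_covector G f X v 0 k) u)
  - force G (f u) (X u *m frame f u).

Lemma is_derive_zero R n (W : set 'rV[R]_n) (f : 'rV[R]_n -> R) (u e : 'rV[R]_n) (d : R) :
  open W -> W u -> (forall v, W v -> f v = 0) -> is_derive u e f d -> d = 0.
Proof.
move=> oW Wu f0 Df.
have Z : is_derive u e (fun=> 0 : R) d.
  by apply: near_eq_is_derive Df; apply: filterS (near_in_open oW Wu) => v; exact: f0.
rewrite -(derive_of Z); exact: derive_val.
Qed.

Section ChartDerivatives.
Context {R : realType} {n m : nat} {V : set 'rV[R]_n} {f : 'rV[R]_n -> 'rV[R]_m}.
Hypothesis (oV : open V) (C2 : Ck 2 V f).

Lemma Ck2_C1mx : C1mx V f.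
Proof.
move=> i j; rewrite (ord1 i); apply: (Ck1_C1on oV); apply: (Ck_coord oV).
exact: CkS C2.
Qed.

Lemma Ck2_frame_C1mx : C1mx V (frame f).
Proof.
move=> i a; have [_ H] := C2; have C : Ck 1 V (pd i f) := (H i).2.
by apply: (C1on_ext oV _ (Ck1_C1on oV (Ck_coord oV a C))) => u _; rewrite mxE.
Qed.

Lemma frame_pd_comm u i j c : V u ->
  pd i (fun v => frame f v j c) u = pd j (fun v => frame f v i c) u.
Proof.
move=> Vu; have C2c := Ck_coord oV c C2.
have E k v : V v -> frame f v k c = pd k (fun v => f v 0 c) v.
  move=> Vv; rewrite mxE; have [_ H] := C2; have [D _] := H k.
  by rewrite /pd (derive_mx (D v Vv)) mxE.
have E2 k l : pd k (fun v => frame f v l c) u = pd k (pd l (fun v => f v 0 c)) u.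
  rewrite /pd; apply: near_eq_derive.
  by apply: filterS (near_in_open oV Vu) => v Vv; exact: E.
by rewrite !E2; exact: Ck2_pd_comm C2c Vu.
Qed.

End ChartDerivatives.

Section NullChart.
Context {R : realType} {n : nat} {V : set 'rV[R]_n} {O : set 'rV[R]_n.+1}
  {G : 'rV[R]_n.+1 -> 'M[R]_n.+1} {f : 'rV[R]_n -> 'rV[R]_n.+1}.
Hypothesis NC : null_chart V O G f.
Let oV := null_open NC.

Lemma C1mx_chart : C1mx V f.
Proof. exact: Ck2_C1mx oV (null_C2 NC). Qed.

Lemma C1mx_frame : C1mx V (frame f).
Proof. exact: Ck2_frame_C1mx oV (null_C2 NC). Qed.

Lemma C1mx_metric : C1mx V (fun u => G (f u)).
Proof. by move=> a c; exact: (C1on_comp oV C1mx_chart (null_metric NC a c) (null_range NC)). Qed.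

Lemma C1mx_first_form : C1mx V (first_form G f).
Proof.
apply: (C1mx_mul oV); last by apply: (C1mx_tr oV); exact: C1mx_frame.
by apply: (C1mx_mul oV); [exact: C1mx_frame|exact: C1mx_metric].
Qed.

Lemma first_form_sym u : V u -> (first_form G f u)^T = first_form G f u.
Proof.
move=> Vu; rewrite /first_form !trmx_mul trmxK mulmxA.
by rewrite (null_sym NC (null_range NC Vu)).
Qed.

Lemma rank_frame u : V u -> \rank (frame f u)^T = n.
Proof. by move=> Vu; rewrite mxrank_tr; apply/eqP; exact: (null_free NC Vu). Qed.

(** If [x] is in the kernel, [x *m frame f u *m G (f u)] is a covector that kills the image of df,
and such covectors form a line since that image is a hyperplane. *)
Lemma kernel_line u (x v : 'rV[R]_n) : V u -> x *m first_form G f u = 0 ->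
  v *m first_form G f u = 0 -> v != 0 -> exists c, x = c *: v.
Proof.
move=> Vu; rewrite /first_form -mulmxA !mulmxA -![_ *m frame f u *m _ *m _]mulmxA => x0 v0 vn0.
have free := null_free NC Vu.
have cancel (y z : 'rV[R]_n) : y *m frame f u = z *m frame f u -> y = z.
  by move=> E; rewrite -(mulmxKp free y) E mulmxKp.
have [||c Ec] := @left_kernel_line _ _ (G (f u) *m (frame f u)^T) (x *m frame f u) (v *m frame f u) _ x0 v0.
- have := mxrankMfree (frame f u) (B := G (f u)).
  rewrite row_free_unit (null_unit NC (null_range NC Vu)) => /(_ isT).
  rewrite -mxrank_tr trmx_mul (null_sym NC (null_range NC Vu)) => ->.
  by apply/eqP.
- by apply: contraNneq vn0 => E; apply/eqP; apply: cancel; rewrite mul0mx.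
- by exists c; apply: cancel; rewrite -scalemxAl.
Qed.

Section Field.
Context {W : set 'rV[R]_n} {X : 'rV[R]_n -> 'rV[R]_n}.
Hypothesis (oW : open W) (WV : W `<=` V) (CX : forall k, C1on W (fun u => X u 0 k)).
Hypothesis XB : forall u, W u -> X u *m first_form G f u = 0.

Let C1X : C1mx W X. Proof. by move=> i j; rewrite (ord1 i). Qed.
Let CD : C1mx W (frame f). Proof. by move=> i j; exact: C1on_sub (C1mx_frame i j). Qed.
Let CG : C1mx W (fun u => G (f u)). Proof. by move=> i j; exact: C1on_sub (C1mx_metric i j). Qed.

Lemma C1mx_normal : C1mx W (normal_covector G f X).
Proof. by apply: (C1mx_mul oW) => //; apply: (C1mx_mul oW). Qed.

Lemma normal_frame u : W u -> normal_covector G f X u *m (frame f u)^T = 0.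
Proof. by move=> Wu; rewrite /normal_covector -2!mulmxA [X in _ *m X]mulmxA XB. Qed.

(** Write N for [normal_covector] and D for [frame f]. Differentiating N D^T = 0 along [X] replaces
the derivatives of N by second derivatives of [f]; differentiating g(df(X), df(X)) = 0 along the
coordinate [j] expresses the force by second derivatives too. These agree by [frame_pd_comm]. The
derivatives of [X] drop out because they come multiplied by N D^T. *)
Lemma acceleration_frame u : W u -> acceleration G f X u *m (frame f u)^T = 0.
Proof.
move=> Wu; have Vu := WV Wu.
pose N := normal_covector G f X.
pose D := frame f.
have dN i k : is_derive u (delta_mx 0 i) (fun v => N v 0 k) (pd i (fun v => N v 0 k) u).
  by apply: is_derive_pd; case: (C1mx_normal 0 k Wu).
have dD i j a : is_derive u (delta_mx 0 i) (fun v => D v j a) (pd i (fun v => D v j a) u).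
  by apply: is_derive_pd; case: (CD j a Wu).
have dX i j : is_derive u (delta_mx 0 i) (fun v => X v 0 j) (pd i (fun v => X v 0 j) u).
  by apply: is_derive_pd; case: (CX j Wu).
have ND v j : W v -> \sum_k N v 0 k * D v j k = 0.
  move=> Wv; have := congr1 (fun M : 'rV[R]_n => M 0 j) (normal_frame Wv).
  rewrite mxE [RHS]mxE => E; rewrite -[RHS]E; apply: eq_bigr => k _.
  by rewrite [(frame f v)^T _ _]mxE.
have sumE (p : nat) (F : 'I_p -> 'rV[R]_n -> R) : (fun v => \sum_(k < p) F k v) = \sum_(k < p) F k.
  by apply/funext => v; rewrite fct_sumE.
have eq1 i j : \sum_k N u 0 k * pd i (fun v => D v j k) u = - \sum_k D u j k * pd i (fun v => N v 0 k) u.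
  apply/eqP; rewrite -subr_eq0 opprK -big_split /=; apply/eqP.
  apply: (@is_derive_zero _ _ W (fun v => \sum_k N v 0 k * D v j k) u (delta_mx 0 i) _ oW Wu).
    by move=> v Wv; exact: ND.
  rewrite sumE; apply: is_derive_sum => k.
  exact: (is_deriveM (dN i k) (dD i j k)).
pose xi v := X v *m D v.
have dxi j : is_derive u (delta_mx 0 j) xi
    (\row_c \sum_i (X u 0 i * pd j (fun v => D v i c) u + D u i c * pd j (fun v => X v 0 i) u)).
  apply: is_derive_row => c; rewrite mxE.
  have -> : (fun v => xi v 0 c) = (fun v => \sum_i X v 0 i * D v i c).
    by apply/funext => v; rewrite mxE.
  by rewrite sumE; apply: is_derive_sum => i; exact: (is_deriveM (dX j i) (dD j i c)).
have df j : is_derive u (delta_mx 0 j) f (pd j f u).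
  have [_ H] := null_C2 NC; have [Dj _] := H j; exact: derivableP (Dj u Vu).
have eq2 j : \sum_b D u j b * force G (f u) (xi u) 0 b = - \sum_c N u 0 c * \sum_i X u 0 i * pd j (fun v => D v i c) u.
  have DG a c : differentiable (fun y => G y a c) (f u) by case: (null_metric NC a c (null_range NC Vu)).
  have := is_derive_gform DG (null_sym NC (null_range NC Vu)) (df j) (dxi j).
  move/(is_derive_zero oW Wu) => E.
  have {E} /E/eqP : forall v, W v -> gform (G (f v)) (xi v) (xi v) = 0.
    move=> v Wv; rewrite /gform /xi trmx_mul mulmxA -[_ *m G (f v)]/(N v) /D normal_frame //.
    by rewrite mul0mx mxE.
  rewrite mulf_eq0 pnatr_eq0 /= addr_eq0 => /eqP E.
  transitivity (\sum_b pd j f u 0 b * force G (f u) (xi u) 0 b).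
    by apply: eq_bigr => b _; rewrite /D mxE.
  rewrite E; congr (- _).
  transitivity (\sum_c N u 0 c * \sum_i X u 0 i * pd j (fun v => D v i c) u
     + \sum_i pd j (fun v => X v 0 i) u * \sum_c N u 0 c * D u i c).
    rewrite [X in _ = _ + X](eq_bigr (fun i => \sum_c N u 0 c * (D u i c * pd j (fun v => X v 0 i) u))); last first.
      by move=> i _; rewrite mulr_sumr; apply: eq_bigr => c _; ring.
    rewrite exchange_big /= -big_split /=; apply: eq_bigr => c _.
    by rewrite mxE -mulr_sumr -mulrDr big_split.
  rewrite [X in _ + X]big1 ?addr0 // => i _; by rewrite ND // mulr0.
apply/rowP => j; rewrite [RHS]mxE mxE.
transitivity (\sum_k (\sum_i X u 0 i * pd i (fun v => N v 0 k) u) * D u j k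
   - \sum_k D u j k * force G (f u) (xi u) 0 k).
  rewrite -sumrB; apply: eq_bigr => k _.
  by rewrite row_subE [in LHS]mxE [(frame f u)^T _ _]mxE mulrBl [X in _ - X]mulrC.
rewrite eq2 opprK.
have -> : \sum_k (\sum_i X u 0 i * pd i (fun v => N v 0 k) u) * D u j k =
   \sum_i X u 0 i * \sum_k D u j k * pd i (fun v => N v 0 k) u.
  rewrite (eq_bigr (fun k => \sum_i X u 0 i * (D u j k * pd i (fun v => N v 0 k) u))); last first.
    by move=> k _; rewrite mulr_suml; apply: eq_bigr => i _; ring.
  by rewrite exchange_big /=; apply: eq_bigr => i _; rewrite mulr_sumr.
have -> : \sum_c N u 0 c * (\sum_i X u 0 i * pd j (fun v => D v i c) u) =
   \sum_i X u 0 i * \sum_c N u 0 c * pd i (fun v => D v j c) u.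
  rewrite (eq_bigr (fun c => \sum_i X u 0 i * (N u 0 c * pd i (fun v => D v j c) u))); last first.
    move=> c _; rewrite mulr_sumr; apply: eq_bigr => i _.
    by rewrite /D (frame_pd_comm oV (null_C2 NC) j i c Vu); ring.
  by rewrite exchange_big /=; apply: eq_bigr => i _; rewrite mulr_sumr.
by rewrite -big_split big1 // => i _; rewrite /= eq1 mulrN subrr.
Qed.

End Field.
End NullChart.

(** * The null field and its pregeodesics *)

Lemma open_nonzero R n (V : set 'rV[R]_n) (g : 'rV[R]_n -> R) :
  open V -> (forall u, V u -> {for u, continuous g}) -> open (V `&` [set u | g u != 0]).
Proof.
move=> oV cg; rewrite openE => u [Vu gu].
have e0 : 0 < `|g u| by rewrite normr_gt0.
have /cvgrPdist_lt/(_ _ e0) nd := cg u Vu.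
apply: filterS2 nd (near_in_open oV Vu) => v gv Vv; split=> //=.
by apply: contraTneq gv => ->; rewrite subr0 ltxx.
Qed.

(** A field that spans the kernel of the first fundamental form, normalized by its coordinate [j0].
By [field_acc], its integral curves are geodesics up to parametrization. *)
Record null_field R n (G : 'rV[R]_n.+1 -> 'M[R]_n.+1)
    (f : 'rV[R]_n -> 'rV[R]_n.+1) (W : set 'rV[R]_n) (j0 : 'I_n) (X : 'rV[R]_n -> 'rV[R]_n)
    (lam : 'rV[R]_n -> R) : Prop := {
  field_open : open W;
  field_C1 : forall k, C1on W (fun u => X u 0 k);
  field_unit : forall u, W u -> X u 0 j0 = 1;
  field_null : forall u, W u -> X u *m first_form G f u = 0;
  field_line : forall u v, W u -> v *m first_form G f u = 0 -> v = v 0 j0 *: X u;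
  field_cont : forall u, W u -> {for u, continuous lam};
  field_normal : forall u, W u -> normal_covector G f X u != 0;
  field_acc : forall u, W u -> acceleration G f X u = lam u *: normal_covector G f X u }.

(** [X] is the kernel vector of [bordered_kernel]. Acceleration and normal covector both kill the
image of df, so they are proportional; the factor [lam] is their quotient at a coordinate [b0]
where the normal covector is nonzero, which shows its continuity. *)
Lemma null_field_exists R n (V : set 'rV[R]_n) (O : set 'rV[R]_n.+1)
    (G : 'rV[R]_n.+1 -> 'M[R]_n.+1) (f : 'rV[R]_n -> 'rV[R]_n.+1) (p : 'rV[R]_n) :
  null_chart V O G f -> V p ->
  exists W j0 X lam, [/\ W p, W `<=` V & null_field G f W j0 X lam].
Proof.
move=> NC Vp; have oV := null_open NC.
have /eqP/det0P[v v0 vB] := null_det NC Vp.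
have /rV0Pn[j0 vj0] := v0.
pose C u := first_form G f u + delta_mx j0 j0.
have CC : C1mx V C.
  move=> i j; have Ce u : V u -> first_form G f u i j + (delta_mx j0 j0 : 'M[R]_n) i j = C u i j.
    by rewrite !mxE.
  apply: (C1on_ext oV Ce); apply: (C1onD oV); first exact: (C1mx_first_form NC).
  exact: C1on_cst.
have Cp : C p \in unitmx.
  apply: (bordered_unitmx (first_form_sym NC Vp) vB _ vj0) => x xB.
  exact: (kernel_line NC Vp xB vB v0).
pose W1 := V `&` [set u | \det (C u) != 0].
have oW1 : open W1.
  apply: open_nonzero => // u Vu; exact: (C1on_cont (C1on_det oV CC)).
have W1V : W1 `<=` V by move=> u [].
have W1p : W1 p by split=> //=; move: Cp; rewrite unitmxE unitfE.
have CW u : W1 u -> C u \in unitmx by move=> [_ /=]; rewrite unitmxE unitfE.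
pose X u : 'rV[R]_n := delta_mx 0 j0 *m invmx (C u).
have CX : C1mx W1 X.
  apply: (C1mx_mul oW1); first by move=> i j; exact: (C1on_cst oW1).
  apply: (C1mx_inv oW1) => // i j; exact: C1on_sub (CC i j).
have K u (Wu : W1 u) := bordered_kernel (CW u Wu) (null_det NC (W1V u Wu)).
have XB u : W1 u -> X u *m first_form G f u = 0 by move=> /K[].
have Xj u : W1 u -> X u 0 j0 = 1 by move=> /K[].
pose N := normal_covector G f X.
have CXk k : C1on W1 (fun u => X u 0 k) by exact: CX.
have CN : C1mx W1 N by exact: (C1mx_normal NC oW1 W1V CXk).
have Np : N p != 0.
  rewrite /N /normal_covector; apply: contra_eq_neq (Xj p W1p) => E.
  have E1 : X p *m frame f p = 0.
    by rewrite -(mulmxK (null_unit NC (null_range NC Vp)) (X p *m frame f p)) E mul0mx.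
  have -> : X p = 0 by rewrite -(mulmxKp (null_free NC Vp) (X p)) E1 mul0mx.
  by rewrite mxE eq_sym oner_neq0.
have /rV0Pn[b0 Nb0] := Np.
pose W := W1 `&` [set u | N u 0 b0 != 0].
have oW : open W by apply: open_nonzero => // u Wu; exact: (C1on_cont (CN 0 b0)).
have WW1 : W `<=` W1 by move=> u [].
have WV : W `<=` V by move=> u /WW1/W1V.
pose lam u := acceleration G f X u 0 b0 / N u 0 b0.
have N0 u : W u -> N u != 0 by move=> [_ Nu]; apply/rV0Pn; exists b0.
exists W, j0, X, lam; split; [by split|exact: WV|split].
- exact: oW.
- by move=> k; exact: C1on_sub (CXk k).
- by move=> u /WW1; exact: Xj.
- by move=> u /WW1; exact: XB.
- by move=> u x /WW1 Wu; have [_ _ H] := K u Wu; exact: H.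
- move=> u Wu; apply: contM; last first.
    by apply: contV; [case: Wu|exact: (C1on_cont (CN 0 b0) (WW1 u Wu))].
  have -> : (fun u => acceleration G f X u 0 b0) =
      (fun u => \sum_i X u 0 i * pd i (fun v => N v 0 b0) u
         - 2^-1 * \sum_a \sum_c pd b0 (fun z => G z a c) (f u) * (X u *m frame f u) 0 a * (X u *m frame f u) 0 c).
    by apply/funext => w; rewrite row_subE !mxE.
  have W1u := WW1 u Wu; have Vu := WV u Wu.
  have xic a : {for u, continuous (fun u => (X u *m frame f u) 0 a)}.
    have CXD : C1mx W1 (fun u => X u *m frame f u).
      apply: (C1mx_mul oW1) => // i j; exact: C1on_sub (C1mx_frame NC i j).
    exact: (C1on_cont (CXD 0 a) W1u).
  apply: contB.
    apply: cont_sum => i; apply: contM; first exact: (C1on_cont (CXk i) W1u).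
    by case: (CN 0 b0 u W1u).
  apply: contM; first exact: cont_cst.
  apply: cont_sum => a; apply: cont_sum => c; apply: contM => //; apply: contM => //.
  apply: cont_comp.
    apply: continuous_row => i; exact: (C1on_cont (C1mx_chart NC 0 i) Vu).
  by case: (null_metric NC a c (null_range NC Vu)).
- exact: N0.
- move=> u Wu.
  have A := acceleration_frame NC oW1 W1V CXk XB (WW1 u Wu).
  have B := normal_frame XB (WW1 u Wu).
  have [c Ec] := left_kernel_line (rank_frame NC (WV u Wu)) A B (N0 u Wu).
  by rewrite /lam Ec mxE mulfK //; case: Wu.
Qed.

Definition momentum R (m : nat) (G : 'rV[R]_m -> 'M[R]_m) (x : R -> 'rV[R]_m) (s : R) : 'rV[R]_m :=
  derive1 x s *m G (x s).

(** The Euler-Lagrange form of the geodesic equation. The unknown is the covector G x', which along a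
null curve is a multiple of the normal covector of the hypersurface. *)
Definition momentum_law R (m : nat) (G : 'rV[R]_m -> 'M[R]_m) (x : R -> 'rV[R]_m) (s : R) : Prop :=
  is_derive s 1 (momentum G x) (force G (x s) (derive1 x s)).

Lemma forceZ R (m : nat) (G : 'rV[R]_m -> 'M[R]_m) (y v : 'rV[R]_m) (k : R) :
  force G y (k *: v) = k ^+ 2 *: force G y v.
Proof.
apply/rowP => i; rewrite !mxE mulrCA; congr (_ * _); rewrite mulr_sumr; apply: eq_bigr => a _.
by rewrite mulr_sumr; apply: eq_bigr => c _; rewrite !mxE; ring.
Qed.

Lemma derive1_val R (V : normedModType R) (c : R -> V) (s : R) (d : V) :
  is_derive s 1 c d -> derive1 c s = d.
Proof. by move=> D; rewrite derive1E (derive_of D). Qed.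

Lemma is_derive_derive1 R (V : normedModType R) (c : R -> V) (s : R) :
  derivable c s 1 -> is_derive s 1 c (derive1 c s).
Proof. by rewrite derive1E; exact: derivableP. Qed.

Lemma is_derive_curve R (V : normedModType R) (n m : nat)
    (f : 'rV[R]_n -> 'rV[R]_m) (c : V -> 'rV[R]_n) (s v : V) (d : 'rV[R]_n) :
  (forall a, differentiable (fun u => f u 0 a) (c s)) ->
  is_derive s v c d -> is_derive s v (f \o c) (d *m frame f (c s)).
Proof.
move=> Df Dc; apply: is_derive_row => a.
apply: (is_derive_eq (is_derive_chain (Df a) Dc)).
rewrite mxE; apply: eq_bigr => i _; rewrite mxE /GRing.scale /=; congr (_ * _).
have D : derivable f (c s) (delta_mx 0 i).
  by apply/derivable_mxP => j b; rewrite (ord1 j); exact: diff_derivable (Df b).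
by rewrite /pd (derive_mx D) mxE.
Qed.

Section Pregeodesic.
Context {R : realType} {n : nat} {V : set 'rV[R]_n} {O : set 'rV[R]_n.+1}
  {G : 'rV[R]_n.+1 -> 'M[R]_n.+1} {f : 'rV[R]_n -> 'rV[R]_n.+1}
  {W : set 'rV[R]_n} {j0 : 'I_n} {X : 'rV[R]_n -> 'rV[R]_n} {lam : 'rV[R]_n -> R}.
Hypothesis (NC : null_chart V O G f) (WV : W `<=` V) (NF : null_field G f W j0 X lam).
Context {c : R -> 'rV[R]_n} {mu : R -> R} {s : R}.
Hypothesis cX : \forall r \near s, W (c r) /\ is_derive r 1 c (mu r *: X (c r)).
Let N := normal_covector G f X.
Let x := f \o c.

Let Df r a : W (c r) -> differentiable (fun u => f u 0 a) (c r).
Proof. by move=> /WV/(C1mx_chart NC 0 a)[]. Qed.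

Let near_x' : \forall r \near s, derive1 x r = mu r *: (X (c r) *m frame f (c r)).
Proof.
apply: filterS cX => r [Wr Dc].
have Dfr a : differentiable (fun u => f u 0 a) (c r) by exact: Df.
by rewrite (derive1_val (is_derive_curve Dfr Dc)) scalemxAl.
Qed.

Let near_p : \forall r \near s, momentum G x r = mu r *: N (c r).
Proof. by apply: filterS near_x' => r E; rewrite /momentum E -scalemxAl. Qed.

Let Ws : W (c s). Proof. by have [] := nbhs_singleton cX. Qed.

Let DN k : is_derive s 1 (fun r => N (c r) 0 k)
  (mu s * \sum_i X (c s) 0 i * pd i (fun v => N v 0 k) (c s)).
Proof.
have [_ Dc] := nbhs_singleton cX.
have [DNk _] := C1mx_normal NC (field_open NF) WV (field_C1 NF) 0 k Ws.
apply: (is_derive_eq (is_derive_chain DNk Dc)).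
by rewrite mulr_sumr; apply: eq_bigr => i _; rewrite mxE /GRing.scale /= mulrA.
Qed.

Let acc_coord k : \sum_i X (c s) 0 i * pd i (fun v => N v 0 k) (c s) =
  lam (c s) * N (c s) 0 k + force G (f (c s)) (X (c s) *m frame f (c s)) 0 k.
Proof.
have := congr1 (fun M : 'rV[R]_n.+1 => M 0 k) (field_acc NF Ws).
rewrite row_subE mxE [RHS]mxE -/N => <-; by rewrite subrK.
Qed.

Let force_s : force G (x s) (derive1 x s) =
  mu s ^+ 2 *: force G (f (c s)) (X (c s) *m frame f (c s)).
Proof. by rewrite (nbhs_singleton near_x') forceZ. Qed.

(** The momentum is [mu] times the normal covector N, with derivative
mu' N + mu^2 (lam N + force), and the force is quadratic in the velocity. *)
Lemma momentum_of_speed : is_derive s 1 mu (- (lam (c s) * mu s ^+ 2)) -> momentum_law G x s.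
Proof.
move=> Dmu; rewrite /momentum_law force_s; apply: is_derive_row => k.
have E : \forall r \near s, mu r * N (c r) 0 k = momentum G x r 0 k.
  by apply: filterS near_p => r ->; rewrite [RHS]mxE.
apply: (near_eq_is_derive E); apply: (is_derive_eq (is_deriveM Dmu (DN k))).
by rewrite /GRing.scale /= acc_coord [RHS]mxE; ring.
Qed.

(** The same computation, read on a coordinate [b] where N is nonzero; dividing by it first gives the
differentiability of [mu]. *)
Lemma speed_of_momentum : momentum_law G x s -> is_derive s 1 mu (- (lam (c s) * mu s ^+ 2)).
Proof.
rewrite /momentum_law force_s => Dp.
have /rV0Pn[b Nb] := field_normal NF Ws; rewrite -/N in Nb.
have [DNd _] := DN b.
have nearN : \forall r \near s, N (c r) 0 b != 0.
  have cN : {for s, continuous (fun r => N (c r) 0 b)}.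
    by apply: differentiable_continuous; rewrite -derivable1_diffP.
  have e0 : 0 < `|N (c s) 0 b| by rewrite normr_gt0.
  have /cvgrPdist_lt/(_ _ e0) := cN; apply: filterS => r.
  by apply: contraTneq => ->; rewrite subr0 ltxx.
have Dmu : derivable mu s 1.
  apply: (@near_eq_derivable _ _ _ (fun r => momentum G x r 0 b * (N (c r) 0 b)^-1)).
    apply: filterS2 near_p nearN => r -> Nr; by rewrite [X in X / _]mxE mulfK.
  apply: derivableM; first by have [] := is_derive_coord b Dp.
  exact: derivableV.
have Dmu' := derivableP Dmu.
have E : \forall r \near s, momentum G x r 0 b = mu r * N (c r) 0 b.
  by apply: filterS near_p => r ->; rewrite [LHS]mxE.
have D1 := near_eq_is_derive E (is_derive_coord b Dp).
have D2 := is_deriveM Dmu' (DN b).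
have := derive_of D1; rewrite (derive_of D2).
rewrite /GRing.scale /= acc_coord [RHS]mxE => Eq.
apply: (is_derive_eq Dmu'); apply: (mulIf Nb).
have -> : 'D_1 mu s * N (c s) 0 b = N (c s) 0 b * 'D_1 mu s by rewrite mulrC.
move: Eq; move: ('D_1 mu s) (N (c s) 0 b) (mu s) (lam (c s)) (force _ _ _ 0 b) => d nb q l F Eq.
have -> : nb * d = q ^+ 2 * F - q * (q * (l * nb + F)) by rewrite -Eq; ring.
ring.
Qed.

End Pregeodesic.

(** * The geodesic equation in momentum form *)

Lemma is_derive_mulmx R (p q : nat) (a : R -> 'rV[R]_p) (B : R -> 'M[R]_(p, q))
    (s : R) (da : 'rV[R]_p) (dB : 'M[R]_(p, q)) :
  is_derive s 1 a da -> (forall i j, is_derive s 1 (fun r => B r i j) (dB i j)) ->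
  is_derive s 1 (fun r => a r *m B r) (da *m B s + a s *m dB).
Proof.
move=> Da DB; apply: is_derive_row => j.
have -> : (fun r => (a r *m B r) 0 j) = \sum_i (fun r => a r 0 i * B r i j).
  by apply/funext => r; rewrite mxE fct_sumE.
apply: (@is_derive_eq _ _ _ _ _ _ _ (\sum_i (a s 0 i * dB i j + B s i j * da 0 i))).
  by apply: is_derive_sum => i; exact: (is_deriveM (is_derive_coord i Da) (DB i j)).
by rewrite !mxE addrC big_split /=; congr (_ + _); apply: eq_bigr => i _; rewrite mulrC.
Qed.

(** The energies agree: [gform (G y) v v] is [gform (G' (tau y)) w w] for [w = v *m frame tau y].
Differentiating this in [y] with [v] frozen compares the two forces; they differ by the derivative
of the jacobian of [tau] along the curve, which is also the term that appears when the momentum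
is transported by this jacobian and differentiated. *)
Lemma momentum_change R (m : nat) (T O' O : set 'rV[R]_m) (tau : 'rV[R]_m -> 'rV[R]_m)
    (G G' : 'rV[R]_m -> 'M[R]_m) (x : R -> 'rV[R]_m) (s : R) :
  open T -> Ck 2 T tau -> (forall y, T y -> O' (tau y)) ->
  (forall a c, C1on O (fun y => G y a c)) -> (forall a c, C1on O' (fun y => G' y a c)) ->
  T `<=` O -> (forall y, O y -> (G y)^T = G y) ->
  (forall y, O' y -> (G' y)^T = G' y) ->
  (forall y, T y -> G y = frame tau y *m G' (tau y) *m (frame tau y)^T) ->
  (\forall r \near s, T (x r) /\ derivable x r 1) ->
  momentum_law G' (tau \o x) s -> momentum_law G x s.
Proof.
move=> oT C2 TO' CG CG' TO sG sG' GE nx ML.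
have [Ts Dxs] := nbhs_singleton nx.
have Dx := is_derive_derive1 Dxs.
set v := derive1 x s in Dx *; set y := x s in Ts *.
have CJ := Ck2_frame_C1mx oT C2.
have Dtau r : T (x r) -> forall a, differentiable (fun u => tau u 0 a) (x r).
  by move=> Tr a; case: (Ck2_C1mx oT C2 0 a Tr).
have near_z' : \forall r \near s, derive1 (tau \o x) r = derive1 x r *m frame tau (x r).
  apply: filterS nx => r [Tr Dr]; apply: derive1_val.
  exact: (is_derive_curve (Dtau r Tr) (is_derive_derive1 Dr)).
have near_p : \forall r \near s, momentum G' (tau \o x) r *m (frame tau (x r))^T = momentum G x r.
  apply: filterS2 nx near_z' => r [Tr _] E.
  by rewrite /momentum E GE // !mulmxA.
have DJ a k : is_derive s 1 (fun r => frame tau (x r) a k) (\sum_b v 0 b * pd b (fun u => frame tau u a k) y).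
  have [DJ _] := CJ a k y Ts.
  by apply: (is_derive_eq (is_derive_chain DJ Dx)).
have DJt i k : is_derive s 1 (fun r => (frame tau (x r))^T i k)
    ((\matrix_(i, k) \sum_b v 0 b * pd b (fun u => frame tau u k i) y) i k).
  have -> : (fun r => (frame tau (x r))^T i k) = (fun r => frame tau (x r) k i).
    by apply/funext => r; rewrite mxE.
  by rewrite mxE.
have := is_derive_mulmx ML DJt => /(near_eq_is_derive near_p) H.
apply: (is_derive_eq H); rewrite (nbhs_singleton near_z') -/v -/y.
apply/rowP => k.
pose w u := v *m frame tau u.
have DG' a c : differentiable (fun y => G' y a c) (tau y) by case: (CG' a c (tau y) (TO' y Ts)).
have DG a c : differentiable (fun y => G y a c) y by case: (CG a c y (TO y Ts)).
have Dtk : is_derive y (delta_mx 0 k) tau (pd k tau y).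
  by have [_ C] := C2; have [D _] := C k; exact: derivableP (D y Ts).
have Dw : is_derive y (delta_mx 0 k) w (\row_c \sum_a v 0 a * pd k (fun u => frame tau u a c) y).
  apply: is_derive_row => c; rewrite mxE.
  have -> : (fun u => w u 0 c) = \sum_a (fun u => v 0 a * frame tau u a c).
    by apply/funext => u; rewrite mxE fct_sumE.
  apply: is_derive_sum => a.
  have D : is_derive y (delta_mx 0 k) (fun u => frame tau u a c) (pd k (fun u => frame tau u a c) y).
    by apply: is_derive_pd; case: (CJ a c y Ts).
  exact: (@is_deriveZ R _ R _ (v 0 a) _ _ _ D).
have Q1 := is_derive_gform DG' (sG' _ (TO' y Ts)) Dtk Dw.
have Q2 := is_derive_gform DG (sG _ (TO y Ts)) (is_derive_id y (delta_mx 0 k)) (is_derive_cst v y (delta_mx 0 k)).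
have QE : \forall u \near y, gform (G' (tau u)) (w u) (w u) = gform (G u) v v.
  apply: filterS (near_in_open oT Ts) => u Tu.
  by rewrite /gform /w GE // trmx_mul !mulmxA.
have := derive_of (near_eq_is_derive QE Q1).
rewrite (derive_of Q2) => E2.
have two0 : (2 : R) != 0 by rewrite pnatr_eq0.
have {E2} E := mulfI two0 E2.
have e1 : \sum_b (delta_mx 0 k : 'rV[R]_m) 0 b * force G y v 0 b = force G y v 0 k.
  rewrite (bigD1 k) //= mxE !eqxx mul1r big1 ?addr0 // => i ik.
  by rewrite mxE (negbTE ik) andbF mul0r.
have e2 : \sum_c (v *m G y) 0 c * (0 : 'rV[R]_m) 0 c = 0.
  by apply: big1 => c _; rewrite [X in _ * X]mxE mulr0.
move: E; rewrite e1 e2 addr0 => ->.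
rewrite mxE; congr (_ + _).
  by rewrite mxE; apply: eq_bigr => b _; rewrite [(frame tau _)^T _ _]mxE [frame tau _ _ _]mxE mulrC.
rewrite mxE; apply: eq_bigr => c _.
rewrite [X in _ * X = _]mxE [X in _ = _ * X]mxE /momentum (nbhs_singleton near_z').
congr (_ * _); apply: eq_bigr => a _; congr (_ * _).
exact: (frame_pd_comm oT C2 a k c Ts).
Qed.

(** The velocity is the momentum times the inverse of G, hence differentiable. The derivative of G
along the curve, contracted with the velocity twice, splits into the two symmetric halves that
occur in the Christoffel symbols. *)
Lemma geodesic_of_momentum R (m : nat) (O : set 'rV[R]_m)
    (G : 'rV[R]_m -> 'M[R]_m) (x : R -> 'rV[R]_m) (s : R) :
  open O -> (forall a c, C1on O (fun y => G y a c)) ->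
  (forall y, O y -> (G y)^T = G y) -> (forall y, O y -> G y \in unitmx) ->
  (\forall r \near s, O (x r) /\ derivable x r 1) ->
  momentum_law G x s ->
  derivable (derive1 x) s 1 /\ forall k : 'I_m,
    derive1 (derive1 x) s 0 k + \sum_(i < m) \sum_(j < m)
      christoffel G (x s) k i j * derive1 x s 0 i * derive1 x s 0 j = 0.
Proof.
move=> oO CG sG uG nx ML.
have [Os Dxs] := nbhs_singleton nx.
have Dx := is_derive_derive1 Dxs.
have CI := C1mx_inv oO uG CG.
have DGx (H : 'rV[R]_m -> 'M[R]_m) a c : C1mx O H -> is_derive s 1 (fun r => H (x r) a c)
   (\sum_b derive1 x s 0 b * pd b (fun y => H y a c) (x s)).
  by move=> CH; have [DH _] := CH a c (x s) Os; exact: (is_derive_chain DH Dx).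
have near_x' : \forall r \near s, momentum G x r *m invmx (G (x r)) = derive1 x r.
  by apply: filterS nx => r [Or _]; rewrite /momentum mulmxK // uG.
have D2 : derivable (derive1 x) s 1.
  pose dI := \matrix_(a, c) \sum_b derive1 x s 0 b * pd b (fun y => invmx (G y) a c) (x s).
  have DI a c : is_derive s 1 (fun r => invmx (G (x r)) a c) (dI a c).
    by rewrite mxE; exact: DGx CI.
  by have [D _] := near_eq_is_derive near_x' (is_derive_mulmx ML DI).
split=> // k.
have D2' := is_derive_derive1 D2.
set acc := derive1 (derive1 x) s in D2' *; set v := derive1 x s in Dx ML D2' DGx *; set y := x s in Os ML DGx *.
pose dG := \matrix_(a, c) \sum_b v 0 b * pd b (fun y => G y a c) y.
have DG a c : is_derive s 1 (fun r => G (x r) a c) (dG a c) by rewrite mxE; exact: DGx CG.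
have E : acc *m G y = - (v *m dG - force G y v).
  have P1 := is_derive_mulmx D2' DG.
  have := derive_of P1; rewrite (derive_of ML) => ->.
  by rewrite opprB addrK.
have -> : acc = - ((v *m dG - force G y v) *m invmx (G y)).
  by rewrite -mulNmx -E mulmxK // uG.
apply/eqP; rewrite [X in X + _]mxE addrC subr_eq0; apply/eqP; rewrite [RHS]mxE.
have symI l : invmx (G y) l k = invmx (G y) k l by rewrite -{1}(sG y Os) -trmx_inv mxE.
transitivity (\sum_l invmx (G y) k l * \sum_i \sum_j 2^-1 * (pd i (fun z => G z j l) y
   + pd j (fun z => G z i l) y - pd l (fun z => G z i j) y) * v 0 i * v 0 j).
  rewrite /christoffel.
  apply: esym; transitivity (\sum_l \sum_i \sum_j invmx (G y) k l * (2^-1 * (pd i (fun z => G z j l) y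
   + pd j (fun z => G z i l) y - pd l (fun z => G z i j) y) * v 0 i * v 0 j)).
    by apply: eq_bigr => l _; rewrite mulr_sumr; apply: eq_bigr => i _; rewrite mulr_sumr.
  rewrite exchange_big /=; apply: eq_bigr => i _; rewrite exchange_big /=; apply: eq_bigr => j _.
  by rewrite mulr_sumr !mulr_suml; apply: eq_bigr => l _; ring.
apply: eq_bigr => l _; rewrite symI mulrC; congr (_ * _).
rewrite row_subE [force _ _ _ _ _]mxE.
have -> : (v *m dG) 0 l = \sum_i \sum_j pd i (fun z => G z j l) y * v 0 i * v 0 j.
  rewrite mxE exchange_big /=; apply: eq_bigr => j _; rewrite mxE mulr_sumr.
  by apply: eq_bigr => i _; ring.
have sw : \sum_i \sum_j pd i (fun z => G z j l) y * v 0 i * v 0 j =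
    \sum_i \sum_j pd j (fun z => G z i l) y * v 0 i * v 0 j.
  by rewrite exchange_big /=; apply: eq_bigr => i _; apply: eq_bigr => j _; ring.
transitivity (2^-1 * (\sum_i \sum_j pd i (fun z => G z j l) y * v 0 i * v 0 j) +
  2^-1 * (\sum_i \sum_j pd j (fun z => G z i l) y * v 0 i * v 0 j) -
  2^-1 * (\sum_i \sum_j pd l (fun z => G z i j) y * v 0 i * v 0 j)).
  rewrite -!mulrDr -mulrN -mulrDr -!sumrN -!big_split mulr_sumr /=; apply: eq_bigr => i _.
  by rewrite -sumrN -!big_split mulr_sumr /=; apply: eq_bigr => j _; ring.
by rewrite -sw; congr (_ - _); rewrite -mulrDl -[X in (X + X) * _]mul1r -splitr mul1r.
Qed.

(** * Flow boxes of the null field *)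

(** The geodesics along the null field: [c' = mu *: X] with [mu' = - lam mu^2], where the speed [mu]
is read on the coordinate [j0], in which [X] is 1. *)
Definition speed_law R n (W : set 'rV[R]_n) (X : 'rV[R]_n -> 'rV[R]_n)
    (j0 : 'I_n) (lam : 'rV[R]_n -> R) (c : R -> 'rV[R]_n) (s : R) : Prop :=
  [/\ \forall r \near s, W (c r) /\ is_derive r 1 c (derive1 c r 0 j0 *: X (c r)),
    derive1 c s 0 j0 != 0 &
    is_derive s 1 (fun r => derive1 c r 0 j0) (- (lam (c s) * derive1 c s 0 j0 ^+ 2))].

Definition unit_clamp R (t : R) : R := Num.max (-1) (Num.min 1 t).

Lemma unit_clamp_id R (t : R) : `|t| <= 1 -> unit_clamp t = t.
Proof. by rewrite /unit_clamp ler_norml => /andP[h1 h2]; rewrite (min_idPr h2) (max_idPr h1). Qed.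

Lemma unit_clamp_le R (t : R) : `|unit_clamp t| <= 1.
Proof. by rewrite /unit_clamp ler_norml le_max lexx ge_max ge_min lexx /= andbT; lra. Qed.

Lemma unit_clamp_continuous R : continuous (@unit_clamp R).
Proof.
apply: (@lipschitz_continuous _ _ _ _ 1) => t s; rewrite mul1r.
by apply: le_trans (dist_max _ _ _) _; exact: dist_min.
Qed.

(** A solution of S'' = g S' with S' > 0: if an orbit is a geodesic up to parametrization, with
acceleration g times its velocity, then S is an affine parameter along it. *)
Definition affine_parameter R (g : R -> R) : R -> R := primitive (expR \o primitive g).

Section AffineParameter.
Context {R : realType} {g : R -> R}.
Hypothesis cg : continuous g.
Let S := affine_parameter g.

Lemma primitive_continuous : continuous (primitive g).
Proof.
move=> t; apply: differentiable_continuous; rewrite -derivable1_diffP.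
by have [] := is_derive_primitive t cg.
Qed.

Lemma is_derive_affine_parameter (t : R) : is_derive t 1 S (expR (primitive g t)).
Proof.
apply: is_derive_primitive => r.
apply: (@cont_comp _ _ _ (primitive g) expR); first exact: primitive_continuous.
exact: continuous_expR.
Qed.

Lemma affine_parameter_continuous : continuous S.
Proof.
move=> t; apply: differentiable_continuous; rewrite -derivable1_diffP.
by have [] := is_derive_affine_parameter t.
Qed.

Lemma affine_parameter_lt (a b : R) : a < b -> S a < S b.
Proof.
move=> ab; have [c _ E] := mean_value (ltW ab) (fun t _ => is_derive_affine_parameter t).
by rewrite -subr_gt0 E mulr_gt0 ?expR_gt0 // subr_gt0.
Qed.

Lemma affine_parameter_inj : injective S.
Proof.
move=> a b E; case: (ltgtP a b) => // /affine_parameter_lt; by rewrite E ltxx.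
Qed.

Lemma affine_parameter_inverse : exists (J : set R) (sigma : R -> R),
  [/\ open J, is_interval J,
    forall s, J s -> [/\ -1 < sigma s < 1, S (sigma s) = s &
      is_derive s 1 sigma (expR (- primitive g (sigma s)))] &
    forall t : R, -1 < t < 1 -> J (S t) /\ sigma (S t) = t].
Proof.
pose J : set R := [set` `]S (-1), S 1[].
have J_ex s : J s -> exists t, -1 < t < 1 /\ S t = s.
  rewrite /J /= in_itv /= => /andP[s1 s2].
  have le11 : (-1 : R) <= 1 by lra.
  have [||t] := @IVT R S (-1) 1 s le11.
  - by apply: continuous_subspaceT; exact: affine_parameter_continuous.
  - have S11 : S (-1) <= S 1 by apply/ltW/affine_parameter_lt; lra.
    by rewrite (min_idPl S11) (max_idPr S11) !ltW.
  rewrite in_itv /= => /andP[t1 t2] E; exists t; split=> //.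
  rewrite !lt_neqAle t1 t2 !andbT; apply/andP; split.
    by apply: contraTneq s1 => ->; rewrite -E ltxx.
  by apply: contraTneq s2 => <-; rewrite -E ltxx.
pose sigma s := xget 0 [set t | S t = s].
have sS t : sigma (S t) = t.
  by apply: affine_parameter_inj; exact: (@xgetPex _ 0 [set r | S r = S t] (ex_intro _ t erefl)).
exists J, sigma; split.
- exact: itv_open.
- exact: interval_is_interval.
- move=> _ /J_ex[t [t1 <-]]; rewrite sS; split=> //.
  rewrite expRN; apply: is_derive_inverse.
  + by near=> r; exact: sS.
  + by near=> r; exact: affine_parameter_continuous.
  + exact: is_derive_affine_parameter.
  + by rewrite gt_eqF ?expR_gt0.
- move=> t /andP[t1 t2]; split; last exact: sS.
  by rewrite /J /= in_itv /= !affine_parameter_lt.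
Unshelve. all: by end_near. Qed.

End AffineParameter.

(** In the chart of [flow_box] the first coordinate t along an orbit is its time divided by [delta],
so S = [affine_parameter (g y)] with [g y = delta * lam] is an affine parameter along the plaque of
[y]. A curve in the box obeys the speed law when S is an affine function of its parameter; this
gives both the curve that fills a plaque and the uniqueness of a curve with given position and
velocity. *)
Lemma box_of_flow R n (U : set 'rV[R]_n.+1) (P : (R -> 'rV[R]_n.+1) -> R -> Prop)
    (W : set 'rV[R]_n.+1) (X : 'rV[R]_n.+1 -> 'rV[R]_n.+1) (j0 : 'I_n.+1)
    (lam : 'rV[R]_n.+1 -> R) (p : 'rV[R]_n.+1) :
  open W -> W `<=` U -> W p -> (forall i, C1on W (fun u => X u 0 i)) ->
  (forall u, W u -> X u 0 j0 = 1) -> (forall u, W u -> {for u, continuous lam}) ->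
  (forall c s, W (c s) -> P c s <-> speed_law W X j0 lam c s) ->
  exists V h k, V p /\ curve_box U P V h k.
Proof.
move=> oW WU Wp CX Xj Cl PE.
have [V [h [k [delta [[d0 oV Vp VW Dhk] [kc kW kD]]]]]] := flow_box oW Wp CX Xj.
have [Ch Ckk hV kh] := Dhk.
have dn0 : delta != 0 by rewrite gt_eqF.
have Vh x : V x -> `|h x| < 1.
  by move=> Vx; rewrite -(unit_ballE (h x)) -hV; exists x.
have Vk (y : 'rV[R]_n.+1) : `|y| < 1 -> V (k y) /\ h (k y) = y.
  by rewrite -(unit_ballE y) -hV => -[x Vx <-]; rewrite kh.
have Dh x j : V x -> differentiable (fun u => h u 0 j) x.
  by move=> Vx; have [] := Ck1_C1on oV (Ck_coord oV j Ch) Vx.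
have sf_norm (y : 'rV[R]_n.+1) t : `|y| < 1 -> `|t| < 1 -> `|set_first y t| < 1.
  move=> y1 t1; apply: row_norm_lt => // i; rewrite mxE; case: eqP => // _.
  by apply: le_lt_trans y1; exact: row_norm_ge.
have sf_norm' (y : 'rV[R]_n.+1) t : `|y| < 1 -> `|t| <= 1 -> `|set_first y t| <= 1.
  move=> y1 t1; apply: row_norm_le => // i; rewrite mxE; case: eqP => // _.
  by apply: le_trans (ltW y1); exact: row_norm_ge.
have sf_id (y : 'rV[R]_n.+1) : set_first y (y 0 0) = y.
  by apply/rowP => i; rewrite mxE; case: eqP => // ->.
(* in the coordinates [h] the field is [delta^-1] times d/dy_0 *)
have Xh x j : V x -> \sum_i X x 0 i * pd i (fun u => h u 0 j) x = (j == 0)%:R / delta.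
  move=> Vx; pose y := h x; have y1 : `|y| < 1 by exact: Vh.
  have y01 : `|y 0 0| < 1 by apply: le_lt_trans y1; exact: row_norm_ge.
  have kyx : k (set_first y (y 0 0)) = x by rewrite sf_id kh.
  have D1 := kD y (y 0 0); rewrite kyx sf_id in D1.
  have Dhx : differentiable (fun u => h u 0 j) (k (set_first y (y 0 0))) by rewrite kyx; exact: Dh.
  have := is_derive_chain Dhx (D1 (ltW y1)); rewrite kyx => D2.
  have near1 : \forall t \near y 0 0, ((fun u => h u 0 j) \o (fun t => k (set_first y t))) t = set_first y t 0 j.
    have e0 : 0 < 1 - `|y 0 0| by rewrite subr_gt0.
    apply/nbhs_ballP; exists (1 - `|y 0 0|) => //= t; rewrite -ball_normE /= ltrBrDr distrC => ty.
    have t1 : `|t| < 1.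
      by have := ler_normD (t - y 0 0) (y 0 0); rewrite subrK => /le_lt_trans; apply.
    by have [_ ->] := Vk _ (sf_norm y t y1 t1).
  have := near_eq_is_derive near1 D2 => D3.
  have D4 : is_derive (y 0 0) 1 (fun t => set_first y t 0 j) ((j == 0)%:R : R).
    have -> : (fun t => set_first y t 0 j) = (fun t => if j == 0 then t else y 0 j).
      by apply/funext => t; rewrite mxE.
    by case: eqP => _; [exact: is_derive_id|exact: is_derive_cst].
  have := derive_of D3; rewrite (derive_of D4) => ->.
  apply: (mulIf dn0); rewrite divfK // mulrC mulr_sumr; apply: eq_bigr => i _.
  by rewrite mxE /GRing.scale /= mulrA.
have good_speed I c : good_curve P I c -> (forall s, I s -> V (c s)) -> forall s, I s ->
    speed_law W X j0 lam c s.
  by move=> [_ _ H] cV s Is; apply: (PE c s (VW _ (cV s Is))).1; exact: H.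
have Dhc I c : good_curve P I c -> (forall s, I s -> V (c s)) -> forall s, I s -> forall j,
    is_derive s 1 (fun r => h (c r) 0 j) (derive1 c s 0 j0 * ((j == 0)%:R / delta)).
  move=> g cV s Is j; have [/nbhs_singleton[_ Dc] _ _] := good_speed I c g cV s Is.
  apply: (is_derive_eq (is_derive_chain (Dh _ j (cV s Is)) Dc)).
  rewrite -(Xh _ j (cV s Is)).
  by rewrite mulr_sumr; apply: eq_bigr => i _; rewrite mxE /GRing.scale /= mulrA.
have cst_on (I : set R) (u : R -> R) : is_interval I -> (forall s, I s -> is_derive s 1 u 0) ->
    forall s s', I s -> I s' -> u s = u s'.
  move=> iI Du s s' Is Is'.
  have [|r _] := @mean_value_any R u (fun=> 0) s s'.
    move=> r; case: (leP s s') => ss' rr; apply: Du; first exact: (iI s s').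
    exact: (iI s' s).
  by rewrite mul0r => /eqP; rewrite subr_eq0 => /eqP.
have transverse I c : good_curve P I c -> (forall s, I s -> V (c s)) ->
    forall s s', I s -> I s' -> forall j : 'I_n.+1, (0 < j)%N -> h (c s) 0 j = h (c s') 0 j.
  move=> g cV s s' Is Is' j j_gt0; have [_ iI _] := g.
  apply: (cst_on I (fun r => h (c r) 0 j)) => // r Ir.
  have := Dhc I c g cV r Ir j; have -> : (j == 0) = false by apply/eqP => E; rewrite E in j_gt0.
  by rewrite mul0r mulr0.
(* [unit_clamp] extends the function from the plaque to a continuous function on the line *)
pose g (y : 'rV[R]_n.+1) t := delta * lam (k (set_first y (unit_clamp t))).
have cg (y : 'rV[R]_n.+1) : `|y| < 1 -> continuous (g y).
  move=> y1 t; apply: contM; first exact: cont_cst.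
  have csf : {for t, continuous (fun t => set_first y (unit_clamp t))}.
    apply: continuous_row => i.
    have -> : (fun t => set_first y (unit_clamp t) 0 i) = (fun t => if i == 0 then unit_clamp t else y 0 i).
      by apply/funext => r; rewrite mxE.
    by case: eqP => _; [exact: unit_clamp_continuous|exact: cont_cst].
  apply: cont_comp; last by apply: Cl; apply: kW; apply: sf_norm' => //; exact: unit_clamp_le.
  by apply: cont_comp; [exact: csf|exact: kc].
have gE (y : 'rV[R]_n.+1) t : `|t| < 1 -> g y t = delta * lam (k (set_first y t)).
  by move=> t1; rewrite /g unit_clamp_id // ltW.
exists V, h, k; split=> //; split=> //.
- by move=> x /VW/WU.
- move=> x Vx; pose y := h x; have y1 : `|y| < 1 by exact: Vh.
  have [J [sigma [oJ iJ HJ HS]]] := affine_parameter_inverse (cg y y1).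
  pose c s := k (set_first y (sigma s)).
  have sig1 s : J s -> `|sigma s| < 1 by move=> /HJ[]; rewrite ltr_norml.
  have cV s : J s -> V (c s) by move=> Js; apply: (Vk _ _).1; apply: sf_norm => //; exact: sig1.
  pose L := primitive (g y).
  have Dc s : J s -> is_derive s 1 c ((delta * expR (- L (sigma s))) *: X (c s)).
    move=> Js; have [_ _ Ds] := HJ s Js.
    have Dk := kD y (sigma s) (ltW (sf_norm y _ y1 (sig1 s Js))).
    apply: is_derive_row => i.
    apply: (is_derive_eq (is_derive1_comp (is_derive_coord i Dk) Ds)).
    by rewrite !mxE; ring.
  have near_J s : J s -> \forall r \near s, J r by move=> Js; exact: open_nbhs_nbhs.
  have muE s : J s -> derive1 c s 0 j0 = delta * expR (- L (sigma s)).
    move=> Js; rewrite (derive1_val (Dc s Js)) mxE Xj ?mulr1 //; exact/VW/cV.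
  exists J, c; split.
    split=> // s Js; apply: (PE c s (VW _ (cV s Js))).2; split.
    + apply: filterS (near_J s Js) => r Jr; split; first exact/VW/cV.
      by rewrite muE //; exact: Dc.
    + by rewrite muE // mulf_neq0 // gt_eqF ?expR_gt0.
    + have near_mu : \forall r \near s, delta * expR (- L (sigma r)) = derive1 c r 0 j0.
        by apply: filterS (near_J s Js) => r Jr; rewrite muE.
      apply: (near_eq_is_derive near_mu); rewrite muE //.
      have [_ _ Ds] := HJ s Js.
      have DL : is_derive (sigma s) 1 L (g y (sigma s)) by exact: is_derive_primitive (cg y y1).
      have D1 := is_derive1_comp DL Ds.
      have D2 : is_derive s 1 (fun r => - L (sigma r)) (- (g y (sigma s) * expR (- L (sigma s)))).
        exact: is_deriveN D1.
      have D3 := @is_derive1_comp R expR (fun r => - L (sigma r)) s _ _ (is_derive_expR _) D2.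
      apply: (is_derive_eq (is_deriveMc delta D3)).
      by rewrite gE ?sig1 // -/(c s); ring.
  apply/seteqP; split=> z.
    move=> [s Js <-]; split; first exact: cV.
    move=> j j_gt0; have [_ ->] := Vk _ (sf_norm y _ y1 (sig1 s Js)).
    by rewrite mxE; case: eqP => // E; rewrite E in j_gt0.
  move=> [Vz hz]; pose t := h z 0 0.
  have t1 : -1 < t < 1.
    by rewrite -ltr_norml; apply: le_lt_trans (Vh z Vz); exact: row_norm_ge.
  have [JSt sSt] := HS t t1.
  exists (affine_parameter (g y) t) => //; rewrite /c sSt -(kh z Vz); congr k.
  apply/rowP => j; rewrite mxE; case: eqP => [->//|/eqP j_n0].
  by rewrite -hz // lt0n.
- move=> I c1 c2 s0 g1 g2 V1 V2 Is0 e0 de0.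
  have [_ iI _] := g1.
  pose y := h (c1 s0); have y1 : `|y| < 1 by apply: Vh; exact: V1.
  have hE c : good_curve P I c -> (forall s, I s -> V (c s)) -> c s0 = c1 s0 ->
      forall s, I s -> h (c s) = set_first y (h (c s) 0 0).
    move=> gc cV cs0 s Is; apply/rowP => j; rewrite mxE; case: eqP => [->//|/eqP j_n0].
    by rewrite /y -cs0; apply: transverse gc cV _ _ Is Is0 _ _; rewrite lt0n.
  pose L := primitive (g y).
  pose S := affine_parameter (g y).
  (* S grows at constant speed along [c] because the speed of [c] times exp L is constant *)
  have FE c : good_curve P I c -> (forall s, I s -> V (c s)) -> c s0 = c1 s0 ->
      forall s, I s -> is_derive s 1 (fun r => S (h (c r) 0 0))
        (derive1 c s0 0 j0 * expR (L (y 0 0)) / delta).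
    move=> gc cV cs0 s Is.
    have Dt (r : R) : I r -> is_derive r 1 (fun r => h (c r) 0 0) (derive1 c r 0 j0 / delta).
      by move=> Ir; have := Dhc I c gc cV r Ir 0; rewrite eqxx mul1r.
    have DL : forall t : R, is_derive t 1 L (g y t) by move=> t; exact: is_derive_primitive (cg y y1).
    have F (r : R) : I r -> is_derive r 1 (fun r => derive1 c r 0 j0 * expR (L (h (c r) 0 0))) 0.
      move=> Ir; have [_ _ Dmu] := good_speed I c gc cV r Ir.
      have D1 := is_derive1_comp (DL (h (c r) 0 0)) (Dt r Ir).
      have D2 := @is_derive1_comp R expR (L \o (fun r => h (c r) 0 0)) r _ _ (is_derive_expR _) D1.
      apply: (is_derive_eq (is_deriveM Dmu D2)).
      have t1 : `|h (c r) 0 0| < 1 by apply: le_lt_trans (Vh _ (cV r Ir)); exact: row_norm_ge.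
      rewrite gE // -hE // kh; last exact: cV.
      by rewrite /GRing.scale /=; field.
    have := cst_on I _ iI F s s0 Is Is0; rewrite cs0 -/y => Fs.
    have DS := is_derive1_comp (is_derive_affine_parameter (cg y y1) (h (c s) 0 0)) (Dt s Is).
    apply: (is_derive_eq DS); rewrite -Fs; ring.
  move=> s Is.
  have D (r : R) : I r -> is_derive r 1 (fun r => S (h (c1 r) 0 0) - S (h (c2 r) 0 0)) 0.
    move=> Ir; have := is_deriveB (FE c1 g1 V1 erefl r Ir) (FE c2 g2 V2 (esym e0) r Ir).
    by rewrite de0 subrr.
  have := cst_on I _ iI D s s0 Is Is0; rewrite e0 subrr => /eqP; rewrite subr_eq0 => /eqP.
  move=> /(affine_parameter_inj (cg y y1)) E.
  rewrite -(kh _ (V1 s Is)) -(kh _ (V2 s Is)) (hE c1) // (hE c2) // ?E //.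
Qed.

(** * Light-like hypersurfaces of a manifold *)

Lemma near_near R (s : R) (Q : R -> Prop) :
  (\forall r \near s, Q r) -> \forall r \near s, \forall q \near r, Q q.
Proof. exact: nbhs_interior. Qed.

Lemma near_affine R (a b s : R) (Q : R -> Prop) :
  (\forall r \near (a * s + b), Q r) -> \forall r \near s, Q (a * r + b).
Proof.
have c : {for s, continuous (fun r => a * r + b)}.
  by apply: contD; [apply: contM; [exact: cont_cst|exact: cont_id]|exact: cont_cst].
by move=> H; exact: c _ H.
Qed.

Lemma near_comp_open R n (V : set 'rV[R]_n) (c : R -> 'rV[R]_n) (s : R) :
  open V -> V (c s) -> derivable c s 1 -> \forall r \near s, V (c r).
Proof.
move=> oV Vs D; have cc : {for s, continuous c}.
  by apply: differentiable_continuous; rewrite -derivable1_diffP.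
by apply: cc; exact: near_in_open.
Qed.

Lemma differentiable_row R (n m : nat) (f : 'rV[R]_n -> 'rV[R]_m) (x : 'rV[R]_n) :
  (forall a, differentiable (fun u => f u 0 a) x) -> differentiable f x.
Proof.
move=> Df; have -> : f = \sum_(a < m) (fun u => f u 0 a *: (delta_mx 0 a : 'rV[R]_m)).
  by apply/funext => u; rewrite fct_sumE [LHS]row_sum_delta.
by apply: differentiable_sum => a; exact: differentiableZl.
Qed.

Lemma Ck_row R (n m : nat) (V : set 'rV[R]_n) (k : nat) (f : 'rV[R]_n -> 'rV[R]_m) :
  open V -> (forall j, Ck k V (fun u => f u 0 j)) -> Ck k V f.
Proof.
move=> oV; elim: k f => [|k IH] f H; (split; first by move=> x Vx; apply: continuous_row => j; have [c _] := H j; exact: c) => //.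
have D i x : V x -> derivable f x (delta_mx 0 i).
  move=> Vx; apply/derivable_mxP => a j; rewrite (ord1 a).
  by have [_ /(_ i)[D _]] := H j; exact: D.
move=> i; split; first exact: D.
apply: IH => j; have [_ /(_ i)[_ C]] := H j.
by apply: (Ck_ext oV _ C) => x Vx; rewrite /pd (derive_mx (D i x Vx)) mxE.
Qed.

Lemma lorentz_unit R (m : nat) (G : 'M[R]_m) : lorentz_signature G -> G \in unitmx.
Proof.
move=> [_ [P uP E]]; have : \det (P *m G *m P^T) != 0.
  rewrite E det_diag; apply/prodf_neq0 => i _; rewrite mxE; case: ifP => _.
    by rewrite oppr_eq0 oner_neq0.
  exact: oner_neq0.
rewrite !det_mulmx !mulf_eq0 !negb_or => /andP[/andP[_ dG] _].
by rewrite unitmxE unitfE.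
Qed.

Lemma momentum_law_near R (m : nat) (G : 'rV[R]_m -> 'M[R]_m) (x y : R -> 'rV[R]_m) (s : R) :
  (\forall r \near s, x r = y r) -> momentum_law G x s -> momentum_law G y s.
Proof.
move=> xy ML; rewrite /momentum_law -(nbhs_singleton xy) -(eq_derive1_near xy).
apply: near_eq_is_derive ML; apply: filterS (near_near xy) => r nr.
by rewrite /momentum -(eq_derive1_near nr) -(nbhs_singleton nr).
Qed.

Lemma momentum_law_affine R (m : nat) (G : 'rV[R]_m -> 'M[R]_m) (x : R -> 'rV[R]_m)
    (a b s : R) :
  (\forall r \near (a * s + b), derivable x r 1) -> momentum_law G x (a * s + b) ->
  momentum_law G (fun r => x (a * r + b)) s.
Proof.
move=> nD ML; rewrite /momentum_law (derive1_affine (nbhs_singleton nD)) forceZ.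
have D := is_derive_affine ML.
have DZ : is_derive s 1 (fun r => a *: momentum G x (a * r + b)) (a *: (a *: force G (x (a * s + b)) (derive1 x (a * s + b)))).
  exact: (is_deriveZ a D).
apply: (@is_derive_eq _ _ _ _ _ _ _ (a *: (a *: force G (x (a * s + b)) (derive1 x (a * s + b))))); last first.
  by rewrite scalerA expr2.
apply: near_eq_is_derive DZ; apply: filterS (near_affine nD) => r Dr.
by rewrite /momentum (derive1_affine Dr) scalemxAl.
Qed.

Section Hypersurface.
Context {R : realType} {n l : nat} {M : topologicalType} {A : set (chart R n.+2 M)}
  {g : chart R n.+2 M -> 'rV[R]_n.+2 -> 'M[R]_n.+2} {U : set 'rV[R]_n.+1}
  {F : 'rV[R]_n.+1 -> M}.
Hypothesis (hr : (3 <= l)%N) (hM : oriented_analytic_manifold A) (hg : lorentz_metric l A g)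
  (hUo : open U) (hF : Ck_immersion 2 A U F) (hl : light_like A g U F).
Implicit Types (phi psi : chart R n.+2 M) (c : R -> 'rV[R]_n.+1).

Let dom phi := U `&` F @^-1` cdom phi.
Let loc phi := cmap phi \o F.

Lemma immersion_continuous u : U u -> {for u, continuous F}.
Proof.
move=> Uu; have [cF _] := hF.
by move: cF; rewrite continuous_open_subspace // => /(_ u); rewrite inE; exact.
Qed.

Lemma dom_open phi : open (dom phi).
Proof.
rewrite openE => u [Uu du].
have nF : nbhs u (F @^-1` cdom phi).
  by apply: (immersion_continuous Uu); apply: open_nbhs_nbhs; split=> //; exact: cdom_open.
by apply: filterI => //; exact: near_in_open.
Qed.

Lemma chart_null phi : A phi -> null_chart (dom phi) (ccod phi) (g phi) (loc phi).
Proof.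
move=> Aphi; have [_ /(_ phi Aphi)[C2 inj]] := hF.
have oC : open (ccod phi) by exact: ccod_open.
have rng u : dom phi u -> ccod phi (loc phi u) by move=> [_ du]; exists (F u).
split=> //.
- exact: dom_open.
- move=> a c; apply: (Ck1_C1on oC).
  by apply: Ck_le (metric_class hg Aphi a c); apply: leq_trans hr.
- by move=> y Oy; have [] := metric_signature hg Aphi Oy.
- by move=> y Oy; exact: lorentz_unit (metric_signature hg Aphi Oy).
- move=> u du; apply: inj_row_free => v vD.
  have [Uu cu] := du.
  have Df : differentiable (loc phi) u.
    by apply: differentiable_row => a; case: (Ck2_C1mx (@dom_open phi) C2 0 a du).
  apply: (inj u Uu cu); rewrite linear0 (diff_row _ Df) -[RHS]vD.
  apply/rowP => a; rewrite summxE [RHS]mxE; apply: eq_bigr => i _.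
  by rewrite [LHS]mxE [frame _ _ _ _]mxE.
- move=> u [Uu cu]; rewrite -(hl Aphi Uu cu) /B_F; congr (\det _).
  apply/matrixP => i j; rewrite [RHS]mxE.
  rewrite /gform /first_form [LHS]mxE [RHS]mxE; apply: eq_bigr => b _.
  rewrite [X in X * _ = _]mxE [X in _ = X * _]mxE; congr (_ * _); last first.
    by rewrite [LHS]mxE [LHS]mxE [RHS]mxE.
  by apply: eq_bigr => a _; rewrite [X in X * _ = _]mxE.
Qed.

Lemma transition_open psi phi : open (transition_dom psi phi).
Proof.
rewrite openE => y [p [psip phip] <-].
have oC : open (ccod psi) by exact: ccod_open.
have Cp : ccod psi (cmap psi p) by exists p.
have ci : {for cmap psi p, continuous (cinv psi)}.
  have := @cinv_continuous _ _ _ psi.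
  by rewrite continuous_open_subspace // => /(_ (cmap psi p)); rewrite inE; exact.
have nP : nbhs (cmap psi p) (cinv psi @^-1` cdom phi).
  by apply: ci; rewrite cmapK //; apply: open_nbhs_nbhs; split=> //; exact: cdom_open.
apply: filterS2 (near_in_open oC Cp) nP => z [q qD <-] qP.
by exists q => //; split=> //; move: qP; rewrite /= cmapK.
Qed.

Lemma transition_range psi phi y : transition_dom psi phi y -> ccod phi (transition psi phi y).
Proof. by move=> [p [psip phip] <-]; exists p => //=; rewrite /transition /= cmapK. Qed.

Lemma transition_sub psi phi : transition_dom psi phi `<=` ccod psi.
Proof. by move=> y [p [psip phip] <-]; exists p. Qed.

Lemma transition_C2 psi phi : A psi -> A phi -> Ck 2 (transition_dom psi phi) (transition psi phi).
Proof.
move=> Apsi Aphi; apply: (Ck_row (@transition_open psi phi)) => j.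
by have [C _] := atlas_analytic hM Apsi Aphi j; exact: C.
Qed.

(** The metric transforms by the jacobian matrix of the differential, while [momentum_change] and
[is_derive_curve] use the matrix of the partial derivatives. *)
Lemma transition_jacobian psi phi y : A psi -> A phi -> transition_dom psi phi y ->
  'J (transition psi phi) y = frame (transition psi phi) y.
Proof.
move=> Apsi Aphi Ty; have C2 := transition_C2 Apsi Aphi.
have D : differentiable (transition psi phi) y.
  by apply: differentiable_row => a; case: (Ck2_C1mx (@transition_open psi phi) C2 0 a Ty).
by apply/row_matrixP => i; rewrite rowE -(deriveEjacobian _ D); apply/rowP => a; rewrite [RHS]mxE [RHS]mxE.
Qed.

Lemma metric_frame psi phi y : A psi -> A phi -> transition_dom psi phi y ->
  g psi y = frame (transition psi phi) y *m g phi (transition psi phi y)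
              *m (frame (transition psi phi) y)^T.
Proof.
move=> Apsi Aphi Ty; rewrite [LHS](metric_change hg Apsi Aphi Ty).
by rewrite (transition_jacobian Apsi Aphi Ty).
Qed.

Lemma loc_transition psi phi u : dom psi u -> loc phi u = transition psi phi (loc psi u).
Proof. by move=> [_ pu]; rewrite /transition /loc /= cmapK. Qed.

Lemma loc_transition_dom psi phi u : dom psi u -> dom phi u -> transition_dom psi phi (loc psi u).
Proof. by move=> [_ pu] [_ qu]; exists (F u). Qed.

Lemma frame_transition psi phi u : A psi -> A phi -> dom psi u -> dom phi u ->
  frame (loc phi) u = frame (loc psi) u *m frame (transition psi phi) (loc psi u).
Proof.
move=> Apsi Aphi du eu.
have Dt a : differentiable (fun y => transition psi phi y 0 a) (loc psi u).
  by case: (Ck2_C1mx (@transition_open psi phi) (transition_C2 Apsi Aphi) 0 a (loc_transition_dom du eu)).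
apply/row_matrixP => i; rewrite row_mul.
have Dl : is_derive u (delta_mx 0 i) (loc psi) (row i (frame (loc psi) u)).
  have -> : row i (frame (loc psi) u) = pd i (loc psi) u.
    by apply/rowP => a; rewrite [LHS]mxE [LHS]mxE.
  apply: is_derive_pd; apply: differentiable_row => a.
  by case: (Ck2_C1mx (@dom_open psi) (null_C2 (chart_null Apsi)) 0 a du).
have Dc := is_derive_curve Dt Dl.
have Dp : is_derive u (delta_mx 0 i) (loc phi) (row i (frame (loc psi) u) *m frame (transition psi phi) (loc psi u)).
  apply: near_eq_is_derive Dc; apply: filterS (near_in_open (@dom_open psi) du) => v dv.
  by rewrite (loc_transition phi dv).
by rewrite -(pd_val Dp); apply/rowP => a; rewrite [LHS]mxE [LHS]mxE.
Qed.

Lemma first_form_transition psi phi u : A psi -> A phi -> dom psi u -> dom phi u ->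
  first_form (g phi) (loc phi) u = first_form (g psi) (loc psi) u.
Proof.
move=> Apsi Aphi du eu; rewrite /first_form (frame_transition Apsi Aphi du eu).
rewrite (metric_frame Apsi Aphi (loc_transition_dom du eu)) (loc_transition phi du).
by rewrite trmx_mul !mulmxA.
Qed.

(** In the chart [phi], the velocity of [c] lies in the kernel of the first fundamental form and the
image of [c] obeys the geodesic equation at [s]. *)
Definition germ_in phi c (s : R) : Prop :=
  [/\ \forall r \near s, [/\ dom phi (c r), derivable c r 1
        & derive1 c r *m first_form (g phi) (loc phi) (c r) = 0],
      derive1 c s != 0 & momentum_law (g phi) (loc phi \o c) s].

Definition light_germ c (s : R) : Prop := exists2 phi, A phi & germ_in phi c s.

Lemma loc_derivable psi c (s : R) : A psi -> dom psi (c s) -> derivable c s 1 ->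
  is_derive s 1 (loc psi \o c) (derive1 c s *m frame (loc psi) (c s)).
Proof.
move=> Apsi ds D; apply: is_derive_curve; last exact: is_derive_derive1.
by move=> a; case: (Ck2_C1mx (@dom_open psi) (null_C2 (chart_null Apsi)) 0 a ds).
Qed.

(** The transition maps are of class C^2, so [momentum_change] applies to them. *)
Lemma germ_change phi psi c (s : R) : A phi -> A psi -> germ_in phi c s -> cdom psi (F (c s)) ->
  germ_in psi c s.
Proof.
move=> Aphi Apsi [nb c0 ML] cs.
have [[Us _] Dcs _] := nbhs_singleton nb.
have npsi : \forall r \near s, dom psi (c r).
  by apply: (near_comp_open (@dom_open psi)).
have [NCphi NCpsi] := (chart_null Aphi, chart_null Apsi).
split; [|exact: c0|].
  apply: filterS2 nb npsi => r [dr Dr Nr] er; split; [exact: er|exact: Dr|].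
  by rewrite (first_form_transition Aphi Apsi dr er).
have nT : \forall r \near s, transition_dom psi phi ((loc psi \o c) r) /\ derivable (loc psi \o c) r 1.
  apply: filterS2 nb npsi => r [dr Dr Nr] er; split; first exact: loc_transition_dom.
  by have [] := loc_derivable Apsi er Dr.
apply: (momentum_change (@transition_open psi phi) (transition_C2 Apsi Aphi)
  (@transition_range psi phi) (null_metric NCpsi) (null_metric NCphi) (@transition_sub psi phi)
  (null_sym NCpsi) (null_sym NCphi) _ nT).
  by move=> y Ty; exact: metric_frame.
apply: momentum_law_near ML; apply: filterS npsi => r er.
by rewrite /= (loc_transition phi er).
Qed.

Lemma germ_in_local phi c c' (s : R) : (\forall r \near s, c r = c' r) -> germ_in phi c s -> germ_in phi c' s.
Proof.
move=> cc [nb c0 ML]; split.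
- apply: filterS2 nb (near_near cc) => r [dr Dr Nr] cr.
  rewrite -(nbhs_singleton cr) -(eq_derive1_near cr); split; [exact: dr| |exact: Nr].
  exact: near_eq_derivable cr Dr.
- by rewrite -(eq_derive1_near cc).
- by apply: momentum_law_near ML; apply: filterS cc => r cr /=; rewrite cr.
Qed.

Lemma germ_in_affine phi c (a b s : R) : A phi -> a != 0 -> germ_in phi c (a * s + b) ->
  germ_in phi (fun r => c (a * r + b)) s.
Proof.
move=> Aphi a0 [nb c0 ML]; have [_ Ds _] := nbhs_singleton nb; split.
- apply: filterS (near_affine nb) => r [dr Dr Nr]; split; first exact: dr.
    by have [] := is_derive_affine (is_derive_derive1 Dr).
  by rewrite (derive1_affine Dr) -scalemxAl Nr scaler0.
- by rewrite (derive1_affine Ds) scaler_eq0 negb_or a0.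
- apply: (momentum_law_affine _ ML).
  apply: filterS nb => r [dr Dr _].
  by have [] := loc_derivable Aphi dr Dr.
Qed.

(** Germs at a common point are compared in the same chart by [germ_change]; then both velocities lie
in the line of [kernel_line]. *)
Lemma light_germs : curve_germs U light_germ.
Proof.
split.
- by move=> c c' s cc [phi Aphi H]; exists phi; [exact: Aphi|exact: germ_in_local H].
- by move=> c a b s a0 [phi Aphi H]; exists phi; [exact: Aphi|exact: germ_in_affine].
- move=> c s [phi Aphi [nb c0 _]]; have [[Us _] D _] := nbhs_singleton nb.
  by split; [exact: Us|exact: D|exact: c0].
- move=> c1 c2 s1 s2 [phi Aphi [nb1 _ _]] [psi Apsi H2] E.
  have [d1 _ N1] := nbhs_singleton nb1.
  have [|nb2 c20 _] := germ_change Apsi Aphi H2; first by rewrite -E; exact: d1.2.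
  have [_ _ N2] := nbhs_singleton nb2; rewrite -E in N2.
  exact: (kernel_line (chart_null Aphi) d1 N1 N2 c20).
Qed.

(** In the chart [phi] around [F p], light germs are the curves with the speed law of the null
field. *)
Lemma light_box p : U p -> exists V h k, V p /\ curve_box U light_germ V h k.
Proof.
move=> Up; have [phi Aphi cp] := atlas_cover hM (F p).
have dp : dom phi p by [].
have [W [j0 [X [lam [Wp WV NF]]]]] := null_field_exists (chart_null Aphi) dp.
have WU : W `<=` U by move=> u /WV[].
apply: (box_of_flow (field_open NF) WU Wp (field_C1 NF) (field_unit NF) (field_cont NF)) => c s Ws.
split=> [[psi Apsi H]|[nb c0 D]].
  have [nb c0 ML] := germ_change Apsi Aphi H (WV _ Ws).2.
  have [_ Ds Ns] := nbhs_singleton nb.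
  have nW : \forall r \near s, W (c r) by exact: (near_comp_open (field_open NF)).
  have nX : \forall r \near s, W (c r) /\ is_derive r 1 c (derive1 c r 0 j0 *: X (c r)).
    apply: filterS2 nb nW => r [dr Dr Nr] Wr; split; first exact: Wr.
    by rewrite -(field_line NF Wr Nr); exact: is_derive_derive1.
  split; first exact: nX.
    by apply: contraNneq c0 => z; rewrite (field_line NF Ws Ns) z scale0r.
  exact: (speed_of_momentum (chart_null Aphi) WV NF nX ML).
exists phi; first exact: Aphi.
split.
- apply: filterS nb => r [Wr Dr]; split; [exact: WV|by case: Dr|].
  by rewrite (derive1_val Dr) -scalemxAl (field_null NF Wr) scaler0.
- by apply: contraNneq c0 => ->; rewrite mxE.
- exact: (momentum_of_speed (chart_null Aphi) WV NF nb D).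
Qed.

Lemma light_geodesic (I : set R) c : good_curve light_germ I c -> {within I, continuous c} ->
  light_like_geodesic A g I (F \o c).
Proof.
move=> [oI _ GI] cc.
have key phi t : A phi -> I t -> cdom phi (F (c t)) -> germ_in phi c t.
  by move=> Aphi It ct; have [psi Apsi H] := GI t It; exact: germ_change Apsi Aphi H ct.
split; first split.
- rewrite continuous_open_subspace // => t; rewrite inE => It.
  have ct : {for t, continuous c}.
    by move: cc; rewrite continuous_open_subspace // => /(_ t); rewrite inE; exact.
  have [psi Apsi [nb _ _]] := GI t It; have [[Ut _] _ _] := nbhs_singleton nb.
  exact: continuous_comp ct (immersion_continuous Ut).
- move=> phi Aphi t It ct x.
  have [nb _ ML] := key phi t Aphi It ct.
  have NC := chart_null Aphi.
  have nO : \forall r \near t, ccod phi (x r) /\ derivable x r 1.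
    apply: filterS nb => r [dr Dr _]; split; first exact: (null_range NC dr).
    by have [] := loc_derivable Aphi dr Dr.
  have [D2 E] := geodesic_of_momentum (@ccod_open _ _ _ phi) (null_metric NC) (null_sym NC) (null_unit NC) nO ML.
  have [_ D1] := nbhs_singleton nO.
  by split; [exact: D1|exact: D2|exact: E].
- move=> phi Aphi t It ct x.
  have [nb c0 _] := key phi t Aphi It ct.
  have [dt Dt Nt] := nbhs_singleton nb.
  have E := derive1_val (loc_derivable Aphi dt Dt).
  have {E} -> : derive1 x t = derive1 c t *m frame (loc phi) (c t) by exact: E.
  split.
    apply: contra_neq c0 => z; apply: (row_free_inj (null_free (chart_null Aphi) dt)).
    by rewrite z mul0mx.
  rewrite /gform trmx_mul !mulmxA.
  have -> : derive1 c t *m frame (loc phi) (c t) *m g phi (x t) *m (frame (loc phi) (c t))^T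
      = 0 by rewrite -Nt /first_form !mulmxA.
  by rewrite mul0mx mxE.
Qed.

Lemma light_like_foliation : foliated_by_light_like_geodesics A g U F.
Proof.
have [leaves [fol H]] := foliation_of_germs light_germs light_box.
exists leaves; split; first exact: fol.
move=> L LL; have [I [c [GI cc E]]] := H L LL; exists I, c.
have [oI iI _] := GI.
by split; [exact: oI|exact: iI|exact: cc|exact: E|exact: light_geodesic].
Qed.
End Hypersurface.
Theorem corollaryB (R : realType) (n r : nat) (hn : (2 <= n)%N) (hr : (3 <= r)%N)
  (M : topologicalType) (A : set (chart R n.+1 M))
  (g : chart R n.+1 M -> 'rV[R]_n.+1 -> 'M[R]_n.+1)
  (hM : oriented_analytic_manifold A) (hg : lorentz_metric r A g)
  (U : set 'rV[R]_n) (hU0 : U !=set0) (hUo : open U) (hUc : connected U)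
  (F : 'rV[R]_n -> M) (hF : Ck_immersion 2 A U F) (hl : light_like A g U F) :
  foliated_by_light_like_geodesics A g U F.
Proof.
case: n hn A g hM hg U hU0 hUo hUc F hF hl => [//|n] _ A g hM hg U _ hUo _ F hF hl.
exact: light_like_foliation hr hM hg hUo hF hl.
Qed.
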